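(* Let $p>3$ be an odd prime. Then $$\sum_{m=1}^{p-1}\sum_{n=1}^{p-1}\left|C(m,n,4,2;p)\right|^4\cdot S^2(m\overline{n},p) = \begin{cases} \dfrac{35}{144}p^5+O\!\left(p^4\exp\!\left(\dfrac{3\ln p}{\ln\ln p}\right)\right), & \text{if } p\equiv 3 \pmod 4,\\[2ex] \dfrac{35}{144}p^5+O\!\left(p^{9/2}\exp\!\left(\dfrac{3\ln p}{\ln\ln p}\right)\right), & \text{if } p\equiv 1 \pmod 4.\end{cases}$$
   Context: For a positive integer $q\ge 3$, integers $m,n$ and positive integers $k,h$, the two-term exponential sum is $C(m,n,k,h;q)=\sum_{a=0}^{q-1} e\!\left(\frac{ma^k+na^h}{q}\right)$, where $e(y)=e^{2\pi i y}$. For a positive integer $q$ and an integer $h$ coprime to $q$, the Dedekind sum is $S(h,q)=\sum_{a=0}^{q-1}\left(\left(\frac{a}{q}\right)\right)\left(\left(\frac{ah}{q}\right)\right)$, where $((x))=x-[x]-\frac12$ if $x$ is not an integer and $((x))=0$ if $x$ is an integer ($[x]$ the greatest integer $\le x$). For $n$ coprime to $p$, $\overline{n}$ denotes the inverse of $n$ modulo $p$, i.e. $n\overline{n}\equiv 1 \pmod p$. The implied constants in $O(\cdot)$ are absolute. *)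

(* Defs.v *)
From Stdlib Require Import Reals ZArith Znumtheory Arith.
From Coquelicot Require Import Coquelicot.
Open Scope R_scope.

Fixpoint rsum (n : nat) (f : nat -> R) : R :=
  match n with O => 0 | S k => rsum k f + f k end.

Fixpoint csum (n : nat) (f : nat -> C) : C :=
  match n with O => 0%C | S k => Cplus (csum k f) (f k) end.

Definition e (y : R) : C := (cos (2 * PI * y), sin (2 * PI * y)).

Definition twoTermSum (m n : Z) (k h q : nat) : C :=
  csum q (fun a => e ((IZR m * INR a ^ k + IZR n * INR a ^ h) / INR q)).

Definition floorR (x : R) : Z := Int_part x.

Definition saw (x : R) : R :=
  if Req_EM_T x (IZR (floorR x)) then 0 else x - IZR (floorR x) - 1/2.

Definition dedekind (h : Z) (q : nat) : R :=
  rsum q (fun a => saw (INR a / INR q) * saw (INR a * IZR h / INR q)).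

(* inverse of n modulo p: the (unique for prime p, p ∤ n) k in [1, p-1]
   with n k ≡ 1 (mod p) *)
Fixpoint find_inv (p n k : nat) : nat :=
  match k with
  | O => O
  | S k' => if Nat.eqb ((n * S k') mod p) 1 then S k' else find_inv p n k'
  end.
Definition invmod (p n : nat) : nat := find_inv p n (p - 1).

(* Main.v *)
(**
Write [C] for the two-term sum and [χ] for the quadratic character. For fixed [c = m/n] the sum of
[|C(cn, n)|^4] over [n] is [p N_k - p^4], where [k = 1/(2c)] and [N_k] counts, each coordinate [X] with weight
[1 + χ(X - k)], the points of the cone [X^2 + Y^2 = U^2 + V^2]. The cone is a union of planes indexed by
the projective line, and summing the weights plane by plane gives
[N_k = p^3 + 7 p^2 + p χ(k) θ + O(p)], where [θ] is a combination of character sums of cubics,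
hence [O(sqrt p)] by Stepanov's elementary method.

Consequently the main term is [7 p^3] times the sum of [S(c, p)^2], and the secondary term is [p^2 θ] times
the sum of [χ(2c) S(c, p)^2], which vanishes for [p = 3 mod 4], since there [χ] is odd while [S^2] is even.

For the sum of [S(c, p)^2], write [S] as a correlation of the function [l -> cot (π l / p)], and replace the
cotangent by [p / (π l)]. The square mean of the correlation then counts solutions of [a d = ± b c mod p] with
[1 <= a, b, c, d <= p/2], weighted by [1/(abcd)]. The true equalities [a d = b c] contribute
[ζ(2)^4 / ζ(4)] up to [O(log^2 p / p)], which yields [5/144 p^2]; the remaining solutions are bounded by the
divisor function of integers below [p^2], whence the factor [exp (3 ln p / ln ln p)].
*)

Require Import Defs.
From Stdlib Require Import Reals ZArith Znumtheory Arith Lra Lia.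
From Coquelicot Require Import Coquelicot.
From mathcomp Require all_boot all_order all_algebra all_field Rstruct.
From mathcomp Require ring lra zify.
Open Scope R_scope.

(** * Real estimates *)

(** For [p = 3 mod 4] the cone must be counted with error [O(p)]. The fourfold products of
    characters contribute [infinity_sum r] on each plane; a bound [O(sqrt p)] for each [r] would
    only give [p^(3/2)] in total, so the sum over [r] is taken first, and it turns into the square
    of one cubic sum plus [O(p)]. The zeta values are derived along the way. The sums of [cot^2],
    [csc^2] and [csc^4] over the residues have closed forms, and [cot x <= 1/x] together with
    [1/x^2 <= 1 + cot^2 x] squeezes the partial sums of [1/i^2] and [1/i^4] up to [p/2]. The energy
    estimate also meets partial sums up to [(p/2)^2]; these are bounded by the same argument for a
    larger prime. Over the finite field only a pair of functions [co], [si] with the addition laws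
    occurs, with values in an arbitrary ordered field, and [pi] enters through inequalities.
    Logarithms and exponentials stay outside that part; the powers of [ln p] fit in because the
    divisor bound has exponent [4 ln 2 < 3]. *)

Lemma x_cos_le_sin x : 0 <= x <= PI / 2 -> x * cos x <= sin x.
Proof.
intros [x0 x1].
destruct (MVT_gen (fun t => sin t - t * cos t) 0 x (fun t => t * sin t)) as [c [[c0 c1] E]].
- intros t Ht. auto_derive; trivial. ring.
- intros t Ht. apply continuity_pt_minus.
  + apply continuity_sin.
  + apply continuity_pt_mult; [apply continuity_pt_id | apply continuity_cos].
- rewrite Rmin_left in c0 by lra. rewrite Rmax_right in c1 by lra.
  rewrite sin_0 in E.
  assert (0 <= sin c) by (apply sin_ge_0; pose proof PI_RGT_0; lra).
  assert (0 <= c * sin c * (x - 0)) by (apply Rmult_le_pos; [apply Rmult_le_pos|]; lra).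
  lra.
Qed.

(* [cot x = (1 + cos 2x) / sin 2x]; the upper bound on [1/x - cot x] is [tan (x/2) <= 1]. *)
Lemma cotangent_estimates x : 0 < x < PI / 2 ->
  let c := (1 + cos (2 * x)) / sin (2 * x) in
  0 <= c /\ c <= / x /\ / x <= c + 1 /\ (/ x) ^ 2 <= 1 + c ^ 2.
Proof.
intros [x0 x1] c.
assert (s0 : 0 < sin x) by (apply sin_gt_0; lra).
assert (c0 : 0 < cos x) by (apply cos_gt_0; lra).
assert (cE : c = cos x / sin x).
{ unfold c. rewrite cos_2a_cos, sin_2a. field. lra. }
assert (sx : sin x <= x) by (apply Rlt_le, sin_lt_x; lra).
assert (xc : x * cos x <= sin x) by (apply x_cos_le_sin; lra).
assert (p1 : sin x * sin x + cos x * cos x = 1) by (pose proof (sin2_cos2 x) as H; unfold Rsqr in H; lra).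
assert (cs : 1 - cos x <= sin x).
{ assert (cos x <= 1) by apply COS_bound. nra. }
assert (ix : 0 < / x) by (apply Rinv_0_lt_compat; lra).
assert (is : 0 < / sin x) by (apply Rinv_0_lt_compat; lra).
rewrite cE. repeat split.
- apply Rlt_le, Rdiv_lt_0_compat; lra.
- apply Rmult_le_reg_l with (x * sin x); [nra|].
  replace (x * sin x * (cos x / sin x)) with (x * cos x) by (field; lra).
  replace (x * sin x * / x) with (sin x) by (field; lra). lra.
- apply Rmult_le_reg_l with (x * sin x); [nra|].
  replace (x * sin x * / x) with (sin x) by (field; lra).
  replace (x * sin x * (cos x / sin x + 1)) with (x * (cos x + sin x)) by (field; lra).
  nra.
- replace (1 + (cos x / sin x) ^ 2) with ((/ sin x) ^ 2 * (sin x * sin x + cos x * cos x)) by (field; lra).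
  rewrite p1, Rmult_1_r. apply pow_incr. split; [lra|].
  apply Rinv_le_contravar; lra.
Qed.

Lemma PI_bounds_3_4 : 3 <= PI <= 4.
Proof. split; [pose proof PI2_3_2; lra | pose proof PI_4; lra]. Qed.

Lemma inv_succ_le_ln n : / INR (S (S n)) <= ln (INR (S (S n))) - ln (INR (S n)).
Proof.
set (b := INR (S n)). assert (b0 : 0 < b) by (apply lt_0_INR; lia).
assert (E : INR (S (S n)) = b + 1) by (unfold b; rewrite (S_INR (S n)); ring).
rewrite E.
pose proof (exp_ineq1_le (ln b - ln (b + 1))) as H.
unfold Rminus in H. rewrite exp_plus, exp_Ropp, !exp_ln in H by lra.
assert (b * / (b + 1) = 1 - / (b + 1)) by (field; lra). lra.
Qed.

Lemma exp_pow_INR a n : exp a ^ n = exp (INR n * a).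
Proof.
induction n as [|n IH]; [simpl; rewrite Rmult_0_l, exp_0; reflexivity|].
rewrite S_INR, Rmult_plus_distr_r, Rmult_1_l, exp_plus, <- IH. simpl. ring.
Qed.

(** What matters is [4 * 0.74 = 2.96 < 3]: the remaining 0.04 absorbs all lower-order factors of the
    divisor bound. The value holds because [(1 + 0.74/8)^8 > 2]. *)
Lemma ln_2_le : ln 2 <= 74 / 100.
Proof.
replace 2 with (exp (ln 2)) at 1 by (apply exp_ln; lra).
rewrite ln_exp. apply Rnot_lt_le. intros H.
assert (E : exp (74 / 100) = exp (74 / 800) ^ 8) by (rewrite exp_pow_INR; f_equal; simpl; lra).
pose proof (exp_ineq1_le (74 / 800)) as H1.
assert (H2 : (1 + 74 / 800) ^ 8 <= exp (74 / 800) ^ 8) by (apply pow_incr; lra).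
apply exp_increasing in H. rewrite E, exp_ln in H by lra. simpl in H2. lra.
Qed.

Lemma pow_le_exp x a n : 0 <= x -> x <= exp a -> x ^ n <= exp (INR n * a).
Proof.
intros x0 H. rewrite <- exp_pow_INR. apply pow_incr. split; assumption.
Qed.

Lemma pow_le_ln (y k : nat) (z : R) : (1 < y)%nat -> INR y ^ k <= z -> INR k * ln (INR y) <= ln z.
Proof.
intros y1 H. assert (1 < INR y) by (apply (lt_INR 1); assumption).
assert (0 < INR y ^ k) by (apply pow_lt; lra).
rewrite <- ln_pow by lra. apply ln_le; assumption.
Qed.

(* The choice [y ~ sqrt (ln p)] makes the divisor bound [T ^ y * 2 ^ K] of size
   [exp ((4 ln 2 + o(1)) ln p / ln ln p)], and [4 ln 2 < 3]. *)
Lemma divisor_bound_growth : exists C : R, 0 < C /\ forall p : nat, (4 < p)%nat ->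
  exists y : nat, (1 < y)%nat /\ forall t K : nat,
  2 ^ t <= INR p ^ 2 -> INR y ^ K <= INR p ^ 2 ->
  (1 + ln (INR p)) ^ 3 * (INR (S t) ^ y * 2 ^ K) <= C * exp (3 * ln (INR p) / ln (ln (INR p))).
Proof.
exists (exp (63 * 113 ^ 5)). split; [apply exp_pos|]. intros p p5.
set (u := ln (INR p)).
assert (P5 : 5 <= INR p) by (replace 5 with (INR 5) by (simpl; ring); apply le_INR; lia).
assert (u1 : 1 < u).
{ apply exp_lt_inv. unfold u. rewrite exp_ln by lra. pose proof exp_le_3. lra. }
assert (l0 : 0 < ln u) by (rewrite <- ln_1; apply ln_increasing; lra).
(* [v] is the eighth root of [u = ln p]. With [y] about [v^4] the lower-order factors are
   [exp (O(v^5))], while the slack [0.04 u / ln u] is at least [0.005 v^7] because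
   [ln u = 8 ln v <= 8 v]. *)
set (v := exp (ln u / 8)).
assert (v1 : 1 < v) by (rewrite <- exp_0; apply exp_increasing; lra).
assert (uv : u = v ^ 8).
{ unfold v. rewrite exp_pow_INR. replace (INR 8 * (ln u / 8)) with (ln u) by (simpl; field). rewrite exp_ln; lra. }
assert (lv : ln u = 8 * ln v) by (unfold v; rewrite ln_exp; field).
assert (lnv : ln v <= v) by (pose proof (exp_ineq1_le (ln v)) as H; rewrite exp_ln in H; lra).
assert (v5 : v <= v ^ 5) by (rewrite <- (pow_1 v) at 1; apply Rle_pow; [lra|lia]).
assert (v4 : 1 <= v ^ 4) by (apply pow_R1_Rle; lra).
destruct (archimed (v ^ 4)) as [ya yb].
assert (yz : (2 <= up (v ^ 4))%Z).
{ assert (1 < up (v ^ 4))%Z by (apply lt_IZR; lra). lia. }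
exists (Z.to_nat (up (v ^ 4))).
set (y := Z.to_nat (up (v ^ 4))).
assert (yR : INR y = IZR (up (v ^ 4))) by (unfold y; rewrite INR_IZR_INZ, Z2Nat.id by lia; reflexivity).
split; [unfold y; lia|]. intros t K Ht HK.
assert (y1 : (1 < y)%nat) by (unfold y; lia).
assert (p2 : ln (INR p ^ 2) = 2 * u) by (rewrite ln_pow by lra; unfold u; simpl; ring).
assert (tb : INR t <= 4 * u).
{ pose proof (pow_le_ln 2 t (INR p ^ 2) ltac:(lia) Ht) as H. rewrite p2 in H. simpl (INR 2) in H.
  pose proof ln_lt_2 as H2. pose proof (pos_INR t).
  replace (1 + 1) with 2 in H by ring. nra. }
assert (Tb : INR (S t) <= exp (12 * v)).
{ apply Rle_trans with (5 * u); [rewrite S_INR; lra|].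
  replace (12 * v) with (4 * v + 8 * v) by ring. rewrite exp_plus. apply Rmult_le_compat; try lra.
  - pose proof (exp_ineq1_le (4 * v)). lra.
  - rewrite <- (exp_ln u) by lra. rewrite lv.
    destruct (Rle_lt_or_eq_dec (8 * ln v) (8 * v)) as [h|h]; [lra| |rewrite h; lra].
    apply Rlt_le, exp_increasing; lra. }
assert (Kb : INR K * ln 2 <= 296 / 100 * (u / ln u)).
{ pose proof (pow_le_ln y K (INR p ^ 2) y1 HK) as H. rewrite p2 in H.
  assert (ly : ln u / 2 <= ln (INR y)).
  { apply Rle_trans with (ln (v ^ 4)); [rewrite ln_pow by lra; rewrite lv; simpl; lra|].
    apply ln_le; lra. }
  pose proof (pos_INR K) as K0. pose proof ln_2_le as l2.
  assert (K1 : INR K * (ln u / 2) <= 2 * u).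
  { apply Rle_trans with (INR K * ln (INR y)); [apply Rmult_le_compat_l; assumption|exact H]. }
  assert (K2 : INR K <= 4 * (u / ln u)).
  { apply Rmult_le_reg_r with (ln u / 2); [lra|].
    replace (4 * (u / ln u) * (ln u / 2)) with (2 * u) by (field; lra). exact K1. }
  pose proof ln_lt_2. nra. }
assert (E1 : (1 + u) ^ 3 <= exp (27 * v)).
{ replace (27 * v) with (INR 3 * (9 * v)) by (simpl; ring). apply pow_le_exp; [lra|].
  apply Rle_trans with (2 * u); [lra|].
  replace (9 * v) with (v + 8 * v) by ring. rewrite exp_plus. apply Rmult_le_compat; try lra.
  - pose proof (exp_ineq1_le v). lra.
  - rewrite <- (exp_ln u) by lra. rewrite lv.
    destruct (Rle_lt_or_eq_dec (8 * ln v) (8 * v)) as [h|h]; [lra| |rewrite h; lra].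
    apply Rlt_le, exp_increasing; lra. }
assert (E2 : INR (S t) ^ y <= exp (INR y * (12 * v))) by (apply pow_le_exp; [apply pos_INR|exact Tb]).
assert (E3 : 2 ^ K = exp (INR K * ln 2)).
{ rewrite <- exp_pow_INR, exp_ln by lra. reflexivity. }
apply Rle_trans with (exp (27 * v) * (exp (INR y * (12 * v)) * exp (INR K * ln 2))).
{ apply Rmult_le_compat.
  - apply pow_le; lra.
  - apply Rmult_le_pos; apply pow_le; [apply pos_INR|lra].
  - exact E1.
  - rewrite E3. apply Rmult_le_compat_r; [apply Rlt_le, exp_pos|exact E2]. }
rewrite <- !exp_plus.
assert (yv : INR y * (12 * v) <= 36 * v ^ 5).
{ replace (36 * v ^ 5) with (3 * v ^ 4 * (12 * v)) by ring. apply Rmult_le_compat_r; lra. }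
assert (Q : 5 / 1000 * v ^ 7 <= 4 / 100 * (u / ln u)).
{ apply Rmult_le_reg_r with (ln u); [lra|].
  replace (4 / 100 * (u / ln u) * ln u) with (4 / 100 * u) by (field; lra).
  rewrite lv, uv. replace (v ^ 8) with (v ^ 7 * v) by ring.
  assert (0 < v ^ 7) by (apply pow_lt; lra). nra. }
(* The coefficient 63 is 27 + 36, from the power of the logarithm and from the small primes. Beyond
   113 one has [v^2 >= 12769 > 63 / 0.005]; below it the constant [63 * 113^5] takes over. *)
assert (G : 63 * v ^ 5 <= 63 * 113 ^ 5 + 5 / 1000 * v ^ 7).
{ destruct (Rle_lt_dec v 113) as [h|h].
  - assert (H : v ^ 5 <= 113 ^ 5) by (apply pow_incr; lra).
    assert (0 < v ^ 7) by (apply pow_lt; lra).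
    revert H. generalize (113 ^ 5). intros c Hc. lra.
  - assert (0 < v ^ 5) by (apply pow_lt; lra).
    assert (63 * v ^ 5 <= 5 / 1000 * v ^ 7).
    { replace (v ^ 7) with (v ^ 5 * (v * v)) by ring.
      assert (vv : 12769 <= v * v) by nra.
      assert (0 <= v ^ 5 * (v * v - 12769)) by (apply Rmult_le_pos; lra). lra. }
    assert (c0 : 0 < 113 ^ 5) by (apply pow_lt; lra).
    revert c0. generalize (113 ^ 5). intros c c0. lra. }
replace (3 * u / ln u) with (296 / 100 * (u / ln u) + 4 / 100 * (u / ln u)) by (field; lra).
destruct (Rle_lt_or_eq_dec (27 * v + (INR y * (12 * v) + INR K * ln 2))
   (63 * 113 ^ 5 + (296 / 100 * (u / ln u) + 4 / 100 * (u / ln u)))) as [h|h].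
- revert G. generalize (113 ^ 5). intros c G. lra.
- apply Rlt_le, exp_increasing, h.
- rewrite h. apply Rle_refl.
Qed.

(** * Two-term sums, sawtooth values and cotangents at the angles [2 pi n / p] *)

Definition angle (p n : nat) : R := 2 * PI * INR n / INR p.

Lemma angle_plus p m n : (0 < p)%nat -> angle p (m + n) = angle p m + angle p n.
Proof.
intros p0. assert (INR p <> 0) by (apply not_0_INR; lia).
unfold angle. rewrite plus_INR. field. assumption.
Qed.

Lemma angle_mult p q : (0 < p)%nat -> angle p (q * p) = 2 * INR q * PI.
Proof.
intros p0. assert (INR p <> 0) by (apply not_0_INR; lia).
unfold angle. rewrite mult_INR. field. assumption.
Qed.

Lemma cos_angle_mod p n : (0 < p)%nat -> cos (angle p (n mod p)) = cos (angle p n).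
Proof.
intros p0. rewrite (Nat.div_mod_eq n p) at 2. rewrite Nat.mul_comm, Nat.add_comm.
rewrite angle_plus, angle_mult, cos_period by assumption. reflexivity.
Qed.

Lemma sin_angle_mod p n : (0 < p)%nat -> sin (angle p (n mod p)) = sin (angle p n).
Proof.
intros p0. rewrite (Nat.div_mod_eq n p) at 2. rewrite Nat.mul_comm, Nat.add_comm.
rewrite angle_plus, angle_mult, sin_period by assumption. reflexivity.
Qed.

Lemma sin_angle_neq0 p n : (0 < n < p)%nat -> p <> (2 * n)%nat -> sin (angle p n) <> 0.
Proof.
intros [n0 np] odd H.
assert (P0 : 0 < INR p) by (apply lt_0_INR; lia).
assert (N0 : 0 < INR n) by (apply lt_0_INR; lia).
assert (NP : INR n < INR p) by (apply lt_INR; lia).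
pose proof PI_RGT_0 as pi0.
assert (E : angle p n * INR p = 2 * PI * INR n) by (unfold angle; field; lra).
assert (B : 0 < angle p n < 2 * PI).
{ split; apply Rmult_lt_reg_r with (INR p); try lra; rewrite ?E; nra. }
destruct (sin_eq_O_2PI_0 (angle p n)) as [h|[h|h]]; try lra.
apply odd, INR_eq. rewrite mult_INR. simpl (INR 2).
rewrite h in E. apply Rmult_eq_reg_l with PI; [|lra].
replace (PI * ((1 + 1) * INR n)) with (2 * PI * INR n) by ring. exact E.
Qed.

Lemma rsum_ext n f g : (forall i, (i < n)%nat -> f i = g i) -> rsum n f = rsum n g.
Proof.
intros H. induction n as [|n IH]; [reflexivity|]. simpl.
rewrite IH by (intros; apply H; lia). rewrite H by lia. reflexivity.
Qed.

Lemma csum_rsum n f : csum n f = (rsum n (fun i => fst (f i)), rsum n (fun i => snd (f i))).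
Proof.
induction n as [|n IH]; [reflexivity|]. simpl. rewrite IH. reflexivity.
Qed.

Lemma Cmod_pow4 z : Cmod z ^ 4 = (fst z ^ 2 + snd z ^ 2) ^ 2.
Proof.
unfold Cmod. replace (sqrt (fst z ^ 2 + snd z ^ 2) ^ 4) with
  ((sqrt (fst z ^ 2 + snd z ^ 2) ^ 2) ^ 2) by ring.
rewrite pow2_sqrt; [reflexivity|]. pose proof (pow2_ge_0 (fst z)). pose proof (pow2_ge_0 (snd z)). lra.
Qed.

Lemma twoTermSum_pow4 m n p :
  Cmod (twoTermSum (Z.of_nat m) (Z.of_nat n) 4 2 p) ^ 4 =
  (rsum p (fun a => cos (angle p (m * a ^ 4 + n * a ^ 2))) ^ 2 +
   rsum p (fun a => sin (angle p (m * a ^ 4 + n * a ^ 2))) ^ 2) ^ 2.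
Proof.
rewrite Cmod_pow4. unfold twoTermSum. rewrite csum_rsum. unfold fst at 1, snd at 1.
assert (A : forall a, 2 * PI * ((IZR (Z.of_nat m) * INR a ^ 4 + IZR (Z.of_nat n) * INR a ^ 2) / INR p) =
  angle p (m * a ^ 4 + n * a ^ 2)).
{ intros a. unfold angle. rewrite <- !INR_IZR_INZ, plus_INR, !mult_INR, !pow_INR. unfold Rdiv. ring. }
f_equal. f_equal; f_equal; apply rsum_ext; intros a _; cbv beta iota delta [e fst snd]; rewrite A; reflexivity.
Qed.

Lemma saw_ratio p k : (0 < p)%nat -> saw (INR k / INR p) =
  if Nat.eqb (k mod p) 0 then 0 else INR (k mod p) / INR p - 1 / 2.
Proof.
intros p0. assert (P0 : 0 < INR p) by (apply lt_0_INR; lia).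
assert (E : INR k / INR p = INR (k / p) + INR (k mod p) / INR p).
{ rewrite (Nat.div_mod_eq k p) at 1. rewrite plus_INR, mult_INR. field. lra. }
assert (r0 : 0 <= INR (k mod p) / INR p).
{ apply Rmult_le_pos; [apply pos_INR|]. apply Rlt_le, Rinv_0_lt_compat; assumption. }
assert (r1 : INR (k mod p) / INR p < 1).
{ apply Rmult_lt_reg_r with (INR p); [assumption|]. unfold Rdiv. rewrite Rmult_assoc, Rinv_l, Rmult_1_r, Rmult_1_l by lra.
  apply lt_INR, Nat.mod_upper_bound. lia. }
assert (F : floorR (INR k / INR p) = Z.of_nat (k / p)).
{ unfold floorR. symmetry. apply Int_part_spec. rewrite <- INR_IZR_INZ, E. lra. }
unfold saw. rewrite F, <- INR_IZR_INZ. destruct (Req_EM_T _ _) as [h|h]; destruct (Nat.eqb_spec (k mod p) 0) as [m|m].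
- reflexivity.
- exfalso. apply m. apply INR_eq. simpl (INR 0). rewrite E in h.
  assert (z : INR (k mod p) / INR p = 0) by lra.
  apply Rmult_eq_reg_r with (/ INR p); [|apply Rinv_neq_0_compat; lra]. rewrite Rmult_0_l. exact z.
- exfalso. apply h. rewrite E, m. simpl (INR 0). unfold Rdiv. ring.
- rewrite E. ring.
Qed.

Lemma dedekind_nat h p : dedekind (Z.of_nat h) p =
  rsum p (fun a => saw (INR a / INR p) * saw (INR (a * h) / INR p)).
Proof.
unfold dedekind. apply rsum_ext. intros a _. rewrite mult_INR, <- INR_IZR_INZ. reflexivity.
Qed.

Lemma find_inv_spec p n k j : (0 < j <= k)%nat -> ((n * j) mod p = 1)%nat ->
  ((n * find_inv p n k) mod p = 1)%nat.
Proof.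
induction k as [|k IH]; [lia|]. intros jk E. simpl.
destruct (Nat.eqb_spec ((n * S k) mod p)%nat 1) as [h|h]; [exact h|].
apply IH; [|exact E]. destruct (Nat.eq_dec j (S k)) as [->|]; [contradiction|lia].
Qed.

Lemma Rpower_nine_halves x : 0 < x -> Rpower x (9 / 2) = x ^ 4 * sqrt x.
Proof.
intros x0. replace (9 / 2) with (INR 4 + / 2) by (simpl; field).
rewrite Rpower_plus, Rpower_pow, Rpower_sqrt by assumption. reflexivity.
Qed.

Lemma add_inv_le_ln x n : x <= 1 + ln (INR (S n)) -> x + / INR (S (S n)) <= 1 + ln (INR (S (S n))).
Proof. intros H. pose proof (inv_succ_le_ln n). lra. Qed.

Lemma cotangent_angle_bounds p n : (0 < n)%nat -> (2 * n < p)%nat ->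
  let z := INR p / (PI * INR n) in
  let c := (1 + cos (angle p n)) / sin (angle p n) in
  0 <= c /\ c <= z /\ z <= c + 1 /\ z ^ 2 <= 1 + c ^ 2.
Proof.
intros n0 np z c. pose proof PI_RGT_0 as pi0.
assert (N0 : 0 < INR n) by (apply lt_0_INR; lia).
assert (P0 : 0 < INR p) by (apply lt_0_INR; lia).
assert (NP : 2 * INR n < INR p).
{ apply lt_INR in np. rewrite mult_INR in np. simpl (INR 2) in np. lra. }
set (x := PI * INR n / INR p).
assert (E : angle p n = 2 * x) by (unfold angle, x; field; lra).
assert (Z : z = / x) by (unfold z, x; field; lra).
unfold c. rewrite E, Z. apply cotangent_estimates.
split; apply Rmult_lt_reg_r with (INR p); try lra.
- rewrite Rmult_0_l. unfold x. replace (PI * INR n / INR p * INR p) with (PI * INR n) by (field; lra).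
  apply Rmult_lt_0_compat; lra.
- unfold x. replace (PI * INR n / INR p * INR p) with (PI * INR n) by (field; lra). nra.
Qed.

Lemma one_le_add_ln n : (0 < n)%nat -> 1 <= 1 + ln (INR n).
Proof.
intros n0. assert (1 <= INR n) by (apply (le_INR 1); lia).
pose proof (ln_le 1 (INR n)) as H1. rewrite ln_1 in H1. lra.
Qed.

Module FiniteField.
Import all_boot all_order all_algebra all_field ring lra zify.
Set Implicit Arguments. Unset Strict Implicit. Unset Printing Implicit Defensive.
Import Order.TTheory GRing.Theory Num.Theory.

(** * The divisor bound and the number of factorizations *)

Lemma size_divisors n : (0 < n)%N -> size (divisors n) = (\prod_(q <- primes n) (logn q n).+1)%N.
Proof.
move=> n0; rewrite /divisors.
have -> : (\prod_(q <- primes n) (logn q n).+1 = \prod_(f <- prime_decomp n) f.2.+1)%N.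
  by rewrite prime_decompE big_map.
elim: (prime_decomp n) => [|[q e] s IH]; first by rewrite big_nil.
rewrite big_cons /= -IH; set ds := foldr _ _ s.
by elim: e => [|e IHe] /=; rewrite ?mul1n // size_merge size_cat size_map IHe mulSn addnC [in RHS]mulSn; lia.
Qed.

(** Split the primes at [y]. There are fewer than [y] small ones, each with exponent at most
    [log_2 n]. For a large one [e + 1 <= 2^e], and the exponents of the large primes add up to some
    [k] with [y^k <= n]. *)
Lemma divisor_bound y n : (1 < y)%N -> (0 < n)%N ->
  (size (divisors n) <= (trunc_log 2 n).+1 ^ y * 2 ^ trunc_log y n)%N.
Proof.
move=> y1 n0; rewrite size_divisors // (bigID (fun q => (q < y)%N)) /=.
apply: leq_mul.
  apply: (@leq_trans (\prod_(q <- primes n | (q < y)%N) (trunc_log 2 n).+1)%N).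
    rewrite big_seq_cond [leqRHS]big_seq_cond; apply: leq_prod => q /andP[qn _].
    rewrite ltnS; apply: trunc_log_max => //; apply: (@leq_trans (q ^ logn q n)%N).
      have [->//|e0] := posnP (logn q n).
      by rewrite leq_exp2r //; move: qn; rewrite mem_primes => /andP[/prime_gt1].
    by apply: dvdn_leq => //; exact: pfactor_dvdnn.
  rewrite big_const_seq iter_muln_1 leq_pexp2l // -size_filter -[leqRHS](size_iota 0).
  apply: uniq_leq_size; first by rewrite filter_uniq // primes_uniq.
  by move=> q; rewrite mem_filter mem_iota => /andP[].
pose k := (\sum_(q <- primes n | ~~ (q < y)) logn q n)%N.
apply: (@leq_trans (2 ^ k)%N).
  rewrite /k expn_sum; apply: leq_prod => q _; exact: ltn_expl.
rewrite leq_exp2l //; apply: trunc_log_max => //.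
have nE : n = (\prod_(q <- primes n) q ^ logn q n)%N.
  by rewrite [LHS]prod_prime_decomp // prime_decompE big_map.
rewrite [leqRHS]nE (bigID (fun q => (q < y)%N)) /= /k expn_sum.
apply: (@leq_trans (1 * \prod_(q <- primes n | ~~ (q < y)) q ^ logn q n)%N).
  rewrite mul1n; apply: leq_prod => q; rewrite -leqNgt => yq.
  by have [->//|e0] := posnP (logn q n); rewrite leq_exp2r.
apply: leq_mul => //; rewrite big_seq_cond; apply: prodn_cond_gt0 => q /andP[qn _].
by rewrite expn_gt0; move: qn; rewrite mem_primes => /andP[/prime_gt0 ->].
Qed.

(** The bound is uniform in [n]: a divisor determines its cofactor, so the divisor bound applies
    when [0 < n <= m], and outside this range there is no factorization at all, since the products
    are positive and at most [h * h <= m]. *)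
Lemma factorization_count_le (R : realFieldType) y h m n : (1 < y)%N -> (h * h <= m)%N ->
  (\sum_(i < h) \sum_(j < h) (i.+1 * j.+1 == n)%N%:R <=
    ((trunc_log 2 m).+1 ^ y * 2 ^ trunc_log y m)%N%:R :> R)%R.
Proof.
move=> y1 hm.
have nat_le : (\sum_(i < h) \sum_(j < h) (i.+1 * j.+1 == n) <= (trunc_log 2 m).+1 ^ y * 2 ^ trunc_log y m)%N.
  have [->|n0] := posnP n; first by rewrite big1 // => i _; rewrite big1.
  have [nm|mn] := leqP n m; last first.
    rewrite big1 // => i _; rewrite big1 // => j _; apply/eqP; rewrite eqb0 neq_ltn.
    by rewrite (leq_ltn_trans _ mn) //; apply: leq_trans hm; rewrite leq_mul.
  apply: (@leq_trans (size (divisors n))); last first.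
    apply: leq_trans (divisor_bound y1 n0) _; apply: leq_mul.
      by rewrite leq_exp2r ?(ltnW y1) // ltnS leq_trunc_log.
    by rewrite leq_exp2l // leq_trunc_log.
  apply: (@leq_trans (\sum_(i < h) (i.+1 %| n))).
    apply: leq_sum => i _; have [/dvdnP [c nE]|ndiv] := boolP (i.+1 %| n); last first.
      by rewrite big1 // => j _; apply/eqP; rewrite eqb0; apply: contra ndiv => /eqP <-; exact: dvdn_mulr.
    have [ch|ch] := ltnP c.-1 h; last first.
      rewrite big1 // => j _; apply/eqP; rewrite eqb0 nE mulnC eqn_pmul2r //.
      by apply: contraTneq ch => <-; rewrite -ltnNge /=.
    rewrite (bigD1 (Ordinal ch)) //= big1 ?addn0 ?leq_b1 // => j jc; apply/eqP; rewrite eqb0 nE mulnC eqn_pmul2r //.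
    by apply: contra jc => /eqP E; apply/eqP; apply: val_inj => /=; rewrite -E.
  rewrite -(big_mkord xpredT (fun i => nat_of_bool (i.+1 %| n))) /=.
  have -> : (\sum_(0 <= i < h) (i.+1 %| n) = size [seq i.+1 | i <- index_iota 0 h & i.+1 %| n])%N.
    rewrite size_map size_filter -sum1_count [RHS]big_mkcond; apply: eq_bigr => i _; by case: (_ %| _).
  apply: uniq_leq_size.
    by rewrite map_inj_uniq ?filter_uniq ?iota_uniq // => a b [].
  by move=> d /mapP [i]; rewrite mem_filter => /andP[id _] ->; rewrite -dvdn_divisors.
apply: le_trans (_ : _ <= (\sum_(i < h) \sum_(j < h) (i.+1 * j.+1 == n))%N%:R)%R _; last by rewrite ler_nat.
rewrite natr_sum; apply: ler_sum => i _; by rewrite natr_sum.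
Qed.

Local Open Scope ring_scope.

(** * The quadratic character *)

Section QuadraticCharacter.
Variables (R : realFieldType) (F : finFieldType) (p : nat).
Hypotheses (p_pr : prime p) (p_gt2 : (2 < p)%N) (cardF : #|F| = p).
Local Notation h := p./2.

Lemma p_half : p = (h.*2).+1.
Proof.
have H := odd_double_half p; rewrite -[LHS]H; case: (boolP (odd p)) => [_ //|Hodd].
by case: (even_prime p_pr) => E; [move: p_gt2; rewrite E | rewrite E in Hodd].
Qed.

Lemma pcharF : p \in [pchar F].
Proof. by apply: (@card_finPcharP _ _ 1) => //; rewrite expn1. Qed.

Lemma Fp_nat_neq0 n : (0 < n < p)%N -> (n%:R : F) != 0.
Proof.
move=> /andP[n0 np]; rewrite -(dvdn_pcharf pcharF).
by apply/negP => /dvdn_leq; rewrite n0 leqNgt np => /(_ isT).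
Qed.

Lemma F2_neq0 : (2 : F) != 0. Proof. exact: Fp_nat_neq0. Qed.

Lemma F1_neqN1 : (1 : F) != -1.
Proof. by rewrite -subr_eq0 opprK; exact: F2_neq0. Qed.

Lemma expF_p (x : F) : x ^+ p = x.
Proof. by rewrite -[RHS]expf_card cardF. Qed.

Lemma expF_pred (x : F) : x != 0 -> x ^+ h.*2 = 1.
Proof.
move=> x0; apply: (mulfI x0); rewrite mulr1 -exprS -p_half; exact: expF_p.
Qed.

(** Euler's criterion serves as the definition, so that multiplicativity comes from that of powers;
    the link with squares is [chi_root]. *)
Definition chi (x : F) : R :=
  if x == 0 then 0 else if x ^+ h == 1 then 1 else -1.

Lemma expF_half (x : F) : x != 0 -> x ^+ h = if x ^+ h == 1 then 1 else -1.
Proof.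
move=> x0; have /eqP := expF_pred x0; rewrite -muln2 exprM sqrf_eq1.
by case/orP => /eqP ->; rewrite ?eqxx // eq_sym (negPf F1_neqN1).
Qed.

Lemma chi0 : chi 0 = 0. Proof. by rewrite /chi eqxx. Qed.
Lemma chi1 : chi 1 = 1. Proof. by rewrite /chi oner_eq0 expr1n eqxx. Qed.

Lemma chiM x y : chi (x * y) = chi x * chi y.
Proof.
rewrite /chi mulf_eq0; have [->|x0] := eqVneq x 0; first by rewrite /= mul0r.
have [->|y0] := eqVneq y 0; first by rewrite orbT mulr0.
rewrite /= exprMn (expF_half x0) (expF_half y0).
have N1 : (-1 : F) == 1 = false by rewrite eq_sym (negPf F1_neqN1).
case: (x ^+ h == 1); case: (y ^+ h == 1); rewrite ?mulr1 ?mul1r ?mulrNN ?mulr1 ?N1 ?eqxx //; ring.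

Qed.

Lemma chi_sqr x : x != 0 -> chi x ^+ 2 = 1.
Proof. by move=> x0; rewrite /chi (negPf x0); case: ifP; rewrite ?expr1n ?sqrrN ?expr1n. Qed.

Lemma chi_sq x : x != 0 -> chi (x ^+ 2) = 1.
Proof. by move=> x0; rewrite expr2 chiM -expr2 chi_sqr. Qed.

Lemma chi_norm x : `|chi x| <= 1.
Proof. by rewrite /chi; case: ifP => _; [rewrite normr0|case: ifP; rewrite ?normrN normr1]. Qed.

Lemma chiV x : chi x^-1 = chi x.
Proof.
have [->|x0] := eqVneq x 0; first by rewrite invr0.
have : chi (x * x^-1) = 1 by rewrite divff ?chi1.
rewrite chiM => H; have /eqP := chi_sqr x0; rewrite sqrf_eq1.
by case/orP => /eqP E; move: H; rewrite E ?mul1r // mulN1r => <-; rewrite opprK.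
Qed.

(** Squaring is at most two-to-one on the [2h] nonzero elements, so there are at least [h] nonzero
    squares. All are roots of [X^h - 1], which has at most [h] roots, so the two sets coincide. *)
Lemma chi_root x : #|[set a : F | a ^+ 2 == x]|%:R = 1 + chi x.
Proof.
pose Q := [set x : F | x ^+ h == 1].
pose S := [set a ^+ 2 | a in [set~ (0 : F)]].
have h0 : (0 < h)%N by move: p_gt2; rewrite p_half; case: h.
have roots2 (y a : F) : a ^+ 2 = y -> [set b : F | b ^+ 2 == y] = [set a; -a].
  by move=> <-; apply/setP=> b; rewrite !inE eqf_sqr.
have cardQ : (#|Q| <= h)%N.
  have szP : size ('X^h - 1 : {poly F}) = h.+1 by rewrite size_XnsubC.
  have := @max_poly_roots _ ('X^h - 1) (enum Q).
  rewrite szP ltnS cardE; apply; rewrite ?enum_uniq -?size_poly_gt0 ?szP //.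
  by apply/allP=> y; rewrite mem_enum inE rootE !hornerE => /eqP->; rewrite subrr.
have cardS : (h <= #|S|)%N.
  rewrite -leq_double -[leqLHS]/((h.*2).+1.-1) -p_half.
  have -> : p.-1 = #|[set~ (0 : F)]| by rewrite cardsC1 cardF.
  rewrite -sum1_card (partition_big_imset (fun a : F => a ^+ 2)) /= -muln2 -sum_nat_const.
  apply: leq_sum => y /imsetP [a _ ya].
  apply: (@leq_trans #|[set a; -a]|); last by rewrite cards2; case: (_ != _).
  rewrite -(roots2 _ _ (esym ya)) -sum1dep_card [leqLHS]big_mkcond [leqRHS]big_mkcond /=.
  by apply: leq_sum => b _; case: (b \in _); case: (_ == y).
have SQ : S = Q.
  apply/eqP; rewrite eqEcard (leq_trans cardQ cardS) andbT.
  apply/subsetP=> y /imsetP [a a0 ->]; rewrite inE -exprM mul2n expF_pred //.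
  by move: a0; rewrite !inE.
rewrite /chi; have [->|x0] := eqVneq x 0.
  by rewrite (roots2 0 0) ?expr0n // oppr0 setUid cards1 addr0.
case: ifP => xh.
  have : x \in S by rewrite SQ inE xh.
  case/imsetP=> a; rewrite !inE => a0 xa.
  rewrite (roots2 x a) // cards2 -[a != - a]negbK negbK.
  have -> : a != - a by rewrite -subr_eq0 opprK -mulr2n -mulr_natl mulf_neq0 ?F2_neq0.
  by rewrite /=; ring.
suff -> : [set a : F | a ^+ 2 == x] = set0 by rewrite cards0 subrr.
apply/setP=> a; rewrite !inE; apply/negP=> /eqP xa.
have : x \in S by apply/imsetP; exists a; rewrite // !inE; apply: contra_neq x0 => a0; rewrite -xa a0 expr0n.
by rewrite SQ inE xh.
Qed.

Lemma sum_sqr (g : F -> R) : \sum_a g (a ^+ 2) = \sum_x (1 + chi x) * g x.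
Proof.
rewrite (partition_big (fun a : F => a ^+ 2) xpredT) //=.
apply: eq_bigr => x _; rewrite -chi_root.
rewrite (eq_bigr (fun=> g x)) => [|a /eqP-> //].
by rewrite sumr_const mulr_natl; congr (_ *+ _); apply: eq_card => a; rewrite !inE.
Qed.

Lemma sum_F1 (c : R) : \sum_(x : F) c = p%:R * c.
Proof. by rewrite sumr_const mulr_natl cardT -cardE cardF. Qed.

Lemma sum_chi : \sum_x chi x = 0.
Proof.
have := sum_sqr (fun=> 1); rewrite sum_F1.
under eq_bigr => x _ do rewrite mulr1.
by rewrite big_split /= sum_F1 => H; lra.
Qed.

Lemma reindex_aff (g : F -> R) (a b : F) : a != 0 -> \sum_x g (a * x + b) = \sum_x g x.
Proof.
move=> a0; rewrite [RHS](reindex (fun x => a * x + b)) //=.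
exists (fun y => (y - b) / a) => x _; field; exact: a0.
Qed.

Lemma sum_chi_aff (a b : F) : a != 0 -> \sum_x chi (a * x + b) = 0.
Proof. by move=> a0; rewrite (reindex_aff chi) // sum_chi. Qed.

Lemma sum_chi_sqr : \sum_x chi x ^+ 2 = p%:R - 1.
Proof.
rewrite (bigD1 0) //= chi0 expr0n add0r.
rewrite (eq_bigr (fun=> 1)) => [|x x0]; last by rewrite chi_sqr.
have := sum_F1 1; rewrite (bigD1 0) //= => H; lra.
Qed.

(** For [x != 0], [x (x + b)] is [1 + b/x] up to a square, and [1/x] runs over the field. With the
    convention [0^-1 = 0] the point [x = 0] contributes [chi 1 = 1], which is the [-1] of the
    result. *)
Lemma sum_chi2_monic (b : F) : \sum_x chi x * chi (x + b) = p%:R * (b == 0)%:R - 1.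
Proof.
have [->|b0] := eqVneq b 0.
  by under eq_bigr => x _ do rewrite addr0 -expr2; rewrite sum_chi_sqr mulr1.
rewrite mulr0 sub0r (eq_bigr (fun x => chi (b * x^-1 + 1) - (x == 0)%:R)) => [|x _].
  rewrite sumrB (reindex_inj (can_inj invrK)) /=.
  under eq_bigr => x _ do rewrite invrK.
  rewrite (sum_chi_aff _ b0) (bigD1 0) //= big1 ?eqxx ?addr0 ?sub0r // => x /negPf-> //.
have [->|x0] := eqVneq x 0; first by rewrite chi0 mul0r invr0 mulr0 add0r chi1 subrr.
have -> : x + b = x * (b * x^-1 + 1) by field.
by rewrite chiM mulrA -expr2 chi_sqr // mul1r subr0.
Qed.

Lemma sum_chi2 (a b c d : F) : a != 0 -> c != 0 ->
  \sum_x chi (a * x + b) * chi (c * x + d) = chi (a * c) * (p%:R * (a * d == b * c)%:R - 1).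
Proof.
move=> a0 c0; rewrite -[in LHS](reindex_aff (fun x => _) (- (b / a)) (oner_neq0 _)).
rewrite (eq_bigr (fun x => chi (a * c) * (chi x * chi (x + (d / c - b / a))))) => [|x _].
  rewrite -big_distrr /= sum_chi2_monic; congr (_ * (_ * (nat_of_bool _)%:R - _)).
  by rewrite subr_eq0 eqr_div // [d * a]mulrC.
have -> : a * (1 * x - b / a) + b = a * x by field.
have -> : c * (1 * x - b / a) + d = c * (x + (d / c - b / a)) by field; rewrite a0 c0.
by rewrite !chiM; ring.
Qed.
End QuadraticCharacter.

(** * Stepanov's method for character sums *)

(* [lia] sees two elaborations of the same polynomial size as different atoms. *)
Ltac size_lia :=
  repeat match goal with H : is_true (leq _ _) |- _ => revert H end;
  repeat match goal with
  | |- context [@size ?T1 (@polyseq ?R1 ?u)] =>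
    match goal with
    | |- context [@size ?T2 (@polyseq ?R2 u)] =>
      progress change (@size T2 (@polyseq R2 u)) with (@size T1 (@polyseq R1 u))
    end
  end; lia.

Section Stepanov.
Variables (F : finFieldType) (p : nat).
Hypotheses (p_pr : prime p) (p_gt2 : (2 < p)%N) (cardF : #|F| = p).
Local Notation h := p./2.

(** Ordinary derivatives detect multiplicities up to [p]: differentiating [q (X - x)^(M+1)] brings
    out the factor [M + 1], which is invertible in [F] as long as it is below [p]. *)
Lemma dvdp_XsubC_exp_deriv (x : F) M (P : {poly F}) : (M <= p)%N ->
  (forall k, (k < M)%N -> root P^`(k) x) -> ('X - x%:P) ^+ M %| P.
Proof.
elim: M P => [|M IH] P Mp rt; first by rewrite expr0 dvd1p.
have /dvdpP [q Pq] : ('X - x%:P) ^+ M %| P by apply: IH => [|k /ltnW]; [exact: ltnW | exact: rt].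
have dP : ('X - x%:P) ^+ M %| P^`().
  apply: IH => [|k kM]; first exact: ltnW.
  by rewrite -derivSn; exact: rt.
case: M Mp rt Pq dP IH => [|M] Mp rt Pq dP _.
  by rewrite expr1 -root_factor_theorem; have := rt 0 isT; rewrite derivn0.
rewrite exprS Pq dvdp_mul // -root_factor_theorem.
have E : P^`() = q^`() * ('X - x%:P) ^+ M.+1 + (M.+1%:R *: q) * ('X - x%:P) ^+ M.
  by rewrite Pq derivM deriv_exp derivXsubC mul1r /= scaler_nat mulrnAr mulrnAl.
have M0 : (M.+1%:R : F) != 0 by apply: (Fp_nat_neq0 p_pr cardF); rewrite ltn0Sn.
move: dP; rewrite E dvdp_addr ?dvdp_mulIr // exprS dvdp_mul2r ?expf_neq0 ?polyXsubC_eq0 //.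
by rewrite dvdpZr // -root_factor_theorem.
Qed.

Lemma dvdp_prod_XsubC_exp M (P : {poly F}) (s : seq F) : uniq s ->
  (forall x, x \in s -> ('X - x%:P) ^+ M %| P) -> \prod_(x <- s) ('X - x%:P) ^+ M %| P.
Proof.
elim: s => [|x s IH] /=; first by rewrite big_nil dvd1p.
case/andP=> xs us H; rewrite big_cons Gauss_dvdp.
  by rewrite H ?mem_head // IH // => y ys; rewrite H // inE ys orbT.
rewrite big_seq; elim/big_ind: _ => [|u v cu cv|y ys]; first exact: coprimep1.
  by rewrite coprimepMr cu cv.
apply: coprimep_expl; apply: coprimep_expr; apply: coprimep_XsubC2.
by rewrite subr_eq0; apply: contraNneq xs => <-.
Qed.

Variable (f : {poly F}).
Hypotheses (sz_f : size f = 4%N) (f0 : f.[0] != 0).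

(** Modulo [X^p] the relation reads [r_0 + s_0 f^h = 0]. Multiplying by [f (r_0 - s_0 f^h)] and
    using [f^p = f(0)] modulo [X^p] gives [f r_0^2 = f(0) s_0^2] modulo [X^p], hence exactly, by the
    bound on degrees. The left side has odd degree and the right side even degree, so both vanish;
    then divide by [X^p] and induct. *)
Lemma stepanov_nonzero A J (r s : nat -> {poly F}) : (2 * A + 2 <= p)%N ->
  (forall j, size (r j) <= A)%N -> (forall j, size (s j) <= A)%N ->
  \sum_(j < J) (r j + s j * f ^+ h) * 'X^(p * j) = 0 ->
  forall j, (j < J)%N -> r j = 0 /\ s j = 0.
Proof.
move=> Ap; elim: J r s => [|J IH] r s szr szs // E0.
have fnz : f != 0 by rewrite -size_poly_eq0 sz_f.
pose T := \sum_(j < J) (r j.+1 + s j.+1 * f ^+ h) * 'X^(p * j).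
have E1 : r 0%N + s 0%N * f ^+ h + T * 'X^p = 0.
  rewrite -[RHS]E0 big_ord_recl muln0 expr0 mulr1; congr (_ + _).
  rewrite /T big_distrl /=; apply: eq_bigr => j _.
  by rewrite -mulrA -exprD mulnS addnC.
have [g fg] : exists g, f = g * 'X + (f.[0])%:P.
  have /factor_theorem [g Eg] : root (f - (f.[0])%:P) 0 by rewrite rootE !hornerE subrr.
  by exists g; move/eqP: Eg; rewrite subr_eq subr0 => /eqP.
have pX : p \in [pchar {poly F}] by rewrite pchar_poly; exact: (pcharF p_pr cardF).
have fp : f ^+ p = g ^+ p * 'X^p + (f.[0])%:P.
  rewrite [in LHS]fg -!(pFrobenius_autE pX) pFrobenius_autD_comm ?pFrobenius_autM_comm; try exact: mulrC.
  by rewrite !pFrobenius_autE -rmorphXn /= (expF_p cardF).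
have D : 'X^p %| f * r 0%N ^+ 2 - f.[0] *: s 0%N ^+ 2.
  have -> : f * r 0%N ^+ 2 - f.[0] *: s 0%N ^+ 2
     = f * (r 0%N + s 0%N * f ^+ h) * (r 0%N - s 0%N * f ^+ h) + s 0%N ^+ 2 * (f ^+ p - (f.[0])%:P).
    have -> : f ^+ p = f * (f ^+ h * f ^+ h) by rewrite -exprD addnn -exprS -p_half.
    rewrite -mul_polyC; ring.
  rewrite fp addrK; apply: dvdp_add; last by rewrite dvdp_mull ?dvdp_mulIr.
  have -> : r 0%N + s 0%N * f ^+ h = - T * 'X^p by rewrite mulNr; apply/eqP; rewrite -addr_eq0 E1.
  by apply: dvdp_mulr; rewrite mulrA dvdp_mulIr.
have szf (u : {poly F}) : u != 0 -> size (f * u ^+ 2) = (2 * size u + 2)%N.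
  move=> u0; have szu : (0 < size u)%N by rewrite size_poly_gt0.
  rewrite size_mul ?expf_neq0 // expr2 size_mul // sz_f; size_lia.
have szs2 (u : {poly F}) : u != 0 -> size (f.[0] *: u ^+ 2) = (2 * size u).-1.
  move=> u0; have szu : (0 < size u)%N by rewrite size_poly_gt0.
  rewrite size_scale // expr2 size_mul //; size_lia.
have Z : f * r 0%N ^+ 2 - f.[0] *: s 0%N ^+ 2 = 0.
  apply/eqP; rewrite -size_poly_leq0 leqNgt; apply/negP => sz0.
  have := dvdp_leq _ D; rewrite -size_poly_gt0 sz0 size_polyXn => /(_ isT).
  rewrite ltnNge => /negP; apply.
  apply: (leq_trans (size_polyD _ _)); rewrite size_polyN geq_max.
  apply/andP; split.
    have [->|r0] := eqVneq (r 0%N) 0; first by rewrite expr0n mulr0 size_poly0.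
    by have := szr 0%N; rewrite szf //; size_lia.
  have [->|s0] := eqVneq (s 0%N) 0; first by rewrite expr0n scaler0 size_poly0.
  by have := szs 0%N; rewrite szs2 //; size_lia.
have [r0 s0] : r 0%N = 0 /\ s 0%N = 0.
  have [r0|r0] := eqVneq (r 0%N) 0; have [s0|s0] := eqVneq (s 0%N) 0 => //.
  - exfalso; move: Z; rewrite r0 expr0n mulr0 sub0r => /eqP; rewrite oppr_eq0 => /eqP /(congr1 (fun u => size (polyseq u))).
    rewrite szs2 // size_poly0; have : (0 < size (s 0%N))%N by rewrite size_poly_gt0.
    size_lia.
  - exfalso; move: Z; rewrite s0 expr0n scaler0 subr0 => /(congr1 (fun u => size (polyseq u))).
    rewrite szf // size_poly0; size_lia.
  - exfalso; move/eqP: Z; rewrite subr_eq0 => /eqP /(congr1 (fun u => size (polyseq u))).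
    by rewrite szf // szs2 //; size_lia.
have T0 : T = 0.
  move: E1; rewrite r0 s0 mul0r !add0r => /eqP; rewrite mulf_eq0 => /orP [/eqP //|].
  by rewrite -size_poly_eq0 size_polyXn.
case=> [|j] jJ //.
by apply: (IH (fun j => r j.+1) (fun j => s j.+1)).
Qed.

(** The polynomial factor in [(f^c u)' = f^(c-1) (c f' u + f u')]; iterated, the [k]-th derivative
    of [f^c u] is [f^(c-k)] times [twisted_derivn c k u]. *)
Definition twisted_deriv (c : F) (u : {poly F}) := c *: (f^`() * u) + f * u^`().
Fixpoint twisted_derivn (c : F) k (u : {poly F}) :=
  if k is k'.+1 then twisted_deriv (c - k'%:R) (twisted_derivn c k' u) else u.

Lemma twisted_derivnB c k : {morph twisted_derivn c k : u v / u - v}.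
Proof.
elim: k => //= k IH u v; rewrite IH /twisted_deriv derivB -!mul_polyC; ring.
Qed.

Lemma size_twisted_derivn c k u : (size (twisted_derivn c k u) <= size u + 2 * k)%N.
Proof.
elim: k => [|k IH] /=; first by rewrite muln0 addn0.
set v := twisted_derivn c k u in IH *; rewrite /twisted_deriv.
have szf' : (size f^`() <= 3)%N.
  by have := lt_size_deriv (p := f); rewrite -size_poly_eq0 sz_f => /(_ isT).
apply: leq_trans (size_polyD _ _) _; rewrite geq_max; apply/andP; split.
  apply: leq_trans (size_scale_leq _ _) _.
  by apply: leq_trans (size_polyMleq _ _) _; size_lia.
have [->|v0] := eqVneq v 0; first by rewrite deriv0 mulr0 size_poly0.
apply: leq_trans (size_polyMleq _ _) _; rewrite sz_f; have := lt_size_deriv v0; size_lia.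
Qed.

(** [X^(p j)] has zero derivative in characteristic [p], and the two summands are [f^M u] and
    [f^(M+h) v]. The prefactor [f^M] is there so that the exponent [M - k] stays nonnegative. *)
Lemma derivn_stepanov_term M k j u v : (k <= M)%N ->
  (f ^+ M * ((u + v * f ^+ h) * 'X^(p * j)))^`(k) =
  f ^+ (M - k) * ((twisted_derivn M%:R k u + twisted_derivn (M + h)%:R k v * f ^+ h) * 'X^(p * j)).
Proof.
elim: k => [|k IH] kM; first by rewrite derivn0 subn0.
rewrite derivnS IH 1?ltnW //=.
set u' := twisted_derivn _ k u; set v' := twisted_derivn _ k v.
have -> : (M - k = (M - k.+1).+1)%N by size_lia.
have Mk : M%:R - k%:R = (M - k.+1).+1%:R :> F by rewrite -natrB ?(ltnW kM) //; congr (_%:R); size_lia.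
have Mhk : (M + h)%:R - k%:R = (M - k.+1).+1%:R + h%:R :> F by rewrite natrD addrAC Mk.
set m := (M - k.+1)%N in Mk Mhk *.
have dX : ('X^(p * j) : {poly F})^`() = 0.
  by rewrite derivXn -mulr_natr natrM -[p%:R]polyC_natr (pcharf0 (pcharF p_pr cardF)) mul0r mulr0.
have [h' hE] : exists h', h = h'.+1 by exists h.-1; move: p_gt2; rewrite (p_half p_pr p_gt2); case: h.
rewrite !derivM dX mulr0 addr0 derivD derivM !deriv_exp /= {}Mk {}Mhk /twisted_deriv hE /=.
rewrite -!mul_polyC polyCD !polyC_natr !exprS.
ring.
Qed.

Variables (a : F) (A J M : nat).
Hypotheses (Ap : (2 * A + 2 <= p)%N) (Mp : (M <= p)%N)
  (dim : (M * (A + 2 * M + J) < 2 * A * J)%N) (M0 : (0 < M)%N).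
Local Notation L := (A + 2 * M + J)%N.
Local Notation dom := {ffun 'I_J -> 'rV[F]_A * 'rV[F]_A}.

(** What remains of the [k]-th derivative, apart from a power of [f], at a point [x] with
    [f(x)^h = a]: there [f^h] becomes [a] and [x^(p j) = x^j]. Its low degree keeps the number of
    vanishing conditions small. *)
Definition stepanov_eval (z : dom) (k : nat) : {poly F} :=
  \sum_(j < J) (twisted_derivn M%:R k (rVpoly (z j).1)
     + a *: twisted_derivn (M + h)%:R k (rVpoly (z j).2)) * 'X^j.

Lemma size_stepanov_eval z k : (k < M)%N -> (size (stepanov_eval z k) <= L)%N.
Proof.
move=> kM; apply: (leq_trans (size_sum _ _ _)); apply/bigmax_leqP => j _.
apply: leq_trans (size_polyMleq _ _) _; rewrite size_polyXn addnS /=.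
have szu (w : 'rV[F]_A) : (size (rVpoly w) <= A)%N by exact: size_poly.
have : (size (twisted_derivn M%:R k (rVpoly (z j).1)
    + a *: twisted_derivn (M + h)%:R k (rVpoly (z j).2))%R <= A + 2 * k)%N.
  apply: leq_trans (size_polyD _ _) _; rewrite geq_max; apply/andP; split.
    by apply: leq_trans (size_twisted_derivn _ _ _) _; rewrite leq_add2r.
  apply: leq_trans (size_scale_leq _ _) _.
  by apply: leq_trans (size_twisted_derivn _ _ _) _; rewrite leq_add2r.
have := ltn_ord j; size_lia.
Qed.

(* Pigeonhole over the finite field replaces linear algebra: more coefficient
   vectors than values of the linear conditions. *)
Lemma stepanov_collision : exists z1 z2 : dom, z1 != z2 /\
  forall k, (k < M)%N -> stepanov_eval z1 k = stepanov_eval z2 k.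
Proof.
pose ev (z : dom) : {ffun 'I_M -> 'rV[F]_L} := [ffun k : 'I_M => poly_rV (stepanov_eval z k)].
have : ~~ injectiveb ev.
  apply/injectiveP => /leq_card; rewrite !card_ffun !card_prod !card_mx !card_ord cardF !mul1n -expnD -!expnM.
  rewrite leq_exp2l ?prime_gt1 //; size_lia.
case/injectivePn => z1 [z2 ne E]; exists z1, z2; split=> // k kM.
have := congr1 (fun g : {ffun 'I_M -> _} => rVpoly (g (Ordinal kM))) E.
by rewrite !ffunE /= !poly_rV_K // size_stepanov_eval.
Qed.

(** The difference of two colliding coefficient vectors gives a polynomial [T], nonzero by
    [stepanov_nonzero], such that [f^M T] vanishes to order [M] at each point of [Z]. Comparing with
    the degree of [f^M T] bounds [#|Z|]. *)
Lemma stepanov_bound (Z : {set F}) : (forall x, x \in Z -> f.[x] ^+ h = a) ->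
  (#|Z| * M <= 3 * M + A + 3 * h + p * J)%N.
Proof.
move=> Za; have [z1 [z2 [ne E]]] := stepanov_collision.
have fnz : f != 0 by rewrite -size_poly_eq0 sz_f.
pose r j := if insub j is Some j' then rVpoly (z1 j').1 - rVpoly (z2 j').1 else 0.
pose s j := if insub j is Some j' then rVpoly (z1 j').2 - rVpoly (z2 j').2 else 0.
have rE (j : 'I_J) : r j = rVpoly (z1 j).1 - rVpoly (z2 j).1 by rewrite /r valK.
have sE (j : 'I_J) : s j = rVpoly (z1 j).2 - rVpoly (z2 j).2 by rewrite /s valK.
have szu (w w' : 'rV[F]_A) : (size (rVpoly w - rVpoly w')%R <= A)%N.
  by rewrite -linearB; exact: size_poly.
have szr j : (size (r j) <= A)%N by rewrite /r; case: insubP => [j' _ _|_]; rewrite ?size_poly0.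
have szs j : (size (s j) <= A)%N by rewrite /s; case: insubP => [j' _ _|_]; rewrite ?size_poly0.
pose T := \sum_(j < J) (r j + s j * f ^+ h) * 'X^(p * j).
have T0 : T != 0.
  apply: contra_neq ne => T0; apply/ffunP => j.
  have [] := stepanov_nonzero Ap szr szs T0 (ltn_ord j).
  rewrite rE sE => /eqP; rewrite subr_eq0 => /eqP /(can_inj rVpolyK) e1.
  move/eqP; rewrite subr_eq0 => /eqP /(can_inj rVpolyK) e2.
  by rewrite [z1 j]surjective_pairing e1 e2 -surjective_pairing.
have D x : x \in Z -> ('X - x%:P) ^+ M %| f ^+ M * T.
  move=> xZ; apply: dvdp_XsubC_exp_deriv => // k kM.
  rewrite /T big_distrr /= (raddf_sum (derivn k)) rootE horner_sum.
  rewrite (eq_bigr (fun j : 'I_J => f.[x] ^+ (M - k) *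
    (((twisted_derivn M%:R k (r j) + a *: twisted_derivn (M + h)%:R k (s j)) * 'X^j).[x]))).
    rewrite -big_distrr /= -horner_sum.
    suff -> : \sum_(j < J) (twisted_derivn M%:R k (r j) + a *: twisted_derivn (M + h)%:R k (s j)) * 'X^j
       = stepanov_eval z1 k - stepanov_eval z2 k by rewrite E // subrr horner0 mulr0.
    rewrite /stepanov_eval -sumrB; apply: eq_bigr => j _.
    rewrite rE sE !twisted_derivnB -!mul_polyC; ring.
  move=> j _ /=; rewrite (derivn_stepanov_term j (r j) (s j) (ltnW kM)) !hornerE Za //.
  by rewrite exprM (expF_p cardF) /=; ring.
have /dvdp_leq := dvdp_prod_XsubC_exp (enum_uniq Z) (fun x xZ => D x (etrans (esym (mem_enum Z x)) xZ)).
rewrite mulf_neq0 ?expf_neq0 // => /(_ isT).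
rewrite prodrXl.
have szP : size (\prod_(x <- enum Z) ('X - x%:P)) = #|Z|.+1 by rewrite size_prod_XsubC -cardE.
have szPM : (size ((\prod_(x <- enum Z) ('X - x%:P)) ^+ M)).-1 = (#|Z| * M)%N by rewrite size_exp szP.
have szfe n : (size (f ^+ n)%R <= 3 * n + 1)%N.
  have : (size (f ^+ n)).-1 = (3 * n)%N by rewrite size_exp sz_f.
  by size_lia.
have szT : (size T <= A + 3 * h + p * J)%N.
  apply: (leq_trans (size_sum _ _ _)); apply/bigmax_leqP => j _.
  apply: leq_trans (size_polyMleq _ _) _; rewrite size_polyXn addnS /=.
  have : (size (r j + s j * f ^+ h)%R <= A + 3 * h)%N.
    apply: leq_trans (size_polyD _ _) _; rewrite geq_max; apply/andP; split.
      by apply: leq_trans (szr j) _; rewrite leq_addr.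
    apply: leq_trans (size_polyMleq _ _) _; have := szs j; have := szfe h; size_lia.
  have : (p * j + p <= p * J)%N by rewrite addnC -mulnS leq_mul2l ltn_ord orbT.
  size_lia.
move=> le_sz; rewrite -szPM; apply: leq_trans (leq_pred _) _; apply: leq_trans le_sz _.
by apply: leq_trans (size_polyMleq _ _) _; have := szfe M; size_lia.
Qed.
End Stepanov.

(** * Square-root cancellation for the quadratic character of a cubic *)

Section CubicSums.
Variables (R : realFieldType) (F : finFieldType) (p : nat).
Hypotheses (p_pr : prime p) (p_gt2 : (2 < p)%N) (cardF : #|F| = p).
Local Notation h := p./2.
Local Notation χ := (@chi R F p).

Lemma nat_sqrt_bracket n : exists m, (m ^ 2 <= n < m.+1 ^ 2)%N.
Proof.
elim: n => [|n [m /andP[m1 m2]]]; first by exists 0%N.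
have [le|lt] := leqP (m.+1 ^ 2) n.+1; first by exists m.+1; rewrite le; nia.
by exists m; rewrite lt; nia.
Qed.

Lemma Rone_neqN1 : (1 == -1 :> R) = false.
Proof. by apply/eqP => H; lra. Qed.

Lemma chi_eq1 x : (χ x == 1) = (x != 0) && (x ^+ h == 1).
Proof.
rewrite /chi; case: (x == 0) => /=; first by rewrite eq_sym oner_eq0.
by case: (_ == 1); rewrite ?eqxx // eq_sym Rone_neqN1.
Qed.

Lemma chi_eqN1 x : (χ x == -1) = (x != 0) && (x ^+ h != 1).
Proof.
rewrite /chi; case: (x == 0) => /=; first by rewrite eq_sym oppr_eq0 oner_eq0.
by case: (_ == 1); rewrite ?eqxx // Rone_neqN1.
Qed.

Lemma norm_sum_chi (I : finType) (g : I -> F) : `|\sum_i χ (g i)| <= #|I|%:R.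
Proof.
apply: le_trans (ler_norm_sum _ _ _) _; apply: le_trans (ler_sum _ (fun i _ => chi_norm R p (g i))) _.
by rewrite sumr_const cardT -cardE.
Qed.

(** Stepanov's method only bounds from above the sets where [f] takes square and nonsquare values,
    each by [p/2 + O(sqrt p)]. As these two sets and at most three roots fill the field, the bounds
    also work from below. *)
Lemma sum_chi_cubic_sqr (f : {poly F}) : size f = 4%N -> f.[0] != 0 ->
  (\sum_x χ f.[x]) ^+ 2 <= 10 ^+ 4 * p%:R.
Proof.
move=> sz_f f0.
have p0 : (0 : R) < p%:R by rewrite ltr0n prime_gt0.
have triv : `|\sum_x χ f.[x]| <= p%:R by have := norm_sum_chi (fun x => f.[x]); rewrite cardF.
have [small|large] := ltnP p 36.
  rewrite -real_normK ?num_real //.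
  have : (p%:R : R) < 36 by rewrite ltr_nat.
  move: triv; set S := `|_|; set P : R := p%:R in p0 *.
  have : 0 <= S by exact: normr_ge0.
  nra.
have [m /andP[m1 m2]] := nat_sqrt_bracket p.
have m6 : (6 <= m)%N by nia.
have ph := p_half p_pr p_gt2.
(* With [A = h - 1], [J = m + 20], [M = 2 m], the dimension condition follows from
   [m^2 - 4 m - 6 > 0], that is [m >= 6]; this is why [p < 36] is treated by the trivial bound. *)
have bound (a : F) (Z : {set F}) : (forall x, x \in Z -> f.[x] ^+ h = a) -> (2 * #|Z| <= p + 22 * m + 50)%N.
  move=> Za; have := @stepanov_bound F p p_pr p_gt2 cardF f sz_f f0 a h.-1 (m + 20) (2 * m) _ _ _ _ Z Za.
  move=> /(_ ltac:(lia) ltac:(nia)); nia.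
pose Z1 := [set x | χ f.[x] == 1]; pose Z2 := [set x | χ f.[x] == -1]; pose Z0 := [set x | f.[x] == 0].
have b1 : (2 * #|Z1| <= p + 22 * m + 50)%N.
  by apply: (bound 1) => x; rewrite inE chi_eq1 => /andP[_ /eqP].
have b2 : (2 * #|Z2| <= p + 22 * m + 50)%N.
  apply: (bound (-1)) => x; rewrite inE chi_eqN1 => /andP[x0 /negPf E].
  by rewrite (expF_half p_pr p_gt2 cardF x0) E.
have b0 : (#|Z0| <= 3)%N.
  have := @max_poly_roots _ f (enum Z0).
  rewrite sz_f cardE -size_poly_eq0 sz_f; apply; rewrite ?enum_uniq //.
  by apply/allP => x; rewrite mem_enum inE.
have Ssum : \sum_x χ f.[x] = #|Z1|%:R - #|Z2|%:R.
  have cardR (Z : {set F}) : #|Z|%:R = \sum_x (x \in Z)%:R :> R.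
    by rewrite -sum1_card natr_sum big_mkcond; apply: eq_bigr => x _; case: (x \in Z).
  rewrite !cardR -sumrB; apply: eq_bigr => x _.
  rewrite !inE /chi; case: (f.[x] == 0); first by rewrite ![0 == _]eq_sym oner_eq0 oppr_eq0 oner_eq0 subrr.
  have N1 := Rone_neqN1.
  by case: (_ == 1); rewrite eqxx ?N1 1?eq_sym ?N1 ?subr0 ?sub0r.
have Pall : (p = #|Z0| + #|Z1| + #|Z2|)%N.
  rewrite -cardF -sum1_card -!sum1_card !(big_mkcond (fun x => x \in _)) /= -!big_split /=.
  apply: eq_bigr => x _; rewrite !inE chi_eq1 chi_eqN1.
  by case: (f.[x] == 0); case: (_ == 1).
have B : `|\sum_x χ f.[x]| <= 75 * m%:R.
  have l1 : (#|Z1|%:R : R) <= #|Z2|%:R + 75 * m%:R by rewrite -natrM -natrD ler_nat; lia.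
  have l2 : (#|Z2|%:R : R) <= #|Z1|%:R + 75 * m%:R by rewrite -natrM -natrD ler_nat; lia.
  rewrite Ssum ler_norml.
  by apply/andP; split; lra.
have m1' : (m%:R : R) ^+ 2 <= p%:R by rewrite -natrX ler_nat.
rewrite -real_normK ?num_real //.
have m0 : (0 : R) <= m%:R by [].
move: B m0 m1'; set S := `|_|; set P : R := p%:R; set M : R := m%:R.
have : 0 <= S by exact: normr_ge0.
nra.
Qed.
End CubicSums.

(** * Points of a quadric cone on a plane *)

Section PlaneSums.
Variables (R : realFieldType) (F : finFieldType) (p : nat).
Hypotheses (p_pr : prime p) (p_gt3 : (3 < p)%N) (cardF : #|F| = p).
Local Notation χ := (@chi R F p).
Let p_gt2 : (2 < p)%N := ltnW p_gt3.
Let χ0 : χ 0 = 0 := chi0 R F p.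
Let χ1 : χ 1 = 1 := chi1 R F p.
Let χM x y : χ (x * y) = χ x * χ y := chiM R p_pr p_gt2 cardF x y.
Let F2 : (2 : F) != 0 := F2_neq0 p_pr p_gt2 cardF.

Lemma sum_delta (c : F) (g : F -> R) : \sum_x (x == c)%:R * g x = g c.
Proof.
rewrite (bigD1 c) //= eqxx mul1r big1 ?addr0 // => x /negPf ->; exact: mul0r.
Qed.

Lemma reindex_lin2 (a b c d e1 e2 : F) (g : F -> F -> R) : a * d - b * c != 0 ->
  \sum_x \sum_y g (a * x + b * y + e1) (c * x + d * y + e2) = \sum_x \sum_y g x y.
Proof.
move=> D0; rewrite !pair_bigA /=.
rewrite [RHS](reindex (fun z : F * F => (a * z.1 + b * z.2 + e1, c * z.1 + d * z.2 + e2))) //=.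
exists (fun z : F * F => ((d * (z.1 - e1) - b * (z.2 - e2)) / (a * d - b * c),
                (a * (z.2 - e2) - c * (z.1 - e1)) / (a * d - b * c))) => [[x y] _|[x y] _] /=;
by congr (_, _); field.
Qed.

(** A point of the cone with [(s, t') != (0, 0)] lies on exactly one plane [t = r t'], [s' = r s].
    The points with [s = t' = 0] form the plane at infinity, and the origin, which lies on all [p]
    finite planes, is subtracted [p] times. *)
Lemma sum_cone_planes (G : F -> F -> F -> F -> R) :
  \sum_s \sum_t \sum_s' \sum_t' (s * t == s' * t')%:R * G s t s' t' =
  \sum_r (\sum_s \sum_t' G s (r * t') (r * s) t') + \sum_t \sum_s' G 0 t s' 0 - p%:R * G 0 0 0 0.
Proof.
pose inner s t' := \sum_t \sum_s' (s * t == s' * t')%:R * G s t s' t'.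
pose ray s t' := \sum_r G s (r * t') (r * s) t'.
have -> : \sum_s \sum_t \sum_s' \sum_t' (s * t == s' * t')%:R * G s t s' t' = \sum_s \sum_t' inner s t'.
  apply: eq_bigr => s _; rewrite /inner [RHS]exchange_big; apply: eq_bigr => t _.
  by rewrite exchange_big.
have -> : \sum_r (\sum_s \sum_t' G s (r * t') (r * s) t') = \sum_s \sum_t' ray s t'.
  rewrite exchange_big; apply: eq_bigr => s _; exact: exchange_big.
have E s t' : (s != 0) || (t' != 0) -> inner s t' = ray s t'.
  have [->|s0] := eqVneq s 0 => /= [t0|_].
    rewrite /inner (reindex_inj (mulIf t0)); apply: eq_bigr => r _.
    rewrite mul0r mulr0 -[RHS](sum_delta 0 (fun s' => G 0 (r * t') s' t')).
    by apply: eq_bigr => s' _; rewrite [0 == _]eq_sym mulf_eq0 (negPf t0) orbF.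
  rewrite /inner exchange_big (reindex_inj (mulIf s0)) /=; apply: eq_bigr => r _.
  rewrite -[RHS](sum_delta (r * t') (fun t => G s t (r * s) t')).
  apply: eq_bigr => t _; congr ((nat_of_bool _)%:R * _).
  by rewrite [r * s]mulrC -mulrA (inj_eq (mulfI s0)).
rewrite -[in RHS]addrA -[LHS](subrK (\sum_s \sum_t' ray s t')) addrC; congr (_ + _).
rewrite -sumrB (bigD1 0) //= [X in _ + X]big1 ?addr0 => [|s s0].
  rewrite -sumrB (bigD1 0) //= [X in _ + X]big1 ?addr0 => [|t t0]; last by rewrite E ?t0 ?orbT ?subrr.
  congr (_ - _).
    by apply: eq_bigr => t _; apply: eq_bigr => s' _; rewrite mul0r mulr0 eqxx mul1r.
  by rewrite /ray; under eq_bigr => r _ do rewrite mulr0; rewrite (sum_F1 cardF).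
by rewrite -sumrB big1 // => t _; rewrite E ?s0 ?subrr.
Qed.

(** In the coordinates [x = s + t], [u = t - s], [v = t' + s'], [y = t' - s'] the equation
    [x^2 - u^2 = v^2 - y^2] becomes [s t = s' t']. *)
Lemma sum_quadric_planes (g : F -> R) :
  \sum_x \sum_y \sum_u \sum_v (x ^+ 2 + y ^+ 2 == u ^+ 2 + v ^+ 2)%:R * (g x * g y * g u * g v) =
  \sum_r (\sum_s \sum_t g (s + r * t) * g (r * t - s) * (g (t + r * s) * g (t - r * s)))
  + (\sum_t g t ^+ 2) * (\sum_t g t * g (- t)) - p%:R * g 0 ^+ 4.
Proof.
pose G s t s' t' := g (s + t) * g (t - s) * (g (t' + s') * g (t' - s')).
have G0 : G 0 0 0 0 = g 0 ^+ 4 by rewrite /G subrr addr0; ring.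
have Goo : \sum_t \sum_s' G 0 t s' 0 = (\sum_t g t ^+ 2) * (\sum_t g t * g (- t)).
  rewrite big_distrl /=; apply: eq_bigr => t _; rewrite big_distrr /=; apply: eq_bigr => s _.
  by rewrite /G add0r subr0 add0r sub0r.
rewrite -G0 -Goo -sum_cone_planes.
transitivity (\sum_x \sum_u \sum_y \sum_v (x ^+ 2 + y ^+ 2 == u ^+ 2 + v ^+ 2)%:R * (g x * g y * g u * g v)).
  by apply: eq_bigr => x _; exact: exchange_big.
rewrite -(@reindex_lin2 1 1 (-1) 1 0 0 (fun x u => \sum_y \sum_v _)); last by rewrite mulr1 mul1r opprK.
apply: eq_bigr => s _; apply: eq_bigr => t _.
transitivity (\sum_v \sum_y (s * t == v * y)%:R * G s t v y); last by [].
rewrite exchange_big -(@reindex_lin2 1 1 (-1) 1 0 0 (fun v y => _)); last by rewrite mulr1 mul1r opprK.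
apply: eq_bigr => s' _; apply: eq_bigr => t' _; rewrite /G.
have -> : ((1 * s + 1 * t + 0) ^+ 2 + (-1 * s' + 1 * t' + 0) ^+ 2 ==
     (-1 * s + 1 * t + 0) ^+ 2 + (1 * s' + 1 * t' + 0) ^+ 2) = (s * t == s' * t').
  rewrite -subr_eq0 -[RHS]subr_eq0.
  have -> : (1 * s + 1 * t + 0) ^+ 2 + (-1 * s' + 1 * t' + 0) ^+ 2 -
     ((-1 * s + 1 * t + 0) ^+ 2 + (1 * s' + 1 * t' + 0) ^+ 2) = 2 * 2 * (s * t - s' * t') by ring.
  by rewrite !mulf_eq0 (negPf F2).
congr (_ * _).
have -> : 1 * s + 1 * t + 0 = s + t by ring.
have -> : -1 * s' + 1 * t' + 0 = t' - s' by ring.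
have -> : -1 * s + 1 * t + 0 = t - s by ring.
have -> : 1 * s' + 1 * t' + 0 = t' + s' by ring.
ring.
Qed.
End PlaneSums.

Section PlaneCounts.
Variables (R : realFieldType) (F : finFieldType) (p : nat).
Hypotheses (p_pr : prime p) (p_gt3 : (3 < p)%N) (cardF : #|F| = p).
Local Notation χ := (@chi R F p).
Let p_gt2 : (2 < p)%N := ltnW p_gt3.
Let χ0 : χ 0 = 0 := chi0 R F p.
Let χ1 : χ 1 = 1 := chi1 R F p.
Let χM x y : χ (x * y) = χ x * χ y := chiM R p_pr p_gt2 cardF x y.
Let F2 : (2 : F) != 0 := F2_neq0 p_pr p_gt2 cardF.

(** The sum over [y] has two linear factors and equals a constant plus a spike at [x = - c / a]; the
    constant is killed by the remaining sum of [χ x]. *)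
Lemma sum2_chi_triple (a b c : F) : a != 0 -> b != 0 ->
  \sum_x \sum_y χ x * χ y * χ (a * x + b * y + c) = p%:R * χ (- (a * b * c)).
Proof.
move=> a0 b0.
transitivity (\sum_x χ x * χ b * (p%:R * (x == - c / a)%:R - 1)).
  apply: eq_bigr => x _.
  have E : (a * x + c == 0) = (x == - c / a).
    have -> : a * x + c = a * (x - - c / a) by field.
    by rewrite mulf_eq0 (negPf a0) subr_eq0.
  have := @sum_chi2 R F p p_pr p_gt2 cardF 1 0 b (a * x + c) (oner_neq0 _) b0.
  rewrite !mul1r mul0r E -mulrA => <-; rewrite big_distrr /=; apply: eq_bigr => y _.
  by rewrite mul1r addr0 -mulrA; congr (_ * (_ * χ _)); ring.
rewrite (eq_bigr (fun x => (x == - c / a)%:R * (p%:R * χ x * χ b) - χ b * χ x)); last by move=> x _; ring.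
rewrite sumrB -big_distrr /= (sum_chi R p_pr p_gt2 cardF) mulr0 subr0 sum_delta -mulrA -χM; congr (_ * _).
have -> : - (a * b * c) = - c / a * b * a ^+ 2 by field.
by rewrite [RHS]χM chi_sq // mulr1.
Qed.

(** Put [y = l x], so that [χ x * χ y = χ l]. The remaining two forms in [x] are proportional only
    for [l = 1], which yields the [p]; every other [l] contributes the [-1] of [sum_chi2], hence the
    subtracted sum. *)
Lemma sum2_chi_quad (a b c : F) : a ^+ 2 != b ^+ 2 -> c != 0 ->
  \sum_x \sum_y χ x * χ y * χ (a * x + b * y + c) * χ (b * x + a * y + c) =
  p%:R - \sum_l χ l * χ (a + b * l) * χ (b + a * l).
Proof.
move=> ab c0.
have Dab : (a - b) * (a + b) != 0 by rewrite -subr_sqr subr_eq0.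
have [amb apb] : a - b != 0 /\ a + b != 0 by move: Dab; rewrite mulf_eq0 negb_or => /andP.
transitivity (\sum_l \sum_x χ l * (χ ((a + b * l) * x + c) * χ ((b + a * l) * x + c))).
  rewrite exchange_big exchange_big /=; rewrite [RHS]exchange_big; apply: eq_bigr => x _.
  have [->|x0] := eqVneq x 0.
    transitivity (0 : R); first by apply: big1 => y _; rewrite χ0 !mul0r.
    under eq_bigr => l _ do rewrite !mulr0 !add0r.
    by rewrite -big_distrl /= (sum_chi R p_pr p_gt2 cardF) mul0r.
  rewrite (reindex_inj (mulIf x0)) /=; apply: eq_bigr => l _.
  have -> : a * x + b * (l * x) + c = (a + b * l) * x + c by ring.
  have -> : b * x + a * (l * x) + c = (b + a * l) * x + c by ring.
  by rewrite χM; have := chi_sqr R p x0; rewrite expr2 => H; rewrite -[RHS]mul1r -H; ring.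
transitivity (\sum_l χ l * (χ (a + b * l) * χ (b + a * l)) * (p%:R * (l == 1)%:R - 1)).
  apply: eq_bigr => l _; rewrite -big_distrr /= -mulrA; congr (_ * _).
  have [u0|u0] := eqVneq (a + b * l) 0.
    have v0 : b + a * l != 0.
      apply: contraNneq Dab => v0.
      have : (a - b) * (a + b) = a * (a + b * l) - b * (b + a * l) by ring.
      by rewrite u0 v0 !mulr0 subrr => ->.
    rewrite u0 χ0 !mul0r; under eq_bigr => x _ do rewrite mul0r add0r.
    by rewrite -big_distrr /= sum_chi_aff // mulr0.
  have [v0|v0] := eqVneq (b + a * l) 0.
    rewrite v0 χ0 !mulr0 mul0r; under eq_bigr => x _ do rewrite mul0r add0r.
    by rewrite -big_distrl /= sum_chi_aff // mul0r.
  rewrite (sum_chi2 R p_pr p_gt2 cardF) // χM; congr (_ * (_ * (nat_of_bool _)%:R - _)).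
  rewrite [c * _]mulrC (inj_eq (mulIf c0)) -subr_eq0.
  have -> : a + b * l - (b + a * l) = (a - b) * (1 - l) by ring.
  by rewrite mulf_eq0 (negPf amb) subr_eq0 eq_sym.
rewrite (eq_bigr (fun l => (l == 1)%:R * (p%:R * (χ l * (χ (a + b * l) * χ (b + a * l))))
    - χ l * χ (a + b * l) * χ (b + a * l))); last by move=> l _; ring.
rewrite sumrB sum_delta !mulr1 χ1 mul1r [b + a]addrC -χM -expr2 chi_sq // mulr1 //.
Qed.

Lemma sum_expand4 (I : finType) (a b c d : I -> R) :
  \sum_i (1 + a i) * (1 + b i) * ((1 + c i) * (1 + d i)) = #|I|%:R +
  (\sum_i a i + \sum_i b i + \sum_i c i + \sum_i d i) +
  (\sum_i a i * b i + \sum_i a i * c i + \sum_i a i * d i + \sum_i b i * c i + \sum_i b i * d i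
     + \sum_i c i * d i) +
  (\sum_i a i * b i * c i + \sum_i a i * b i * d i + \sum_i c i * d i * a i + \sum_i c i * d i * b i) +
  \sum_i a i * b i * c i * d i.
Proof.
have -> : #|I|%:R = \sum_(i : I) 1 :> R by rewrite sumr_const cardT -cardE.
rewrite -!big_split /=; apply: eq_bigr => i _; ring.
Qed.

(** Any two of the four linear forms can serve as coordinates up to translation, so single
    characters and products of two sum to zero. The four triples reduce to [sum2_chi_triple], two of
    them after taking [a x + b y + c] and [b x + a y + c] as coordinates, and the quadruple is
    [sum2_chi_quad]. *)
Lemma sum2_weights (a b c : F) : a != 0 -> b != 0 -> a ^+ 2 != b ^+ 2 -> c != 0 ->
  \sum_x \sum_y (1 + χ x) * (1 + χ y) * ((1 + χ (a * x + b * y + c)) * (1 + χ (b * x + a * y + c))) =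
  p%:R ^+ 2 + p%:R + 2 * p%:R * χ (- (a * b * c)) * (1 + χ (a + b)) -
  \sum_l χ l * χ (a + b * l) * χ (b + a * l).
Proof.
move=> a0 b0 ab c0; pose D := a ^+ 2 - b ^+ 2.
have D0 : D != 0 by rewrite subr_eq0.
have apb : a + b != 0 by move: D0; rewrite /D subr_sqr mulf_eq0 negb_or => /andP[].
rewrite pair_bigA /= (sum_expand4 (fun z : F * F => χ z.1) (fun z => χ z.2)
  (fun z => χ (a * z.1 + b * z.2 + c)) (fun z => χ (b * z.1 + a * z.2 + c))).
have Z (g : F -> F -> R) : \sum_(z : F * F) g z.1 z.2 = \sum_x \sum_y g x y by rewrite pair_bigA.
have Zy (g : F -> F -> R) : (forall x, \sum_y g x y = 0) -> \sum_(z : F * F) g z.1 z.2 = 0.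
  by move=> H; rewrite Z big1.
have Zx (g : F -> F -> R) : (forall y, \sum_x g x y = 0) -> \sum_(z : F * F) g z.1 z.2 = 0.
  by move=> H; rewrite Z exchange_big big1.
have sχ := sum_chi R p_pr p_gt2 cardF.
have aff1 (u v w : F) : u != 0 -> \sum_x χ (u * x + v + w) = 0.
  by move=> u0; under eq_bigr => x _ do rewrite -addrA; exact: sum_chi_aff.
have aff2 (u v w : F) : u != 0 -> \sum_x χ (v + u * x + w) = 0.
  by move=> u0; under eq_bigr => x _ do rewrite [v + _]addrC; exact: aff1.
have chg (g : F -> F -> R) : \sum_(z : F * F) g (a * z.1 + b * z.2 + c) (b * z.1 + a * z.2 + c) = \sum_x \sum_y g x y.
  rewrite (Z (fun x y => g (a * x + b * y + c) (b * x + a * y + c))) reindex_lin2 //.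
have back (z : F * F) : z.1 = a / D * (a * z.1 + b * z.2 + c) + - b / D * (b * z.1 + a * z.2 + c) - c / (a + b)
   /\ z.2 = - b / D * (a * z.1 + b * z.2 + c) + a / D * (b * z.1 + a * z.2 + c) - c / (a + b).
  by split; rewrite /D; field; rewrite apb -/D D0.
have T3 : p%:R * χ (- (a / D * (- b / D) * (- (c / (a + b))))) = p%:R * χ (- (a * b * c)) * χ (a + b).
  rewrite -[RHS]mulrA -χM; congr (_ * _).
  rewrite -[LHS]mulr1 -(chi_sq R p_pr p_gt2 cardF (mulf_neq0 D0 apb)) -χM; congr χ; field.
  by rewrite apb D0.
rewrite (Zx (fun x y => χ x)) => [|y]; last exact: sχ.
rewrite (Zy (fun x y => χ y)) => [|y]; last exact: sχ.
rewrite (Zx (fun x y => χ (a * x + b * y + c))) => [|y]; last exact: aff1.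
rewrite (Zx (fun x y => χ (b * x + a * y + c))) => [|y]; last exact: aff1.
rewrite (Zy (fun x y => χ x * χ y)) => [|x]; last by rewrite -big_distrr /= sχ mulr0.
rewrite (Zy (fun x y => χ x * χ (a * x + b * y + c))) => [|x]; last by rewrite -big_distrr /= aff2 ?mulr0.
rewrite (Zy (fun x y => χ x * χ (b * x + a * y + c))) => [|x]; last by rewrite -big_distrr /= aff2 ?mulr0.
rewrite (Zx (fun x y => χ y * χ (a * x + b * y + c))) => [|x]; last by rewrite -big_distrr /= aff1 ?mulr0.
rewrite (Zx (fun x y => χ y * χ (b * x + a * y + c))) => [|x]; last by rewrite -big_distrr /= aff1 ?mulr0.
have tri1 : \sum_(z : F * F) χ z.1 * χ z.2 * χ (a * z.1 + b * z.2 + c) = p%:R * χ (- (a * b * c)).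
  by rewrite (Z (fun x y => χ x * χ y * χ (a * x + b * y + c))) sum2_chi_triple.
have tri2 : \sum_(z : F * F) χ z.1 * χ z.2 * χ (b * z.1 + a * z.2 + c) = p%:R * χ (- (a * b * c)).
  by rewrite (Z (fun x y => χ x * χ y * χ (b * x + a * y + c))) sum2_chi_triple // [b * a]mulrC.
have tri3 : \sum_(z : F * F) χ (a * z.1 + b * z.2 + c) * χ (b * z.1 + a * z.2 + c) * χ z.1 =
    p%:R * χ (- (a * b * c)) * χ (a + b).
  under eq_bigr => z _ do rewrite [in χ z.1](proj1 (back z)).
  rewrite (chg (fun u v => χ u * χ v * χ (a / D * u + - b / D * v - c / (a + b)))).
  by rewrite sum2_chi_triple ?T3 // mulf_neq0 ?invr_eq0 ?oppr_eq0.
have tri4 : \sum_(z : F * F) χ (a * z.1 + b * z.2 + c) * χ (b * z.1 + a * z.2 + c) * χ z.2 =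
    p%:R * χ (- (a * b * c)) * χ (a + b).
  under eq_bigr => z _ do rewrite [in χ z.2](proj2 (back z)).
  rewrite (chg (fun u v => χ u * χ v * χ (- b / D * u + a / D * v - c / (a + b)))).
  by rewrite sum2_chi_triple ?[- b / D * (a / D)]mulrC ?T3 // mulf_neq0 ?invr_eq0 ?oppr_eq0.
rewrite tri1 tri2 tri3 tri4 (chg (fun u v => χ u * χ v)).
rewrite (Z (fun x y => χ x * χ y * χ (a * x + b * y + c) * χ (b * x + a * y + c))) sum2_chi_quad //.
rewrite [\sum_x \sum_y _]big1 => [|x _]; last by rewrite -big_distrr /= sχ mulr0.
rewrite card_prod cardF natrM; ring.
Qed.
End PlaneCounts.

(** * The weight of each plane, generic or exceptional *)

Section QuadricCount.
Variables (R : realFieldType) (F : finFieldType) (p : nat).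
Hypotheses (p_pr : prime p) (p_gt3 : (3 < p)%N) (cardF : #|F| = p).
Local Notation χ := (@chi R F p).
Let p_gt2 : (2 < p)%N := ltnW p_gt3.
Let χ0 : χ 0 = 0 := chi0 R F p.
Let χ1 : χ 1 = 1 := chi1 R F p.
Let χM x y : χ (x * y) = χ x * χ y := chiM R p_pr p_gt2 cardF x y.
Let F2 : (2 : F) != 0 := F2_neq0 p_pr p_gt2 cardF.
Let P0 : (0 : R) < p%:R. Proof. by rewrite ltr0n prime_gt0. Qed.

Definition plane_sum k r := \sum_s \sum_t (1 + χ (s + r * t - k)) * (1 + χ (r * t - s - k)) *
   ((1 + χ (t + r * s - k)) * (1 + χ (t - r * s - k))).
(** The sum over directions [l] from [sum2_chi_quad], with both forms multiplied by [2 r]; it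
    involves only the homogeneous parts of the four forms, hence not [k]. *)
Definition infinity_sum (r : F) := \sum_l χ l * χ (1 + l + r ^+ 2 * (1 - l)) * χ (1 + l - r ^+ 2 * (1 - l)).
Definition triple_sum (r : F) := χ (- (r * (1 + r) * (1 + r ^+ 2))) + χ (- ((1 + r) * (1 + r ^+ 2))).
Definition generic_plane k r :=
  p%:R ^+ 2 + p%:R + 2 * p%:R * χ k * triple_sum r - infinity_sum r.

(** The excluded slopes are those where the four forms degenerate: at [r = 0] the first two are no
    coordinates, [r^2 = 1] makes [b = 0], and [r^2 = -1] makes [a = 0]. *)
Lemma plane_sum_generic k r : k != 0 -> r != 0 -> r ^+ 2 != 1 -> r ^+ 2 != -1 ->
  plane_sum k r = generic_plane k r.
Proof.
move=> k0 r0 r1 rN1.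
have rm : r - 1 != 0 by rewrite subr_eq0; apply: contra_neq r1 => ->; rewrite expr1n.
have rp : r + 1 != 0 by rewrite addr_eq0; apply: contra_neq r1 => ->; rewrite sqrrN expr1n.
have ri : r ^+ 2 + 1 != 0 by rewrite addr_eq0.
(* Coefficients of [t + r s - k] and [t - r s - k] in the coordinates [x = s + r t - k],
   [y = r t - s - k]. *)
pose a := (r^-1 + r) / 2; pose b := (r^-1 - r) / 2; pose c := k * (r^-1 - 1).
have aE : a = (r ^+ 2 + 1) / (2 * r) by rewrite /a; field; rewrite r0 F2.
have bE : b = - ((r - 1) * (r + 1)) / (2 * r) by rewrite /b; field; rewrite r0 F2.
have cE : c = - k * (r - 1) / r by rewrite /c; field.
have a0 : a != 0 by rewrite aE !mulf_neq0 ?invr_eq0 ?mulf_neq0.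
have b0 : b != 0 by rewrite bE !mulf_neq0 ?invr_eq0 ?oppr_eq0 ?mulf_neq0.
have c0 : c != 0 by rewrite cE !mulf_neq0 ?invr_eq0 ?oppr_eq0.
have abE : a + b = r^-1 by rewrite /a /b; field; rewrite r0 F2.
have ab : a ^+ 2 != b ^+ 2.
  rewrite -subr_eq0; have -> : a ^+ 2 - b ^+ 2 = 1 by rewrite /a /b; field; rewrite r0 F2.
  exact: oner_neq0.
have tri : χ (- (a * b * c)) = χ k * χ (- (r * (1 + r) * (1 + r ^+ 2))).
  rewrite -χM -[RHS]mulr1 -(chi_sq R p_pr p_gt2 cardF (x := (r - 1) / (2 * r ^+ 2))) -?χM.
    by congr χ; rewrite aE bE cE; field; rewrite r0 F2.
  by rewrite !mulf_neq0 ?invr_eq0 ?mulf_neq0 ?expf_neq0.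
have tri' : χ (- (r * (1 + r) * (1 + r ^+ 2))) * χ r^-1 = χ (- ((1 + r) * (1 + r ^+ 2))).
  by rewrite -χM; congr χ; field.
rewrite /plane_sum.
have := sum2_weights R p_pr p_gt3 cardF a0 b0 ab c0.
rewrite -(@reindex_lin2 R F 1 r (-1) r (- k) (- k)); last first.
  by rewrite mul1r mulrN1 opprK -mulr2n -mulr_natl mulf_neq0.
move=> E; transitivity (p%:R ^+ 2 + p%:R + 2 * p%:R * χ (- (a * b * c)) * (1 + χ (a + b)) -
    \sum_l χ l * χ (a + b * l) * χ (b + a * l)).
  rewrite -E; apply: eq_bigr => s _; apply: eq_bigr => t _.
  have -> : s + r * t - k = 1 * s + r * t - k by ring.
  have -> : r * t - s - k = -1 * s + r * t - k by ring.
  congr (_ * ((1 + χ _) * (1 + χ _))); rewrite aE bE cE; field; by rewrite r0 F2.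
rewrite tri abE /generic_plane /triple_sum -tri'; congr (_ - _); first by ring.
rewrite /infinity_sum; apply: eq_bigr => l _; rewrite -!mulrA -!χM.
rewrite -[LHS]mulr1 -(chi_sq R p_pr p_gt2 cardF (x := 2 * r)) ?mulf_neq0 // -χM; congr χ.
by rewrite aE bE; field; rewrite r0 F2.
Qed.

Lemma chiN1_norm x : `|χ x| <= 1. Proof. exact: chi_norm. Qed.

Lemma norm_infinity_sum r : `|infinity_sum r| <= p%:R.
Proof.
rewrite /infinity_sum; under eq_bigr => l _ do rewrite -!χM.
by have := norm_sum_chi R p (fun l => l * (1 + l + r ^+ 2 * (1 - l)) * (1 + l - r ^+ 2 * (1 - l))); rewrite cardF.
Qed.

Lemma chi_cube x : χ x ^+ 3 = χ x.
Proof.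
have [->|x0] := eqVneq x 0; first by rewrite χ0 expr0n.
by rewrite exprS chi_sqr // mulr1.
Qed.

Lemma weight_sqr_sum k : \sum_x (1 + χ (x - k)) ^+ 2 = 2 * p%:R - 1.
Proof.
rewrite -(reindex_aff _ k (oner_neq0 _)).
rewrite (eq_bigr (fun x => 1 + 2 * χ x + χ x ^+ 2)) => [|x _]; last by rewrite mul1r addrK; ring.
rewrite !big_split /= (sum_F1 cardF) -big_distrr /= (sum_chi R p_pr p_gt2 cardF) (sum_chi_sqr R cardF); ring.
Qed.

Lemma weight_pair_sum k c : k != 0 -> c != 0 -> c != 1 ->
  \sum_x (1 + χ (x - k)) * (1 + χ (c * x - k)) = p%:R - χ c.
Proof.
move=> k0 c0 c1.
rewrite (eq_bigr (fun x => 1 + χ (1 * x + - k) + χ (c * x + - k) + χ (1 * x + - k) * χ (c * x + - k)));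
  last by move=> x _; rewrite mul1r; ring.
rewrite !big_split /= (sum_F1 cardF) !(sum_chi_aff R p_pr p_gt2 cardF) ?oner_neq0 //.
rewrite (sum_chi2 R p_pr p_gt2 cardF) ?oner_neq0 // !mul1r [- k * c]mulNr eqr_opp.
rewrite -{1}[k]mulr1 (inj_eq (mulfI k0)) eq_sym (negPf c1) /= mulr0n; ring.
Qed.

(** On the exceptional planes with [r != 0] the last two linear parts are multiples of the first
    two, so the weight is a product of one function of each coordinate and the double sum is a
    square. *)
Lemma plane_sum_split k r (g : F -> R) : r != 0 ->
  (forall s t, (1 + χ (s + r * t - k)) * (1 + χ (r * t - s - k)) *
   ((1 + χ (t + r * s - k)) * (1 + χ (t - r * s - k))) = g (s + r * t) * g (r * t - s)) ->
  plane_sum k r = (\sum_x g x) ^+ 2.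
Proof.
move=> r0 gE; rewrite /plane_sum expr2 big_distrl /=.
under [RHS]eq_bigr => x _ do rewrite big_distrr /=.
rewrite -(@reindex_lin2 R F 1 r (-1) r 0 0 (fun x y => g x * g y)); last first.
  by rewrite mul1r mulrN1 opprK -mulr2n -mulr_natl mulf_neq0.
apply: eq_bigr => s _; apply: eq_bigr => t _; rewrite gE; congr (g _ * g _); ring.
Qed.

Lemma plane_sum_1 k : plane_sum k 1 = (2 * p%:R - 1) ^+ 2.
Proof.
rewrite -(weight_sqr_sum k); apply: plane_sum_split; first exact: oner_neq0.
by move=> s t; rewrite !mul1r [t + s]addrC; ring.
Qed.

Lemma FN1 : (-1 : F) != 1. Proof. by rewrite eq_sym (F1_neqN1 p_pr p_gt2 cardF). Qed.

Lemma plane_sum_N1 k : k != 0 -> plane_sum k (-1) = (p%:R - χ (-1)) ^+ 2.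
Proof.
move=> k0; rewrite -(weight_pair_sum k0 (c := -1)) ?oppr_eq0 ?oner_neq0 ?FN1 //.
apply: plane_sum_split; first by rewrite oppr_eq0 oner_neq0.
move=> s t; have -> : t + -1 * s = -1 * (s + -1 * t) by ring.
have -> : t - -1 * s = -1 * (-1 * t - s) by ring.
ring.
Qed.

Lemma plane_sum_sqrtN1 k r : k != 0 -> r ^+ 2 = -1 -> plane_sum k r = (p%:R - χ (- r)) ^+ 2.
Proof.
move=> k0 ri.
have r0 : r != 0 by apply/eqP => r0; move/eqP: ri; rewrite r0 expr0n eq_sym oppr_eq0 oner_eq0.
have r1 : - r != 1 by apply/eqP => r1; move/eqP: ri; rewrite -sqrrN r1 expr1n (negPf (F1_neqN1 p_pr p_gt2 cardF)).
rewrite -(weight_pair_sum k0 (c := - r)) ?oppr_eq0 //.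
apply: plane_sum_split => // s t.
have -> : t + r * s = - r * (r * t - s).
  rewrite (_ : - r * (r * t - s) = r * s - r ^+ 2 * t); last by ring.
  by rewrite ri; ring.
have -> : t - r * s = - r * (s + r * t).
  rewrite (_ : - r * (s + r * t) = - r * s - r ^+ 2 * t); last by ring.
  by rewrite ri; ring.
ring.
Qed.

Lemma plane_sum_0 k : k != 0 -> plane_sum k 0 = (p%:R - χ (-1)) * (2 * p%:R - 1).
Proof.
move=> k0; rewrite -(weight_pair_sum k0 (c := -1)) ?oppr_eq0 ?oner_neq0 ?FN1 //.
rewrite -(weight_sqr_sum k) big_distrl /=; apply: eq_bigr => s _; rewrite big_distrr /=.
apply: eq_bigr => t _; rewrite !mul0r !addr0 sub0r subr0 mulN1r; ring.
Qed.

Lemma norm_triple_sum r : `|triple_sum r| <= 2.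
Proof.
apply: le_trans (ler_normD _ _) _.
by have := chiN1_norm (- (r * (1 + r) * (1 + r ^+ 2))); have := chiN1_norm (- ((1 + r) * (1 + r ^+ 2))); lra.
Qed.
End QuadricCount.

(** * The weighted number of points of the cone *)

Section QuadricTotal.
Variables (R : realFieldType) (F : finFieldType) (p : nat).
Hypotheses (p_pr : prime p) (p_gt3 : (3 < p)%N) (cardF : #|F| = p).
Local Notation χ := (@chi R F p).
Let p_gt2 : (2 < p)%N := ltnW p_gt3.
Let χ0 : χ 0 = 0 := chi0 R F p.
Let χ1 : χ 1 = 1 := chi1 R F p.
Let χM x y : χ (x * y) = χ x * χ y := chiM R p_pr p_gt2 cardF x y.
Let F2 : (2 : F) != 0 := F2_neq0 p_pr p_gt2 cardF.
Let P0 : (0 : R) < p%:R. Proof. by rewrite ltr0n prime_gt0. Qed.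
Let P1 : (1 : R) <= p%:R. Proof. by rewrite ler1n prime_gt0. Qed.
Let nχ x : `|χ x| <= 1 := chi_norm R p x.

Lemma sum_chi_cubic_Poly (c0 c1 c2 c3 : F) : c3 != 0 -> c0 != 0 ->
  (\sum_x χ (c0 + (c1 + (c2 + c3 * x) * x) * x)) ^+ 2 <= 10 ^+ 4 * p%:R.
Proof.
move=> c30 c00; pose f := Poly [:: c0; c1; c2; c3].
have fE : polyseq f = [:: c0; c1; c2; c3] by rewrite (@PolyK _ 0).
have fh x : f.[x] = c0 + (c1 + (c2 + c3 * x) * x) * x.
  by rewrite horner_Poly /= mul0r add0r; ring.
under eq_bigr => x _ do rewrite -fh.
by apply: sum_chi_cubic_sqr => //; rewrite ?fE // fh mulr0 addr0.
Qed.

Definition theta : R := 2 * \sum_r triple_sum R p (r : F).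

(** The quartic [x (1 + x) (1 + x^2)] is turned into the cubic [(1 + x) (1 + x^2)] by [x -> 1/x], up
    to the square [x^4]; the point [x = 0] accounts for [χ (-1)]. So [theta] is four times a single
    cubic sum, minus [2 χ (-1)]. *)
Lemma theta_sqr : theta ^+ 2 <= 10 ^+ 6 * p%:R.
Proof.
pose f (x : F) := - ((1 + x) * (1 + x ^+ 2)).
pose S2 := \sum_x χ (f x).
have B2 : S2 ^+ 2 <= 10 ^+ 4 * p%:R.
  have := @sum_chi_cubic_Poly (-1) (-1) (-1) (-1); rewrite oppr_eq0 oner_neq0 => /(_ isT isT).
  by congr (_ ^+ 2 <= _); apply: eq_bigr => x _; congr χ; rewrite /f; ring.
have S1 : \sum_x χ (- (x * (1 + x) * (1 + x ^+ 2))) = S2 - χ (-1).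
  rewrite /S2 [in RHS](reindex_inj (can_inj (@invrK F))) /= [in RHS](bigD1 0) //= [in LHS](bigD1 0) //=.
  rewrite !mul0r oppr0 χ0 add0r invr0 /f addr0 expr0n addr0 mulr1 addrC addrK.
  apply: eq_bigr => x x0.
  rewrite -[RHS]mulr1 -(chi_sq R p_pr p_gt2 cardF (x := x ^+ 2)) ?expf_neq0 // -χM.
  by congr χ; field.
have -> : theta = 4 * S2 - 2 * χ (-1).
  by rewrite /theta /triple_sum big_split /= S1 -/S2; ring.
have := nχ (-1); rewrite ler_norml => /andP[]; move: B2 P1.
set s := S2; set c := χ (-1); set P : R := p%:R => *.
have : 0 <= (4 * s + 2 * c) ^+ 2 by exact: sqr_ge0.
nra.
Qed.

(** The shift [s = x + 2] gives [-(x + 1)(x + 2)(x + 3)], whose constant term [-6] is nonzero as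
    [p > 3]; the Stepanov bound requires a nonzero value at 0. *)
Lemma chi_jacobsthal_sqr : (\sum_s χ s * χ (1 + s) * χ (1 - s)) ^+ 2 <= 10 ^+ 4 * p%:R.
Proof.
have := @sum_chi_cubic_Poly (-6) (-11) (-6) (-1); rewrite !oppr_eq0 oner_neq0 => /(_ isT).
have -> : (6 : F) != 0.
  have -> : (6 : F) = 2 * 3 by rewrite -natrM.
  by rewrite mulf_neq0 // (Fp_nat_neq0 p_pr cardF).
move=> /(_ isT); congr (_ ^+ 2 <= _).
rewrite -[RHS](reindex_aff _ 2 (oner_neq0 _)); apply: eq_bigr => x _.
by rewrite -!χM; congr χ; ring.
Qed.

(** Replace [r^2] by [s] with weight [1 + χ s]. The unweighted part is a two-factor sum, bounded by
    1 unless [l] is 1 or -1. In the part with [χ s], scaling [s] by [(1 + l)/(1 - l)] gives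
    [χ (1 + l) * χ (1 - l) * J], and the sum over [l] then produces a second factor [J]. *)
Lemma norm_sum_infinity : `|\sum_r infinity_sum R p (r : F)| <= 10 ^+ 5 * p%:R.
Proof.
pose J := \sum_s χ s * χ (1 + s) * χ (1 - s).
pose h1 l := \sum_s χ ((1 - l) * s + (1 + l)) * χ (- (1 - l) * s + (1 + l)).
pose h2 l := \sum_s χ s * (χ ((1 - l) * s + (1 + l)) * χ (- (1 - l) * s + (1 + l))).
have -> : \sum_r infinity_sum R p (r : F) = \sum_l χ l * h1 l + \sum_l χ l * h2 l.
  rewrite -big_split /infinity_sum exchange_big; apply: eq_bigr => l _ /=.
  rewrite -mulrDr -big_split /=.
  transitivity (χ l * \sum_r (χ ((1 - l) * r ^+ 2 + (1 + l)) * χ (- (1 - l) * r ^+ 2 + (1 + l)))).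
    rewrite big_distrr; apply: eq_bigr => r _ /=; rewrite -mulrA; congr (_ * (χ _ * χ _)); ring.
  congr (_ * _); rewrite (sum_sqr p_pr p_gt2 cardF (fun s => χ ((1 - l) * s + (1 + l)) * χ (- (1 - l) * s + (1 + l)))).
  by apply: eq_bigr => s _; ring.
have h2E l : h2 l = χ (1 + l) * χ (1 - l) * J.
  rewrite /h2; have [u0|u0] := eqVneq (1 + l) 0.
    rewrite u0 χ0 !mul0r; under eq_bigr => s _ do rewrite !addr0 -!χM.
    transitivity (χ (- (1 - l) ^+ 2) * \sum_s χ s).
      rewrite big_distrr /=; apply: eq_bigr => s _.
      rewrite -[χ s in RHS](chi_cube R p) // !exprS !expr0 !mulr1 -!χM; congr χ; ring.
    by rewrite (sum_chi R p_pr p_gt2 cardF) mulr0.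
  have [v0|v0] := eqVneq (1 - l) 0.
    rewrite v0 oppr0 χ0 mulr0 mul0r; under eq_bigr => s _ do rewrite mul0r add0r.
    by rewrite -big_distrl /= (sum_chi R p_pr p_gt2 cardF) mul0r.
  rewrite (reindex_inj (mulfI (mulf_neq0 u0 (invr_neq0 v0)))) /= /J big_distrr /=.
  apply: eq_bigr => s _; rewrite -!χM.
  rewrite -[RHS]mulr1 -(chi_sq R p_pr p_gt2 cardF (mulf_neq0 u0 (invr_neq0 v0))) -χM.
  by congr χ; field.
have -> : \sum_l χ l * h2 l = J ^+ 2.
  by rewrite expr2 {1}/J big_distrl /=; apply: eq_bigr => l _; rewrite h2E; ring.
have h1B l : `|χ l * h1 l| <= 1 + (l == 1)%:R * p%:R + (l == -1)%:R * p%:R.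
  rewrite normrM; apply: (@le_trans _ _ `|h1 l|).
    by rewrite -[leRHS]mul1r ler_wpM2r.
  have triv : `|h1 l| <= p%:R.
    rewrite /h1; under eq_bigr => s _ do rewrite -χM.
    have := norm_sum_chi R p (fun s => ((1 - l) * s + (1 + l)) * (- (1 - l) * s + (1 + l))).
    by rewrite cardF.
  have [l1|l1] := eqVneq l 1; first by rewrite mul1r; apply: le_trans triv _; rewrite /= addrAC lerDr addr_ge0 ?mulr_ge0.
  have [lN|lN] := eqVneq l (-1); first by rewrite mul1r; apply: le_trans triv _; rewrite /= lerDr addr_ge0 ?mulr_ge0.
  rewrite /= !mul0r !addr0 /h1.
  have v0 : 1 - l != 0 by rewrite subr_eq0 eq_sym.
  have u0 : 1 + l != 0 by rewrite addrC addr_eq0.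
  rewrite (sum_chi2 R p_pr p_gt2 cardF) ?oppr_eq0 //.
  have vv : (1 - l == - (1 - l)) = false.
    rewrite -subr_eq0; have -> : 1 - l - - (1 - l) = 2 * (1 - l) by ring.
    by rewrite mulf_eq0 (negPf F2) (negPf v0).
  rewrite [(1 + l) * _]mulrC (inj_eq (mulIf u0)) vv /= mulr0 sub0r.
  by rewrite mulrN1 normrN.
have B1 : `|\sum_l χ l * h1 l| <= 3 * p%:R.
  apply: le_trans (ler_norm_sum _ _ _) _; apply: le_trans (ler_sum _ (fun l _ => h1B l)) _.
  rewrite !big_split /= (sum_delta 1 (fun=> p%:R)) (sum_delta (-1) (fun=> p%:R)) (sum_F1 cardF) mulr1.
  by lra.
apply: le_trans (ler_normD _ _) _; rewrite [`|J ^+ 2|]ger0_norm ?sqr_ge0 //.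
by have := chi_jacobsthal_sqr; rewrite -/J; have := P0; lra.
Qed.

(** The three shapes of exceptional plane: [r = -1] or [r^2 = -1] has no excess of order [P^2] over
    the generic value, [r = 0] exceeds it by [P^2], and [r = 1] by [3 P^2]. *)
Lemma plane_error_bound (P c d t A : R) : 1 <= P -> `|c| <= 1 -> `|d| <= 1 -> `|t| <= 2 -> `|A| <= P ->
  [/\ `|(P - c) ^+ 2 - (P ^+ 2 + P + 2 * P * d * t - A)| <= 20 * P,
      `|(P - c) * (2 * P - 1) - (P ^+ 2 + P + 2 * P * d * t - A) - P ^+ 2| <= 20 * P &
      `|(2 * P - 1) ^+ 2 - (P ^+ 2 + P + 2 * P * d * t - A) - 3 * P ^+ 2| <= 20 * P].
Proof.
move=> P1' cB dB tB AB; have dtB : `|d * t| <= 2.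
  by rewrite normrM -[leRHS]mul1r; apply: ler_pM.
have -> : 2 * P * d * t = 2 * P * (d * t) by ring.
move: (d * t) dtB => u uB {dB tB}; move: cB uB AB; rewrite !ler_norml.
move=> /andP[c1 c2] /andP[u1 u2] /andP[A1 A2].
have Pge : 0 <= P by lra.
have h1 : 0 <= P * (1 - c) by rewrite mulr_ge0 // subr_ge0.
have h2 : 0 <= P * (1 + c) by rewrite mulr_ge0 //; lra.
have h3 : 0 <= P * (2 - u) by rewrite mulr_ge0 // subr_ge0.
have h4 : 0 <= P * (2 + u) by rewrite mulr_ge0 //; lra.
have h5 : 0 <= (1 - c) * (1 + c) by rewrite mulr_ge0 //; lra.
have h6 : 0 <= c ^+ 2 by exact: sqr_ge0.
by split; apply/andP; split; lra.
Qed.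

Let err k r := plane_sum R p (k : F) r - generic_plane R p k r.

Lemma plane_error_generic k r : k != 0 -> r != 0 -> r != 1 -> r != -1 ->
  `|err k r| <= (r ^+ 2 == -1)%:R * (20 * p%:R).
Proof.
move=> k0 r0 r1 rN1; have [ri|ri] := eqVneq (r ^+ 2) (-1); last first.
  by rewrite /err plane_sum_generic // ?subrr ?normr0 ?mul0r // sqrf_eq1 negb_or r1.
rewrite mul1r /err (plane_sum_sqrtN1 R p_pr p_gt3 cardF k0 ri) /generic_plane.
by have [] := plane_error_bound P1 (nχ (- r)) (nχ k) (norm_triple_sum R p r) (norm_infinity_sum R p_pr p_gt3 cardF r).
Qed.

Lemma sum_plane_error k : k != 0 -> `|\sum_r err k r - 4 * p%:R ^+ 2| <= 100 * p%:R.
Proof.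
move=> k0.
have b r := plane_error_bound P1 (nχ (-1)) (nχ k) (norm_triple_sum R p (r : F)) (norm_infinity_sum R p_pr p_gt3 cardF r).
have e0 : `|err k 0 - p%:R ^+ 2| <= 20 * p%:R by rewrite /err plane_sum_0 //; case: (b 0).
have e1 : `|err k 1 - 3 * p%:R ^+ 2| <= 20 * p%:R by rewrite /err plane_sum_1 //; case: (b 1).
have eN : `|err k (-1)| <= 20 * p%:R by rewrite /err plane_sum_N1 //; case: (b (-1)).
have N10 : (-1 : F) != 0 by rewrite oppr_eq0 oner_neq0.
have N11 : (-1 : F) != 1 by exact: (FN1 p_pr p_gt3 cardF).
rewrite (bigD1 0) //= (bigD1 1) ?oner_neq0 //= (bigD1 (-1)) ?N10 ?N11 //=.
have rest : `|\sum_(r | (r != 0) && (r != 1) && (r != -1)) err k r| <= 40 * p%:R.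
  apply: le_trans (ler_norm_sum _ _ _) _.
  apply: (@le_trans _ _ (\sum_(r : F) (r ^+ 2 == -1)%:R * (20 * p%:R))).
    rewrite [leLHS]big_mkcond /=; apply: ler_sum => r _.
    case: ifP => [/andP[/andP[r0 r1] rN]|_]; first exact: plane_error_generic.
    by rewrite mulr_ge0 // mulr_ge0.
  rewrite (sum_sqr p_pr p_gt2 cardF (fun x => (x == -1)%:R * (20 * p%:R))).
  under eq_bigr => x _ do rewrite mulrCA.
  rewrite sum_delta; have := nχ (-1); rewrite ler_norml => /andP[_ H].
  have : 0 <= (1 - χ (-1)) * p%:R by rewrite mulr_ge0 ?subr_ge0 // ltW.
  by lra.
move: e0 e1 eN rest; rewrite !ler_norml; set X := \sum_(r | _) _.
move=> /andP[? ?] /andP[? ?] /andP[? ?] /andP[? ?]; apply/andP; split; lra.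
Qed.

Definition quadric_count (k : F) := \sum_x \sum_y \sum_u \sum_v
  (x ^+ 2 + y ^+ 2 == u ^+ 2 + v ^+ 2)%:R *
  ((1 + χ (x - k)) * (1 + χ (y - k)) * (1 + χ (u - k)) * (1 + χ (v - k))).

(** The coefficient 7 is 1 + 4 + 2: generic planes give [p (p^2 + p)], the planes [r = 0] and
    [r = 1] exceed the generic value by [p^2] and [3 p^2], and the plane at infinity gives about
    [2 p^2]. *)
Lemma quadric_count_asymp k : k != 0 ->
  `|quadric_count k - (p%:R ^+ 3 + 7 * p%:R ^+ 2 + p%:R * χ k * theta)| <= 10 ^+ 6 * p%:R.
Proof.
move=> k0; rewrite /quadric_count.
rewrite (sum_quadric_planes p_pr p_gt3 cardF (fun x => 1 + χ (x - k))).
rewrite weight_sqr_sum //.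
have -> : \sum_t (1 + χ (t - k)) * (1 + χ (- t - k)) = p%:R - χ (-1).
  rewrite -(weight_pair_sum R p_pr p_gt3 cardF k0 (c := -1)) ?oppr_eq0 ?oner_neq0 ?(FN1 p_pr p_gt3 cardF) //.
  by apply: eq_bigr => t _; rewrite mulN1r.
rewrite -/(plane_sum R p k _).
have -> : \sum_r (\sum_s \sum_t (1 + χ (s + r * t - k)) * (1 + χ (r * t - s - k)) *
   ((1 + χ (t + r * s - k)) * (1 + χ (t - r * s - k)))) = 
   p%:R ^+ 3 + p%:R ^+ 2 + p%:R * χ k * theta - \sum_r infinity_sum R p (r : F) + \sum_r err k r.
  have G : \sum_r generic_plane R p k r =
      p%:R ^+ 3 + p%:R ^+ 2 + p%:R * χ k * theta - \sum_r infinity_sum R p (r : F).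
    by rewrite sumrB !big_split /= !(sum_F1 cardF) -big_distrr /= /theta; ring.
  by rewrite /err sumrB G addrC subrK.
have := sum_plane_error k0; have := norm_sum_infinity; have := nχ (0 - k); have := nχ (-1).
rewrite !ler_norml; set I := \sum_r infinity_sum _ _ _; set E := \sum_r err k r.
set c := χ (-1); set d := χ (0 - k) => /andP[c1 c2] /andP[d1 d2] /andP[I1 I2] /andP[E1 E2].
have P0' := ltW P0.
have h1 : 0 <= p%:R * (1 - c) by rewrite mulr_ge0 // subr_ge0.
have h2 : 0 <= p%:R * (1 + c) by rewrite mulr_ge0 //; lra.
have d4 : 0 <= (1 + d) ^+ 4 <= 16.
  rewrite exprn_ge0 /=; last lra.
  have -> : 16 = (2 : R) ^+ 4 by ring.
  by rewrite lerXn2r ?nnegrE; lra.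
have [d41 d42] := andP d4.
have h3 : 0 <= p%:R * (1 + d) ^+ 4 by rewrite mulr_ge0.
have h4 : 0 <= p%:R * (16 - (1 + d) ^+ 4) by rewrite mulr_ge0 // subr_ge0.
move: h3 h4; set D := (1 + d) ^+ 4 => h3 h4.
apply/andP; split; have := P1; lra.
Qed.
End QuadricTotal.

(** * Exponential sums *)

(* The real and imaginary parts of a nontrivial additive character of [F]. *)
Record additive_character (R : realFieldType) (F : finFieldType) (co si : F -> R) := AdditiveCharacter {
  coD : forall x y, co (x + y) = co x * co y - si x * si y;
  siD : forall x y, si (x + y) = si x * co y + co x * si y;
  coN : forall x, co (- x) = co x;
  siN : forall x, si (- x) = - si x;
  co0 : co 0 = 1;
  si_neq0 : forall x, x != 0 -> si x != 0 }.

Section ExponentialSums.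
Variables (R : realFieldType) (F : finFieldType) (p : nat) (co si : F -> R).
Hypotheses (p_pr : prime p) (p_gt3 : (3 < p)%N) (cardF : #|F| = p)
  (ac : additive_character co si).
Local Notation χ := (@chi R F p).
Let p_gt2 : (2 < p)%N := ltnW p_gt3.
Let F2 : (2 : F) != 0 := F2_neq0 p_pr p_gt2 cardF.

Lemma si0 : si 0 = 0.
Proof. by have := siN ac 0; rewrite oppr0 => H; lra. Qed.

Lemma co2Dsi2 x : co x ^+ 2 + si x ^+ 2 = 1.
Proof. by have := coD ac x (- x); rewrite subrr (co0 ac) (coN ac) (siN ac) => ->; ring. Qed.

(** Translation by 1 rotates the vector of the cosine and sine sums by the angle of [1]. This
    rotation fixes only the zero vector, since [si 1 != 0]. *)
Lemma sum_co : \sum_x co x = 0.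
Proof.
have shift (g : F -> R) : \sum_x g x = \sum_x g (x + 1) by rewrite [LHS](reindex_inj (addIr 1)).
set C := \sum_x co x; pose S := \sum_x si x.
have EC : C = C * co 1 - S * si 1.
  rewrite {1}/C shift /C /S !big_distrl -sumrB; apply: eq_bigr => x _; exact: coD.
have ES : S = S * co 1 + C * si 1.
  rewrite {1}/S shift /C /S !big_distrl -big_split; apply: eq_bigr => x _; exact: siD.
have s0 := si_neq0 ac (oner_neq0 F).
have D0 : (co 1 - 1) ^+ 2 + si 1 ^+ 2 != 0.
  rewrite paddr_eq0 ?sqr_ge0 // negb_and; apply/orP; right; by rewrite expf_neq0.
apply: (mulIf D0); rewrite mul0r.
have -> : C * ((co 1 - 1) ^+ 2 + si 1 ^+ 2) =
  (C * co 1 - S * si 1 - C) * (co 1 - 1) + (S * co 1 + C * si 1 - S) * si 1 by ring.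
by rewrite -EC -ES !subrr !mul0r addr0.
Qed.

Lemma sum_co_mul t : \sum_x co (x * t) = p%:R * (t == 0)%:R.
Proof.
have [->|t0] := eqVneq t 0.
  by under eq_bigr => x _ do rewrite mulr0 (co0 ac); rewrite (sum_F1 cardF).
rewrite mulr0; have := sum_co; rewrite (reindex_inj (mulIf t0)); exact.
Qed.

Definition norm_sq (I : finType) (g : I -> F) : R := (\sum_a co (g a)) ^+ 2 + (\sum_a si (g a)) ^+ 2.

Lemma norm_sqE (I : finType) (g : I -> F) : norm_sq g = \sum_a \sum_b co (g a - g b).
Proof.
rewrite /norm_sq !expr2 !big_distrl -big_split; apply: eq_bigr => a _ /=.
rewrite !big_distrr -big_split; apply: eq_bigr => b _ /=.
by rewrite (coD ac) (coN ac) (siN ac); ring.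
Qed.

Lemma norm_sq_sqr (I : finType) (g : I -> F) :
  norm_sq g ^+ 2 = \sum_a \sum_b \sum_c \sum_d co (g a + g b - (g c + g d)).
Proof.
(* [A] is the imaginary part of a squared modulus and vanishes by antisymmetry. Subtracting [A * A]
   lets the product of cosines be rewritten by the addition law. *)
pose A := \sum_a \sum_b si (g a - g b).
have A0 : A = 0.
  have : A = - A.
    rewrite {1}/A exchange_big /A -sumrN; apply: eq_bigr => b _; rewrite -sumrN.
    by apply: eq_bigr => a _; rewrite -(siN ac) opprB.
  by move=> H; lra.
have -> : norm_sq g ^+ 2 = norm_sq g * norm_sq g - A * A by rewrite A0; ring.
rewrite norm_sqE /A !big_distrl -sumrB; apply: eq_bigr => a _ /=.
rewrite [RHS]exchange_big !big_distrl -sumrB; apply: eq_bigr => c _ /=.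
rewrite !big_distrr -sumrB; apply: eq_bigr => b _ /=.
rewrite !big_distrr -sumrB; apply: eq_bigr => d _ /=.
by rewrite -(coD ac); congr co; ring.
Qed.

Lemma fourth_moment (I : finType) (f : I -> F) :
  \sum_(n | n != 0) norm_sq (fun a => n * f a) ^+ 2 =
  p%:R * (\sum_a \sum_b \sum_c \sum_d (f a + f b == f c + f d)%:R) - #|I|%:R ^+ 4.
Proof.
have N0 : norm_sq (fun a => 0 * f a) ^+ 2 = #|I|%:R ^+ 4.
  rewrite /norm_sq.
  under eq_bigr => a _ do rewrite mul0r (co0 ac).
  under [\sum_a si _]eq_bigr => a _ do rewrite mul0r si0.
  by rewrite !sumr_const !cardT -!cardE mul0rn; ring.
rewrite -N0; apply/eqP; rewrite eq_sym subr_eq; apply/eqP.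
have -> : \sum_(n | n != 0) norm_sq (fun a => n * f a) ^+ 2 + norm_sq (fun a => 0 * f a) ^+ 2 =
  \sum_n norm_sq (fun a => n * f a) ^+ 2 by rewrite [RHS](bigD1 0) //= addrC.
under [RHS]eq_bigr => n _ do rewrite norm_sq_sqr.
rewrite [LHS]big_distrr [RHS]exchange_big; apply: eq_bigr => a _ /=.
rewrite [LHS]big_distrr [RHS]exchange_big; apply: eq_bigr => b _ /=.
rewrite [LHS]big_distrr [RHS]exchange_big; apply: eq_bigr => c _ /=.
rewrite [LHS]big_distrr [RHS]exchange_big; apply: eq_bigr => d _ /=.
rewrite -subr_eq0 -sum_co_mul; apply: eq_bigr => n _; congr co; ring.
Qed.

(** Completing the square: with [k = 1/(2c)], [c (x - k)^2 + (x - k)] is [c x^2] plus a constant,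
    and the constants cancel between the two sides. The shift [x = a^2 + k] produces the weight
    [1 + χ (x - k)]. *)
Lemma energy_quadric (c : F) : c != 0 ->
  \sum_(a : F) \sum_(b : F) \sum_(d : F) \sum_(e : F)
    ((c * a ^+ 4 + a ^+ 2) + (c * b ^+ 4 + b ^+ 2) == (c * d ^+ 4 + d ^+ 2) + (c * e ^+ 4 + e ^+ 2))%:R =
  quadric_count R p (2 * c)^-1.
Proof.
move=> c0; set k := (2 * c)^-1.
have sq (g : F -> R) : \sum_a g (a ^+ 2) = \sum_x (1 + χ (x - k)) * g (x - k).
  rewrite (sum_sqr p_pr p_gt2 cardF) -(reindex_aff (fun x => (1 + χ x) * g x) (- k) (oner_neq0 _)).
  by apply: eq_bigr => x _; rewrite mul1r.
pose ψ (x : F) := c * x ^+ 2 + x.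
have ψE a : c * a ^+ 4 + a ^+ 2 = ψ (a ^+ 2) by rewrite /ψ; ring.
transitivity (\sum_(a : F) \sum_(b : F) \sum_(d : F) \sum_(e : F) (ψ (a ^+ 2) + ψ (b ^+ 2) == ψ (d ^+ 2) + ψ (e ^+ 2))%:R : R).
  apply: eq_bigr => a _; apply: eq_bigr => b _; apply: eq_bigr => d _; apply: eq_bigr => e _.
  by rewrite !ψE.
rewrite (sq (fun x => \sum_b \sum_d \sum_e (ψ x + ψ (b ^+ 2) == ψ (d ^+ 2) + ψ (e ^+ 2))%:R)).
apply: eq_bigr => x _.
rewrite (sq (fun y => \sum_d \sum_e (ψ (x - k) + ψ y == ψ (d ^+ 2) + ψ (e ^+ 2))%:R)).
rewrite big_distrr; apply: eq_bigr => y _ /=.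
rewrite (sq (fun u => \sum_e (ψ (x - k) + ψ (y - k) == ψ u + ψ (e ^+ 2))%:R)).
rewrite !big_distrr; apply: eq_bigr => u _ /=.
rewrite (sq (fun v => (ψ (x - k) + ψ (y - k) == ψ (u - k) + ψ v)%:R)).
rewrite !big_distrr; apply: eq_bigr => v _ /=.
have -> : (ψ (x - k) + ψ (y - k) == ψ (u - k) + ψ (v - k)) = (x ^+ 2 + y ^+ 2 == u ^+ 2 + v ^+ 2).
  rewrite -subr_eq0 -[RHS]subr_eq0.
  have -> : ψ (x - k) + ψ (y - k) - (ψ (u - k) + ψ (v - k)) =
     c * (x ^+ 2 + y ^+ 2 - (u ^+ 2 + v ^+ 2)) by rewrite /ψ /k; field; rewrite c0 F2.
  by rewrite mulf_eq0 (negPf c0).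
ring.
Qed.

Lemma two_term_moment (c : F) : c != 0 ->
  \sum_(n | n != 0) norm_sq (fun a : F => c * n * a ^+ 4 + n * a ^+ 2) ^+ 2 =
  p%:R * quadric_count R p (2 * c)^-1 - p%:R ^+ 4.
Proof.
move=> c0; rewrite -energy_quadric // -{2}cardF.
rewrite -(fourth_moment (fun a : F => c * a ^+ 4 + a ^+ 2)).
apply: eq_bigr => n _; congr (_ ^+ 2); rewrite /norm_sq.
by congr (_ ^+ 2 + _ ^+ 2); apply: eq_bigr => a _; [congr co | congr si]; ring.
Qed.

Lemma weighted_moment (S : F -> R) :
  \sum_(m : F | m != 0) \sum_(n : F | n != 0) norm_sq (fun a => m * a ^+ 4 + n * a ^+ 2) ^+ 2 * S (m / n) =
  \sum_(c : F | c != 0) S c * (p%:R * quadric_count R p (2 * c)^-1 - p%:R ^+ 4).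
Proof.
rewrite exchange_big.
transitivity (\sum_(n : F | n != 0) \sum_(c : F | c != 0)
    norm_sq (fun a : F => c * n * a ^+ 4 + n * a ^+ 2) ^+ 2 * S c).
  apply: eq_bigr => n n0; rewrite (reindex_inj (mulIf n0)) /=.
  by apply: eq_big => [c|c _]; [rewrite mulf_eq0 (negPf n0) orbF | rewrite mulfK].
rewrite exchange_big; apply: eq_bigr => c c0; rewrite -two_term_moment // big_distrr.
by apply: eq_bigr => n _; exact: mulrC.
Qed.
End ExponentialSums.

(** * Dedekind sums as cotangent sums *)

Section Residues.
Variables (R : realFieldType) (F : finFieldType) (p : nat).
Hypotheses (p_pr : prime p) (cardF : #|F| = p).

Lemma natF_eq m n : (m%:R == n%:R :> F) = (m == n %[mod p])%N.
Proof.
wlog le : m n / (n <= m)%N => [H|].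
  by have [/H //|/ltnW /H] := leqP n m; rewrite eq_sym => ->; rewrite eq_sym.
by rewrite -subr_eq0 -natrB // -(dvdn_pcharf (pcharF p_pr cardF)) eqn_mod_dvd.
Qed.

Lemma natF_inj m n : (m < p)%N -> (n < p)%N -> (m%:R : F) = n%:R -> m = n.
Proof. by move=> mp np /eqP; rewrite natF_eq !modn_small // => /eqP. Qed.

Lemma natF_p : (p%:R : F) = 0.
Proof. by apply/eqP; rewrite -(dvdn_pcharf (pcharF p_pr cardF)). Qed.

Let ofI (i : 'I_p) : F := (i : nat)%:R.
Let ofI_inj : injective ofI.
Proof. by move=> i j E; apply/val_inj; apply: natF_inj E. Qed.
Let ofI_bij : bijective ofI.
Proof. by apply: inj_card_bij => //; rewrite card_ord cardF. Qed.

Lemma natF_surj x : exists2 n, (n < p)%N & x = n%:R :> F.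
Proof. by case: ofI_bij => g _ gK; exists (g x); rewrite // -[LHS]gK. Qed.

Lemma sumF (g : F -> R) : \sum_x g x = \sum_(i < p) g (i : nat)%:R.
Proof. by rewrite (reindex ofI) //; exact: onW_bij. Qed.

Definition residue (x : F) : nat := find (fun n => x == n%:R) (iota 0%N p).

Lemma residue_nat n : (n < p)%N -> residue n%:R = n.
Proof.
move=> np; rewrite /residue; have Hh : has (fun k => n%:R == k%:R :> F) (iota 0%N p).
  by apply/hasP; exists n; rewrite ?mem_iota.
have := nth_find 0%N Hh; rewrite has_find size_iota in Hh.
by rewrite nth_iota // add0n => /eqP /(natF_inj np Hh).
Qed.

End Residues.

Section DedekindSum.
Variables (R : realFieldType) (F : finFieldType) (p : nat) (co si : F -> R).
Hypotheses (p_pr : prime p) (p_gt3 : (3 < p)%N) (cardF : #|F| = p)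
  (ac : additive_character co si).
Let p_gt2 : (2 < p)%N := ltnW p_gt3.
Let F2 : (2 : F) != 0 := F2_neq0 p_pr p_gt2 cardF.
Let P0 : (0 : R) < p%:R. Proof. by rewrite ltr0n prime_gt0. Qed.
Let Pn0 : (p%:R : R) != 0 := lt0r_neq0 P0.

Definition sawtooth (x : F) : R := if x == 0 then 0 else (residue p x)%:R / p%:R - 1 / 2.
Definition dedekind_sum (h : F) : R := \sum_a sawtooth a * sawtooth (a * h).
(** The half-angle formula: when [co], [si] are taken at [2 pi l / p], this is [cot (pi l / p)].
    Division by zero gives the value 0 at [l = 0]. *)
Definition cotangent (l : F) : R := (1 + co l) / si l.

Lemma cotangent0 : cotangent 0 = 0.
Proof. by rewrite /cotangent (si0 ac) invr0 mulr0. Qed.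

Lemma cotangentN l : cotangent (- l) = - cotangent l.
Proof. by rewrite /cotangent (coN ac) (siN ac) invrN mulrN. Qed.

Lemma cotangent_si l : l != 0 -> cotangent l * si l = 1 + co l.
Proof. by move=> l0; rewrite /cotangent mulfVK // (si_neq0 ac). Qed.

Lemma cotangent_co l : l != 0 -> cotangent l * (1 - co l) = si l.
Proof.
move=> l0; have s0 := si_neq0 ac l0; apply: (mulIf s0).
rewrite mulrAC cotangent_si //; have := co2Dsi2 ac l; nra.
Qed.

Definition sine_sum a := \sum_l cotangent l * si (l * a).

(** [cot * sin] and [cot * (1 - cos)] at [l] are [1 + co l] and [si l], so the difference is a sum
    of cosines without denominators; the [-2] is the missing term [l = 0]. *)
Lemma sine_sum_step a :
  sine_sum (a + 1) - sine_sum a = p%:R * (a + 1 == 0)%:R + p%:R * (a == 0)%:R - 2.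
Proof.
rewrite /sine_sum -!(sum_co_mul cardF ac) -sumrB -big_split /=.
rewrite (bigD1 0) // [in RHS](bigD1 0) //= !mul0r !(co0 ac) cotangent0 !mul0r subrr add0r.
rewrite addrAC [1 + 1]mulr2n subrr add0r; apply: eq_bigr => l l0.
rewrite mulrDr mulr1 (siD ac) (coD ac).
have := cotangent_si l0; have := cotangent_co l0.
set c := cotangent l; set u := co (l * a); set v := si (l * a) => E1 E2.
have -> : c * (v * co l + u * si l) - c * v = u * (c * si l) - v * (c * (1 - co l)) by ring.
by rewrite E1 E2; ring.
Qed.

(** Eisenstein's finite Fourier expansion of the sawtooth, obtained by summing the first differences
    from [sine_sum 0 = 0]. *)
Lemma eisenstein a : sine_sum a = - (2 * p%:R * sawtooth a).
Proof.
have [n np ->] := natF_surj p_pr cardF a.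
have s0 : sine_sum 0 = 0 by rewrite /sine_sum big1 // => l _; rewrite mulr0 (si0 ac) mulr0.
have nz k : (0 < k < p)%N -> (k%:R : F) != 0 by exact: Fp_nat_neq0.
have E k : (k.+1 < p)%N -> sine_sum k.+1%:R = p%:R - 2 * k.+1%:R.
  elim: k => [|k IH] kp.
    have := sine_sum_step 0; rewrite add0r s0 oner_eq0 eqxx /= => H; lra.
  have := sine_sum_step k.+1%:R; have -> : k.+1%:R + 1 = k.+2%:R :> F by rewrite natr1.
  rewrite (negPf (nz k.+2 _)) // (negPf (nz k.+1 _)); last exact: ltnW kp.
  rewrite IH ?(ltnW kp) //; have -> : k.+2%:R = k.+1%:R + 1 :> R by rewrite natr1.
  by move=> H /=; move: H; rewrite /= !mulr0 ; lra.
rewrite /sawtooth; case: n np => [|n] np; first by rewrite eqxx s0 mulr0 oppr0.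
rewrite (negPf (nz _ _)) // residue_nat // E //; by field.
Qed.

Lemma sum_si_si u v : \sum_a si (u * a) * si (v * a) = p%:R / 2 * ((u == v)%:R - (u == - v)%:R).
Proof.
rewrite -[u == v]subr_eq0 -[u == - v]subr_eq0 opprK.
have -> : p%:R / 2 * ((u - v == 0)%:R - (u + v == 0)%:R) =
  (p%:R * (u - v == 0)%:R - p%:R * (u + v == 0)%:R) / 2 :> R by field.
rewrite -!(sum_co_mul cardF ac) -sumrB big_distrl /=; apply: eq_bigr => a _.
rewrite !mulrBr !mulrDr !(coD ac) (coN ac) (siN ac) ![a * _]mulrC; by field.
Qed.

Lemma sum_co_co u v : \sum_a co (u * a) * co (v * a) = p%:R / 2 * ((u == v)%:R + (u == - v)%:R).
Proof.
rewrite -[u == v]subr_eq0 -[u == - v]subr_eq0 opprK.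
have -> : p%:R / 2 * ((u - v == 0)%:R + (u + v == 0)%:R) =
  (p%:R * (u - v == 0)%:R + p%:R * (u + v == 0)%:R) / 2 :> R by field.
rewrite -!(sum_co_mul cardF ac) -big_split big_distrl /=; apply: eq_bigr => a _.
rewrite !mulrBr !mulrDr !(coD ac) (coN ac) (siN ac) ![a * _]mulrC; by field.
Qed.

(** Insert Eisenstein's formula twice. Orthogonality of sines leaves [l = m h] and [l = - m h],
    which contribute equally because the cotangent is odd. *)
Lemma dedekind_cotangent h :
  4 * p%:R * dedekind_sum h = \sum_l cotangent l * cotangent (l * h).
Proof.
have -> : 4 * p%:R * dedekind_sum h = (\sum_a sine_sum a * sine_sum (a * h)) / p%:R.
  rewrite /dedekind_sum big_distrr big_distrl /=; apply: eq_bigr => a _.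
  by rewrite !eisenstein; field.
rewrite /sine_sum.
transitivity ((\sum_l \sum_m cotangent l * cotangent m * (\sum_a si (l * a) * si (m * h * a))) / p%:R).
  congr (_ / _); transitivity (\sum_a \sum_l \sum_m cotangent l * cotangent m * (si (l * a) * si (m * h * a))).
    apply: eq_bigr => a _; rewrite big_distrl; apply: eq_bigr => l _ /=.
    rewrite big_distrr; apply: eq_bigr => m _ /=.
    by rewrite -[m * h * a]mulrA [h * a]mulrC; ring.
  rewrite exchange_big; apply: eq_bigr => l _ /=; rewrite exchange_big; apply: eq_bigr => m _ /=.
  by rewrite -big_distrr.
rewrite exchange_big big_distrl; apply: eq_bigr => m _ /=.
under eq_bigr => l _ do rewrite sum_si_si.
rewrite (eq_bigr (fun l => (l == m * h)%:R * (cotangent l * cotangent m * (p%:R / 2)) -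
   (l == - (m * h))%:R * (cotangent l * cotangent m * (p%:R / 2)))); last by move=> l _; ring.
by rewrite sumrB !sum_delta cotangentN; field.
Qed.

Lemma sum_nat_powers n :
  [/\ \sum_(i < n) (i : nat)%:R = n%:R * (n%:R - 1) / 2 :> R,
      \sum_(i < n) (i : nat)%:R ^+ 2 = n%:R * (n%:R - 1) * (2 * n%:R - 1) / 6 :> R,
      \sum_(i < n) (i : nat)%:R ^+ 3 = (n%:R * (n%:R - 1) / 2) ^+ 2 :> R &
      \sum_(i < n) (i : nat)%:R ^+ 4 =
        n%:R * (n%:R - 1) * (2 * n%:R - 1) * (3 * n%:R ^+ 2 - 3 * n%:R - 1) / 30 :> R].
Proof.
elim: n => [|n [IH1 IH2 IH3 IH4]]; first by rewrite !big_ord0; split; ring.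
by rewrite !big_ord_recr /= IH1 IH2 IH3 IH4 -natr1; split; field.
Qed.

(** The case [h = 1] of [dedekind_cotangent], where the Dedekind sum is an elementary sum of
    squares. *)
Lemma sum_cotangent_sqr : \sum_l cotangent l ^+ 2 = (p%:R - 1) * (p%:R - 2) / 3.
Proof.
have := dedekind_cotangent 1.
under eq_bigr => l _ do rewrite mulr1 -expr2.
move=> <-; rewrite /dedekind_sum; under eq_bigr => a _ do rewrite mulr1 -expr2.
rewrite (sumF p_pr cardF).
(* At residue 0 the sawtooth is 0, whereas the formula [i/p - 1/2] would contribute its square
   [1/4]. *)
transitivity (4 * p%:R * (\sum_(i < p) ((i : nat)%:R / p%:R - 1 / 2) ^+ 2 - 1 / 4) : R).
  congr (_ * _).
  have one : \sum_(i < p) ((i : nat) == 0%N)%:R = 1 :> R.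
    rewrite (bigD1 (Ordinal (prime_gt0 p_pr))) //= big1 ?addr0 // => i i0.
    by case: eqP => // E; case/eqP: i0; apply: val_inj.
  have -> : 1 / 4 = \sum_(i < p) ((i : nat) == 0%N)%:R * (1 / 4) :> R by rewrite -big_distrl /= one; field.
  rewrite -sumrB; apply: eq_bigr => i _ /=.
  rewrite /sawtooth; have [->|i0] := eqVneq (i : nat) 0%N.
    by rewrite eqxx /=; field.
  by rewrite (negPf (Fp_nat_neq0 p_pr cardF _)) ?lt0n ?i0 ?ltn_ord // residue_nat //= mul0r subr0.
have [s1 s2 _ _] := sum_nat_powers p.
rewrite (eq_bigr (fun i : 'I_p => (i : nat)%:R ^+ 2 / p%:R ^+ 2 - (i : nat)%:R / p%:R + 1 / 4)); last by move=> i _; field.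
rewrite big_split sumrB /= -!big_distrl /= s1 s2 sumr_const card_ord -mulr_natl; by field.
Qed.
End DedekindSum.

(** * Closed forms for the sums of the second and fourth powers of the cosecant *)

Section CosecantSums.
Variables (R : realFieldType) (F : finFieldType) (p : nat) (co si : F -> R).
Hypotheses (p_pr : prime p) (p_gt3 : (3 < p)%N) (cardF : #|F| = p)
  (ac : additive_character co si).
Let p_gt2 : (2 < p)%N := ltnW p_gt3.
Let F2 : (2 : F) != 0 := F2_neq0 p_pr p_gt2 cardF.
Let P0 : (0 : R) < p%:R. Proof. by rewrite ltr0n prime_gt0. Qed.
Let Pn0 : (p%:R : R) != 0 := lt0r_neq0 P0.
Local Notation ct := (cotangent co si).

Definition cosecant_sqr (l : F) : R := if l == 0 then 0 else 1 + ct l ^+ 2.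
Local Notation q := cosecant_sqr.

Lemma cosecant_sqr_co l : q l * (1 - co l) = 2 * (l != 0)%:R.
Proof.
rewrite /q; have [_|l0] := eqVneq l 0; first by rewrite mul0r mulr0.
have := cotangent_si ac l0; have := cotangent_co ac l0; set c := ct l => E1 E2.
have -> : (1 + c ^+ 2) * (1 - co l) = 1 - co l + c * (c * (1 - co l)) by ring.
by rewrite E1 E2 /=; ring.
Qed.

Lemma cosecant_sqrN l : q (- l) = q l.
Proof. by rewrite /q oppr_eq0 (cotangentN ac) sqrrN. Qed.

Definition cosine_sum a := \sum_l q l * co (l * a).

(** The second difference multiplies [q l] by [2 co l - 2], which cancels the cosecant; so
    [cosine_sum] is quadratic in the residue, with a kink at 0. *)
Lemma cosine_sum_step a :
  cosine_sum (a + 1) + cosine_sum (a - 1) - 2 * cosine_sum a = 4 - 4 * p%:R * (a == 0)%:R.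
Proof.
transitivity (\sum_l (4 * (l == 0)%:R - 4 * co (l * a)) : R).
  rewrite /cosine_sum big_distrr -big_split -sumrB; apply: eq_bigr => l _ /=.
  rewrite mulrBr mulrDr mulr1 !(coD ac) (coN ac) (siN ac).
  have := cosecant_sqr_co l; have [->|l0] := eqVneq l 0.
    by rewrite mul0r /q eqxx (co0 ac) => _ /=; ring.
  rewrite /= => E; set u := co (l * a).
  have -> : q l * (u * co l - si (l * a) * si l) + q l * (u * co l - si (l * a) * - si l) - 2 * (q l * u) =
     - 2 * u * (q l * (1 - co l)) by ring.
  by rewrite E; ring.
rewrite sumrB -!big_distrr /= (sum_co_mul cardF ac) (bigD1 0) //= big1 => [|l /negPf -> //].
by rewrite eqxx /=; ring.
Qed.

Lemma cosine_sum_nat n : (n < p)%N ->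
  cosine_sum n%:R = cosine_sum 0 - 2 * n%:R * (p%:R - n%:R).
Proof.
have nz k : (0 < k < p)%N -> (k%:R : F) != 0 by exact: Fp_nat_neq0.
have E k : (k.+1 < p)%N -> cosine_sum k%:R = cosine_sum 0 - 2 * k%:R * (p%:R - k%:R) /\
   cosine_sum k.+1%:R = cosine_sum 0 - 2 * k.+1%:R * (p%:R - k.+1%:R).
  elim: k => [|k IH] kp.
    split; first by rewrite mulr0 mul0r subr0.
    have := cosine_sum_step 0; rewrite eqxx add0r sub0r /=.
    (* Evenness supplies the second initial value of the recurrence. *)
    have -> : cosine_sum (-1) = cosine_sum 1.
      rewrite /cosine_sum; apply: eq_bigr => l _; by rewrite mulrN1 (coN ac) mulr1.
    by move=> H; lra.
  have [IH1 IH2] := IH (ltnW kp); split=> //.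
  have := cosine_sum_step k.+1%:R.
  have -> : k.+1%:R + 1 = k.+2%:R :> F by rewrite natr1.
  have -> : k.+1%:R - 1 = k%:R :> F by rewrite -natr1 addrK.
  rewrite (negPf (nz k.+1 _)) ?(ltnW kp) // IH1 IH2 /=.
  have -> : k.+2%:R = k%:R + 2 :> R by rewrite -natrD addn2.
  have -> : k.+1%:R = k%:R + 1 :> R by rewrite natr1.
  by move=> H; lra.
case: n => [|n] np; last by case: (E n np).
by case: (E 0%N) => //; lia.
Qed.

(** The recurrence leaves the value at 0 free; it is fixed by the vanishing of the sum over all [a],
    which holds because [q 0 = 0]. *)
Lemma cosine_sum_0 : cosine_sum 0 = (p%:R ^+ 2 - 1) / 3.
Proof.
have Z : \sum_a cosine_sum a = 0.
  rewrite /cosine_sum exchange_big big1 // => l _; rewrite -big_distrr /=.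
  under eq_bigr => a _ do rewrite mulrC.
  rewrite (sum_co_mul cardF ac) /q; case: eqP => _; rewrite ?mul0r ?mulr0 //.
move: Z; rewrite (sumF p_pr cardF).
rewrite (eq_bigr (fun i : 'I_p => cosine_sum 0 - 2 * p%:R * (i : nat)%:R + 2 * (i : nat)%:R ^+ 2)); last first.
  by move=> i _; rewrite cosine_sum_nat //; ring.
have [s1 s2 _ _] := sum_nat_powers R p.
rewrite big_split sumrB /= -!big_distrr /= s1 s2 sumr_const card_ord -mulr_natl => E.
by apply: (mulfI Pn0); rewrite -[RHS]addr0 -E; field.
Qed.

Lemma sum_cosecant_sqr : \sum_l q l = (p%:R ^+ 2 - 1) / 3.
Proof.
rewrite -cosine_sum_0; apply: eq_bigr => l _; by rewrite mulr0 (co0 ac) mulr1.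
Qed.

(** Parseval for the even function [q], whose cosine transform is the explicit quadratic found
    above. *)
Lemma sum_cosecant_4 : \sum_l q l ^+ 2 = (p%:R ^+ 2 - 1) * (p%:R ^+ 2 + 11) / 45.
Proof.
have E : \sum_a cosine_sum a ^+ 2 = p%:R * \sum_l q l ^+ 2.
  transitivity (\sum_l \sum_m q l * q m * (\sum_a co (l * a) * co (m * a))).
    transitivity (\sum_a \sum_l \sum_m q l * q m * (co (l * a) * co (m * a))).
      apply: eq_bigr => a _; rewrite expr2 {1}/cosine_sum big_distrl; apply: eq_bigr => l _ /=.
      by rewrite /cosine_sum big_distrr; apply: eq_bigr => m _ /=; ring.
    rewrite exchange_big; apply: eq_bigr => l _ /=; rewrite exchange_big; apply: eq_bigr => m _ /=.
    by rewrite -big_distrr.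
  rewrite exchange_big big_distrr; apply: eq_bigr => m _ /=.
  under eq_bigr => l _ do rewrite (sum_co_co cardF ac).
  rewrite (eq_bigr (fun l => (l == m)%:R * (q l * q m * (p%:R / 2)) +
     (l == - m)%:R * (q l * q m * (p%:R / 2)))); last by move=> l _; ring.
  by rewrite big_split !sum_delta cosecant_sqrN /=; field.
apply: (mulfI Pn0); rewrite -E (sumF p_pr cardF).
rewrite (eq_bigr (fun i : 'I_p => ((p%:R ^+ 2 - 1) / 3) ^+ 2 - 4 * ((p%:R ^+ 2 - 1) / 3) * p%:R * (i : nat)%:R
  + (4 * ((p%:R ^+ 2 - 1) / 3) + 4 * p%:R ^+ 2) * (i : nat)%:R ^+ 2 - 8 * p%:R * (i : nat)%:R ^+ 3 +
   4 * (i : nat)%:R ^+ 4)); last first.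
  by move=> i _; rewrite cosine_sum_nat // cosine_sum_0; ring.
have [s1 s2 s3 s4] := sum_nat_powers R p.
rewrite big_split sumrB big_split sumrB /= -!big_distrr /= s1 s2 s3 s4 sumr_const card_ord -mulr_natl.
by field.
Qed.
End CosecantSums.

(** * Inverses of least absolute residues and their correlations *)

Definition harmonic (R : realFieldType) k n : R := \sum_(i < n) i.+1%:R ^- k.

Section SignedInverse.
Variables (R : realFieldType) (F : finFieldType) (p : nat).
Hypotheses (p_pr : prime p) (p_gt3 : (3 < p)%N) (cardF : #|F| = p).
Let p_gt2 : (2 < p)%N := ltnW p_gt3.
Local Notation h := p./2.
Local Notation H k := (harmonic R k h).

Lemma sumF_half (g : F -> R) :
  \sum_x g x = g 0 + \sum_(i < h) (g i.+1%:R + g (- i.+1%:R)).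
Proof.
rewrite (sumF p_pr cardF) -(big_mkord xpredT (fun i => g i%:R)) big_split /=.
have ph := p_half p_pr p_gt2.
have -> : (0 = 0%:R :> F) by [].
rewrite [in LHS]ph big_nat_recl // (@big_cat_nat _ _ _ h) /= -?addnn ?leq_addr //.
rewrite big_mkord; congr (_ + (_ + _)).
rewrite -{1}[h]add0n big_addn addnK.
rewrite big_nat_rev /= add0n big_mkord; apply: eq_bigr => i _; congr g.
apply/eqP; rewrite -addr_eq0 -natrD -(dvdn_pcharf (pcharF p_pr cardF)).
have ih := ltn_ord i; suff -> : ((h - i.+1 + h).+1 + i.+1)%N = p by [].
by rewrite [RHS]ph; lia.
Qed.

Lemma sumF_even (g : F -> R) : g 0 = 0 -> (forall x, g (- x) = g x) ->
  \sum_x g x = 2 * \sum_(i < h) g i.+1%:R.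
Proof.
move=> g0 gN; rewrite sumF_half g0 add0r big_distrr; apply: eq_bigr => i _ /=.
by rewrite gN; ring.
Qed.

Lemma nonzero_nat i : (i < h)%N -> (i.+1%:R : F) != 0.
Proof.
move=> ih; apply: (Fp_nat_neq0 p_pr cardF); rewrite /= (p_half p_pr p_gt2); lia.
Qed.

(** The inverse of the representative of [x] between [-h] and [h], with value 0 at 0: the model of
    the cotangent up to the factor [p / pi]. *)
Definition signed_inverse (x : F) : R :=
  let r := residue p x in if r == 0%N then 0 else if (r <= h)%N then r%:R^-1 else - (p - r)%:R^-1.
Local Notation W := signed_inverse.

Lemma signed_inverse0 : W 0 = 0.
Proof. by rewrite /W (residue_nat p_pr cardF (n := 0)) ?prime_gt0. Qed.

Lemma signed_inverse_nat i : (i < h)%N -> W i.+1%:R = i.+1%:R^-1.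
Proof.
by move=> ih; rewrite /W residue_nat //= ?ih // (p_half p_pr p_gt2); lia.
Qed.

Lemma signed_inverse_natN i : (i < h)%N -> W (- i.+1%:R) = - i.+1%:R^-1.
Proof.
move=> ih; have ph := p_half p_pr p_gt2.
have -> : - i.+1%:R = (p - i.+1)%:R :> F by rewrite natrB ?(natF_p p_pr cardF) ?sub0r //; lia.
rewrite /W residue_nat //; last by lia.
have -> : (p - i.+1 == 0)%N = false by lia.
have -> : (p - i.+1 <= h)%N = false by lia.
by rewrite subKn //; lia.
Qed.

Lemma residue_cases (Q : F -> Prop) : Q 0 -> (forall i, (i < h)%N -> Q i.+1%:R) ->
  (forall i, (i < h)%N -> Q (- i.+1%:R)) -> forall x, Q x.
Proof.
move=> Q0 Q1 Q2 x; have [n np ->] := natF_surj p_pr cardF x; have ph := p_half p_pr p_gt2.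
case: n np => [|n] np //; have [nh|nh] := ltnP n h; first exact: Q1.
have -> : n.+1%:R = - (p - n.+1)%:R :> F by rewrite natrB ?(natF_p p_pr cardF) ?sub0r ?opprK // ltnW.
have -> : (p - n.+1 = (p - n.+2).+1)%N by lia.
by apply: Q2; lia.
Qed.

Lemma signed_inverseN x : W (- x) = - W x.
Proof.
apply: (residue_cases (Q := fun x => W (- x) = - W x)).
- by rewrite oppr0 signed_inverse0 oppr0.
- by move=> i ih; rewrite signed_inverse_nat // signed_inverse_natN.
- by move=> i ih; rewrite opprK signed_inverse_nat // signed_inverse_natN // opprK.
Qed.

Lemma sum_norm_signed_inverse : \sum_x `|W x| = 2 * H 1.
Proof.
rewrite sumF_even ?signed_inverse0 ?normr0 // => [|x]; last by rewrite signed_inverseN normrN.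
congr (_ * _); apply: eq_bigr => i _; rewrite signed_inverse_nat // expr1 ger0_norm // invr_ge0 //.
Qed.

Definition correlation (l : F) : R := \sum_x W x * W (x * l).
Local Notation V := correlation.

Lemma sum_norm_correlation : \sum_l `|V l| <= (2 * H 1) ^+ 2.
Proof.
apply: (@le_trans _ _ (\sum_l \sum_x `|W x| * `|W (x * l)|)).
  apply: ler_sum => l _; apply: le_trans (ler_norm_sum _ _ _) _.
  by apply: ler_sum => x _; rewrite normrM.
rewrite exchange_big expr2 -{1}sum_norm_signed_inverse big_distrl; apply: ler_sum => x _ /=.
rewrite -big_distrr /=; have [->|x0] := eqVneq x 0; first by rewrite signed_inverse0 normr0 !mul0r.
by rewrite ler_wpM2l // -sum_norm_signed_inverse [leRHS](reindex_inj (mulfI x0)).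
Qed.

End SignedInverse.

(** * Partial zeta sums, and Dedekind sums compared with correlations *)

Section CotangentAsymptotics.
Variables (R : realFieldType) (F : finFieldType) (p : nat) (co si : F -> R) (pi : R).
Hypotheses (p_pr : prime p) (p_gt3 : (3 < p)%N) (cardF : #|F| = p)
  (ac : additive_character co si).
Let p_gt2 : (2 < p)%N := ltnW p_gt3.
Let F2 : (2 : F) != 0 := F2_neq0 p_pr p_gt2 cardF.
Let P0 : (0 : R) < p%:R. Proof. by rewrite ltr0n prime_gt0. Qed.
Let Pn0 : (p%:R : R) != 0 := lt0r_neq0 P0.
Let P3 : (3 : R) <= p%:R. Proof. by rewrite ler_nat. Qed.
Local Notation ct := (cotangent co si).
Local Notation h := p./2.
Local Notation H k := (harmonic R k h).
Hypotheses (pi_ge3 : 3 <= pi) (pi_le4 : pi <= 4).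
Let pi0 : 0 < pi. Proof. by have := pi_ge3; lra. Qed.
Hypothesis ct_bound : forall i, (i < h)%N ->
  [/\ 0 <= ct i.+1%:R, ct i.+1%:R <= p%:R / (pi * i.+1%:R), p%:R / (pi * i.+1%:R) <= ct i.+1%:R + 1 &
     (p%:R / (pi * i.+1%:R)) ^+ 2 <= 1 + ct i.+1%:R ^+ 2].

Local Notation W := (@signed_inverse R F p).
Local Notation V := (@correlation R F p).
Let z (i : nat) : R := p%:R / (pi * i.+1%:R).

Lemma sum_z k : \sum_(i < h) z i ^+ k = (p%:R / pi) ^+ k * H k.
Proof.
rewrite big_distrr; apply: eq_bigr => i _ /=; rewrite /z -exprVn -exprMn.
by congr (_ ^+ _); field; rewrite (lt0r_neq0 pi0) nat1r pnatr_eq0.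
Qed.

Let z_ge0 i : 0 <= z i.
Proof. by rewrite divr_ge0 ?ltW // mulr_gt0. Qed.

Let csc_sum : \sum_(i < h) (1 + ct i.+1%:R ^+ 2) = (p%:R ^+ 2 - 1) / 6.
Proof.
have := sum_cosecant_sqr p_pr p_gt3 cardF ac.
rewrite (sumF_even p_pr p_gt3 cardF); [|by rewrite /cosecant_sqr eqxx|exact: cosecant_sqrN].
rewrite (eq_bigr (fun i : 'I_h => 1 + ct i.+1%:R ^+ 2)) => [E|i _]; first by lra.
by rewrite /cosecant_sqr (negPf (nonzero_nat p_pr p_gt3 cardF (ltn_ord i))).
Qed.

Let ct2_sum : \sum_(i < h) ct i.+1%:R ^+ 2 = (p%:R - 1) * (p%:R - 2) / 6.
Proof.
have := sum_cotangent_sqr p_pr cardF ac.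
rewrite (sumF_even p_pr p_gt3 cardF (g := fun l => ct l ^+ 2)) => [E||x]; first by lra.
  by rewrite (cotangent0 ac) expr0n.
by rewrite (cotangentN ac) sqrrN.
Qed.

Let csc4_sum : \sum_(i < h) (1 + ct i.+1%:R ^+ 2) ^+ 2 = (p%:R ^+ 2 - 1) * (p%:R ^+ 2 + 11) / 90.
Proof.
have := sum_cosecant_4 p_pr p_gt3 cardF ac.
rewrite (sumF_even p_pr p_gt3 cardF (g := fun l => cosecant_sqr co si l ^+ 2)) => [||x]; first last.
- by rewrite (cosecant_sqrN ac).
- by rewrite /cosecant_sqr eqxx expr0n.
rewrite (eq_bigr (fun i : 'I_h => (1 + ct i.+1%:R ^+ 2) ^+ 2)) => [E|i _]; first by lra.
by rewrite /cosecant_sqr (negPf (nonzero_nat p_pr p_gt3 cardF (ltn_ord i))).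
Qed.

(** Cauchy's proof of the Basel formula: [z i ^+ 2] lies between [cot^2] and [1 + cot^2], and both
    sums are known exactly. *)
Lemma harmonic2_bounds : pi ^+ 2 / 6 * (1 - 3 / p%:R) <= H 2 <= pi ^+ 2 / 6.
Proof.
have K0 : 0 < (p%:R / pi) ^+ 2 by rewrite exprn_gt0 ?divr_gt0.
rewrite -(ler_pM2l K0) -[H 2 <= _](ler_pM2l K0) -sum_z.
apply/andP; split.
  apply: (@le_trans _ _ (\sum_(i < h) ct i.+1%:R ^+ 2)).
    rewrite ct2_sum; have -> : (p%:R / pi) ^+ 2 * (pi ^+ 2 / 6 * (1 - 3 / p%:R)) = (p%:R ^+ 2 - 3 * p%:R) / 6.
      by field; rewrite (lt0r_neq0 pi0) Pn0.
    by lra.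
  apply: ler_sum => i _; have [c0 c1 _ _] := ct_bound (ltn_ord i).
  by rewrite lerXn2r ?nnegrE ?z_ge0.
apply: (@le_trans _ _ (\sum_(i < h) (1 + ct i.+1%:R ^+ 2))).
  by apply: ler_sum => i _; have [_ _ _ c1] := ct_bound (ltn_ord i).
rewrite csc_sum; have -> : (p%:R / pi) ^+ 2 * (pi ^+ 2 / 6) = p%:R ^+ 2 / 6.
  by field; rewrite (lt0r_neq0 pi0).
by lra.
Qed.

(** The same squeeze with fourth powers, using [cot^4 = csc^4 - 2 csc^2 + 1] for the lower side. *)
Lemma harmonic4_bounds : `|H 4 - pi ^+ 4 / 90| <= pi ^+ 4 / p%:R ^+ 2.
Proof.
have K0 : 0 < (p%:R / pi) ^+ 4 by rewrite exprn_gt0 ?divr_gt0.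
rewrite -(ler_pM2l K0) -[X in X * `|_|](ger0_norm (ltW K0)) -normrM mulrBr -sum_z.
have -> : (p%:R / pi) ^+ 4 * (pi ^+ 4 / 90) = p%:R ^+ 4 / 90 by field; rewrite (lt0r_neq0 pi0).
have -> : (p%:R / pi) ^+ 4 * (pi ^+ 4 / p%:R ^+ 2) = p%:R ^+ 2 by field; rewrite (lt0r_neq0 pi0) Pn0.
have sq4 (x : R) : x ^+ 4 = (x ^+ 2) ^+ 2 by ring.
have up : \sum_(i < h) z i ^+ 4 <= (p%:R ^+ 2 - 1) * (p%:R ^+ 2 + 11) / 90.
  rewrite -csc4_sum; apply: ler_sum => i _; have [_ _ _ c1] := ct_bound (ltn_ord i).
  by rewrite sq4 lerXn2r ?nnegrE ?sqr_ge0 // addr_ge0 ?sqr_ge0.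
have lo : (p%:R ^+ 2 - 1) * (p%:R ^+ 2 + 11) / 90 - (p%:R ^+ 2 - 1) / 3 + h%:R <= \sum_(i < h) z i ^+ 4.
  apply: (@le_trans _ _ (\sum_(i < h) ct i.+1%:R ^+ 4)); last first.
    apply: ler_sum => i _; have [c0 c1 _ _] := ct_bound (ltn_ord i).
    by rewrite lerXn2r ?nnegrE.
  rewrite (eq_bigr (fun i : 'I_h => (1 + ct i.+1%:R ^+ 2) ^+ 2 - 2 * (1 + ct i.+1%:R ^+ 2) + 1)); last by move=> i _; ring.
  rewrite big_split sumrB /= -big_distrr /= csc4_sum csc_sum sumr_const card_ord; lra.
have h0 : (0 : R) <= h%:R by [].
have p9 : 9 <= p%:R ^+ 2 :> R by have := P3; nra.
rewrite ler_norml; apply/andP; split; lra.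
Qed.

Lemma cotangent_signed_inverse x : `|ct x - p%:R / pi * W x| <= 1.
Proof.
apply: (residue_cases p_pr p_gt3 cardF (Q := fun x => `|ct x - p%:R / pi * W x| <= 1)) x => [|i ih|i ih].
- by rewrite (cotangent0 ac) (signed_inverse0 R p_pr cardF) mulr0 subrr normr0.
- rewrite (signed_inverse_nat R p_pr p_gt3 cardF) //; have [_ c1 c2 _] := ct_bound ih.
  have -> : p%:R / pi * i.+1%:R^-1 = p%:R / (pi * i.+1%:R) by rewrite invfM mulrA.
  move: (p%:R / _) (ct _) c1 c2 => u v c1 c2.
  by rewrite ler_norml; apply/andP; split; lra.
rewrite (signed_inverse_natN R p_pr p_gt3 cardF) // (cotangentN ac); have [_ c1 c2 _] := ct_bound ih.
have -> : p%:R / pi * - i.+1%:R^-1 = - (p%:R / (pi * i.+1%:R)) by rewrite invfM mulrA mulrN.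
move: (p%:R / _) (ct _) c1 c2 => u v c1 c2.
by rewrite ler_norml; apply/andP; split; lra.
Qed.

Lemma div_pi_le : p%:R / pi <= p%:R.
Proof. by rewrite ler_pdivrMr // ler_peMr //; have := pi_ge3; lra. Qed.

(** Write the cotangent as [p / pi * W + rho] with [rho] bounded by 1. Each of the two cross terms
    costs at most [2 p L], and the product of the two [rho] at most [p]. *)
Lemma dedekind_correlation (L : R) l : 1 <= L -> H 1 <= L ->
  `|4 * p%:R * dedekind_sum R p l - (p%:R / pi) ^+ 2 * V l| <= 5 * p%:R * L.
Proof.
move=> L1 HL; rewrite (dedekind_cotangent p_pr cardF ac).
pose rho x := ct x - p%:R / pi * W x.
have rhoB x : `|rho x| <= 1 by exact: cotangent_signed_inverse.
have ctE x : ct x = p%:R / pi * W x + rho x by rewrite /rho addrC subrK.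
have K1 : 0 <= p%:R / pi by rewrite divr_ge0 // ltW.
have K2 : p%:R / pi <= p%:R by exact: div_pi_le.
have [->|l0] := eqVneq l 0.
  rewrite big1 => [|x _]; last by rewrite mulr0 (cotangent0 ac) mulr0.
  rewrite /correlation big1 => [|x _]; last by rewrite mulr0 (signed_inverse0 R p_pr cardF) mulr0.
  by rewrite mulr0 subrr normr0 !mulr_ge0 //; lra.
have -> : \sum_x ct x * ct (x * l) - (p%:R / pi) ^+ 2 * V l =
   \sum_x (p%:R / pi * (W x * rho (x * l)) + p%:R / pi * (rho x * W (x * l)) + rho x * rho (x * l)).
  by rewrite /correlation big_distrr -sumrB; apply: eq_bigr => x _; rewrite /= !ctE; ring.
apply: le_trans (ler_norm_sum _ _ _) _.
apply: (@le_trans _ _ (\sum_x (p%:R / pi * `|W x| + p%:R / pi * `|W (x * l)| + 1))).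
  apply: ler_sum => x _; apply: le_trans (ler_normD _ _) _; apply: lerD; last first.
    by rewrite normrM -[leRHS]mul1r; apply: ler_pM.
  apply: le_trans (ler_normD _ _) _; rewrite !(normrM (p%:R / pi)) (ger0_norm K1) !normrM.
  apply: lerD; apply: ler_wpM2l => //; first by rewrite -[leRHS]mulr1; apply: ler_wpM2l.
  by rewrite -[leRHS]mul1r; apply: ler_wpM2r.
rewrite !big_split /= -!big_distrr /= (sum_F1 cardF) mulr1.
have -> : \sum_x `|W (x * l)| = \sum_x `|W x| by rewrite [RHS](reindex_inj (mulIf l0)).
rewrite (sum_norm_signed_inverse R p_pr p_gt3 cardF).
have H0 : 0 <= H 1 by apply: sumr_ge0 => i _; rewrite invr_ge0 exprn_ge0.
have h1 : p%:R / pi * (2 * H 1) <= p%:R * (2 * L).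
  by apply: ler_pM => //; lra.
have h2 : p%:R * 1 <= p%:R * L by apply: ler_wpM2l => //; lra.
lra.
Qed.

(** The error [D - k V] is uniformly [O(p L)], so in [D^2 - (k V)^2 = 2 k V (D - k V) + (D - k V)^2]
    only the sum of [|V|] is needed, and that is at most [4 L^2]. *)
Lemma dedekind_second_moment_correlation (L : R) : 1 <= L -> H 1 <= L ->
  `|16 * p%:R ^+ 2 * (\sum_l dedekind_sum R p (l : F) ^+ 2) - (p%:R / pi) ^+ 4 * \sum_l V l ^+ 2|
    <= 100 * p%:R ^+ 3 * L ^+ 3.
Proof.
move=> L1 HL; pose k := (p%:R / pi) ^+ 2.
have k0 : 0 <= k by exact: sqr_ge0.
have kp : k <= p%:R ^+ 2.
  by rewrite /k lerXn2r ?nnegrE ?div_pi_le // divr_ge0 // ltW.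
pose D l := 4 * p%:R * dedekind_sum R p (l : F).
have DB l : `|D l - k * V l| <= 5 * p%:R * L by exact: dedekind_correlation.
have L0 : 0 <= L by lra.
have pL : 0 <= 5 * p%:R * L by rewrite !mulr_ge0.
have -> : 16 * p%:R ^+ 2 * (\sum_l dedekind_sum R p (l : F) ^+ 2) - (p%:R / pi) ^+ 4 * \sum_l V l ^+ 2 =
  \sum_l (D l ^+ 2 - (k * V l) ^+ 2).
  rewrite sumrB; congr (_ - _); rewrite big_distrr; apply: eq_bigr => l _ /=; rewrite /D /k; ring.
apply: le_trans (ler_norm_sum _ _ _) _.
apply: (@le_trans _ _ (\sum_l (5 * p%:R * L * (2 * k) * `|V l| + (5 * p%:R * L) ^+ 2))).
  apply: ler_sum => l _; have -> : D l ^+ 2 - (k * V l) ^+ 2 =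
    2 * k * V l * (D l - k * V l) + (D l - k * V l) ^+ 2 by ring.
  apply: le_trans (ler_normD _ _) _; apply: lerD.
    have k2 : 0 <= 2 * k by rewrite mulr_ge0.
    rewrite (normrM (2 * k * V l)) (normrM (2 * k)) (ger0_norm k2) [leLHS]mulrC.
    have -> : 5 * p%:R * L * (2 * k) * `|V l| = 5 * p%:R * L * (2 * k * `|V l|) by ring.
    by apply: ler_wpM2r; [rewrite mulr_ge0 | exact: DB].
  by rewrite normrX lerXn2r ?nnegrE.
rewrite big_split /= -big_distrr /= (sum_F1 cardF).
have VB := sum_norm_correlation R p_pr p_gt3 cardF.
have H0 : 0 <= H 1 by apply: sumr_ge0 => i _; rewrite invr_ge0 exprn_ge0.
have h1 : k * \sum_l `|V l| <= p%:R ^+ 2 * (4 * L ^+ 2).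
  apply: ler_pM => //; first exact: sumr_ge0.
  apply: le_trans VB _; rewrite exprMn; have -> : (2 : R) ^+ 2 = 4 by ring.
  by rewrite ler_pM2l // lerXn2r ?nnegrE.
have h2 : p%:R * L * (k * \sum_l `|V l|) <= p%:R * L * (p%:R ^+ 2 * (4 * L ^+ 2)).
  by apply: ler_wpM2l; rewrite ?mulr_ge0.
have h3 : p%:R ^+ 3 * L ^+ 2 * 1 <= p%:R ^+ 3 * L ^+ 2 * L.
  by apply: ler_wpM2l; rewrite ?mulr_ge0 ?exprn_ge0.
have h4 : 0 <= p%:R ^+ 3 * L ^+ 3 by rewrite mulr_ge0 ?exprn_ge0.
move: h2 h3 h4; set S := \sum_l `|V l|; set P : R := p%:R.
have -> : P * L * (k * S) = P * L * k * S by ring.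
move=> h2 h3 h4; lra.
Qed.
End CotangentAsymptotics.

(** * Multiplicative energy and the off-diagonal terms *)

Section Correlations.
Variables (R : realFieldType) (F : finFieldType) (p : nat).
Hypotheses (p_pr : prime p) (p_gt3 : (3 < p)%N) (cardF : #|F| = p).
Let p_gt2 : (2 < p)%N := ltnW p_gt3.
Let P0 : (0 : R) < p%:R. Proof. by rewrite ltr0n prime_gt0. Qed.
Local Notation h := p./2.
Local Notation W := (@signed_inverse R F p).
Local Notation V := (@correlation R F p).
Local Notation inv i := (i.+1%:R^-1 : R).
Let ph := p_half p_pr p_gt2.

Lemma sum_pick (x : F) (g : F -> R) : \sum_y (x == y)%:R * g y = g x.
Proof. by rewrite -[RHS](sum_delta x g); apply: eq_bigr => y _; rewrite eq_sym. Qed.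

Lemma signed_inverse_expand y :
  W y = \sum_(j < h) inv j * ((y == j.+1%:R)%:R - (y == - j.+1%:R)%:R).
Proof.
rewrite -[LHS](sum_pick y) (sumF_half p_pr p_gt3 cardF) (signed_inverse0 R p_pr cardF) mulr0 add0r.
apply: eq_bigr => j _; rewrite (signed_inverse_nat R p_pr p_gt3 cardF) // (signed_inverse_natN R p_pr p_gt3 cardF) //.
ring.
Qed.

Lemma correlation_expand l : V l = 2 * \sum_(i < h) \sum_(j < h)
  inv i * inv j * ((i.+1%:R * l == j.+1%:R)%:R - (i.+1%:R * l == - j.+1%:R)%:R).
Proof.
rewrite /V (sumF_even p_pr p_gt3 cardF (g := fun x => W x * W (x * l))); first last.
- by move=> x; rewrite mulNr !(signed_inverseN R p_pr p_gt3 cardF) mulrNN.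
- by rewrite (signed_inverse0 R p_pr cardF) mul0r.
congr (_ * _); apply: eq_bigr => i _; rewrite (signed_inverse_nat R p_pr p_gt3 cardF) //.
rewrite signed_inverse_expand big_distrr; apply: eq_bigr => j _ /=; ring.
Qed.

Lemma sum_correlation_pair (a b c d : F) : a != 0 -> c != 0 ->
  \sum_l ((a * l == b)%:R - (a * l == - b)%:R) * ((c * l == d)%:R - (c * l == - d)%:R) =
  2 * ((b * c == d * a)%:R - (b * c == - (d * a))%:R) :> R.
Proof.
move=> a0 c0.
have E (u v l : F) : u != 0 -> (u * l == v) = (l == v / u) :> bool.
  by move=> u0; rewrite -[RHS](inj_eq (mulfI u0)) [u * (v / u)]mulrC mulfVK.
rewrite (eq_bigr (fun l => (l == b / a)%:R * ((c * l == d)%:R - (c * l == - d)%:R)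
   - (l == - b / a)%:R * ((c * l == d)%:R - (c * l == - d)%:R))); last first.
  by move=> l _; rewrite !(E a) //; ring.
rewrite sumrB !sum_delta.
have K (s t : F) : (c * (s / a) == t) = (s * c == t * a).
  by rewrite -[LHS](inj_eq (mulIf a0)); congr (_ == _); field.
rewrite !K mulNr -!mulNr !mulNr !eqr_opp.
have -> : (- (b * c) == d * a) = (b * c == - (d * a)) by rewrite eqr_oppLR.
ring.
Qed.

Lemma sum_correlation_sqr : \sum_l V l ^+ 2 =
  8 * \sum_(i < h) \sum_(j < h) \sum_(k < h) \sum_(m < h) inv i * inv j * (inv k * inv m) *
    (((j.+1 * k.+1)%:R == (m.+1 * i.+1)%:R :> F)%:R - ((j.+1 * k.+1)%:R == - (m.+1 * i.+1)%:R :> F)%:R).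
Proof.
pose e (i j : 'I_h) (l : F) : R := (i.+1%:R * l == j.+1%:R)%:R - (i.+1%:R * l == - j.+1%:R)%:R.
transitivity (4 * \sum_(i < h) \sum_(j < h) \sum_(k < h) \sum_(m < h)
    inv i * inv j * (inv k * inv m) * \sum_l e i j l * e k m l).
  transitivity (4 * \sum_l \sum_(i < h) \sum_(j < h) \sum_(k < h) \sum_(m < h)
    inv i * inv j * (inv k * inv m) * (e i j l * e k m l)).
    rewrite [RHS]big_distrr; apply: eq_bigr => l _; rewrite correlation_expand /=.
    rewrite exprMn; congr (_ * _); first by ring.
    rewrite expr2 big_distrl; apply: eq_bigr => i _ /=; rewrite big_distrl; apply: eq_bigr => j _ /=.
    rewrite big_distrr; apply: eq_bigr => k _ /=; rewrite big_distrr; apply: eq_bigr => m _ /=.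
    rewrite /e; ring.
  congr (_ * _).
  rewrite exchange_big; apply: eq_bigr => i _ /=; rewrite exchange_big; apply: eq_bigr => j _ /=.
  rewrite exchange_big; apply: eq_bigr => k _ /=; rewrite exchange_big; apply: eq_bigr => m _ /=.
  by rewrite big_distrr.
have -> : (8 : R) = 4 * 2 by ring.
rewrite -mulrA; congr (_ * _); rewrite big_distrr; apply: eq_bigr => i _ /=.
rewrite big_distrr; apply: eq_bigr => j _ /=; rewrite big_distrr; apply: eq_bigr => k _ /=.
rewrite big_distrr; apply: eq_bigr => m _ /=.
rewrite sum_correlation_pair ?(nonzero_nat p_pr p_gt3 cardF) // -!natrM; ring.
Qed.

Definition mult_energy (n : nat) : R := \sum_(i < n) \sum_(j < n) \sum_(k < n) \sum_(m < n)
  inv i * inv j * (inv k * inv m) * (j.+1 * k.+1 == m.+1 * i.+1)%N%:R.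

Definition off_diagonal (n m : nat) := ((n != m) && (n == m %[mod p]) || (p %| n + m))%N.

Lemma off_diagonal_sym n m : off_diagonal n m = off_diagonal m n.
Proof. by rewrite /off_diagonal eq_sym [(n == m %[mod p])%N]eq_sym addnC. Qed.

(** [p] divides either the nonzero difference or the positive sum, so [n + m >= p]. The larger of
    the two products then has inverse at most [2 / p], which is the saving in the off-diagonal
    estimate. *)
Lemma off_diagonal_large n m : (0 < n)%N -> off_diagonal n m -> (p <= n.*2)%N || (p <= m.*2)%N.
Proof.
move=> n0; have H : (p <= n + m)%N -> (p <= n.*2)%N || (p <= m.*2)%N by lia.
case/orP => [/andP[nm E]|dv]; last by apply: H; apply: dvdn_leq dv; lia.
apply: H; have [lt|gt|eq] := ltngtP n m; last by rewrite eq eqxx in nm.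
  rewrite eq_sym eqn_mod_dvd ?(ltnW lt) // in E.
  by have := dvdn_leq _ E; rewrite subn_gt0 => /(_ lt); lia.
rewrite eqn_mod_dvd ?(ltnW gt) // in E.
by have := dvdn_leq _ E; rewrite subn_gt0 => /(_ gt); lia.
Qed.

Lemma diagonal_error n m :
  `|(n%:R == m%:R :> F)%:R - (n%:R == - m%:R :> F)%:R - (n == m)%:R| <= (off_diagonal n m)%:R :> R.
Proof.
have -> : (n%:R == - m%:R :> F) = (p %| n + m)%N.
  by rewrite -addr_eq0 -natrD -(dvdn_pcharf (pcharF p_pr cardF)).
have b0 : (false%:R : R) = 0 by [].
have b1 : (true%:R : R) = 1 by [].
rewrite (natF_eq p_pr cardF) /off_diagonal; have [->|nm] := eqVneq n m.
  rewrite eqxx /=; case: (p %| _)%N; rewrite ?b0 ?b1.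
    by rewrite subrr sub0r normrN normr1.
  by rewrite subr0 subrr normr0.
case: (n == m %[mod p])%N; case: (p %| _)%N; rewrite /= ?b0 ?b1 ?subrr ?subr0 ?sub0r ?normrN ?normr0 ?normr1 //.
Qed.

Lemma sum_blocks (f : nat -> R) n :
  \sum_(i < n * p) f i = \sum_(t < n) \sum_(r < p) f (t * p + r)%N.
Proof.
elim: n => [|n IH]; first by rewrite !big_ord0.
rewrite big_ord_recr /= -IH -(big_mkord xpredT f) (@big_cat_nat _ _ _ (n * p)) //=; last by rewrite mulSn leq_addl.
rewrite big_mkord; congr (_ + _).
by rewrite -{1}[(n * p)%N]add0n big_addn mulSn addnK big_mkord; apply: eq_bigr => i _; rewrite addnC.
Qed.

Variables (L D : R).
Hypotheses (HL : harmonic R 1 p <= L)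
  (HD : forall n, \sum_(i < h) \sum_(j < h) (i.+1 * j.+1 == n)%N%:R <= D).

Let H0 k n : 0 <= harmonic R k n.
Proof. by apply: sumr_ge0 => i _; rewrite invr_ge0 exprn_ge0. Qed.
Let L0 : 0 <= L. Proof. exact: le_trans (H0 1 p) HL. Qed.
Let D0 : 0 <= D.
Proof. by apply: le_trans (HD 0); apply: sumr_ge0 => i _; apply: sumr_ge0. Qed.

Lemma harmonic_half_le : harmonic R 1 h <= L.
Proof.
apply: le_trans HL; rewrite /harmonic -!(big_mkord xpredT (fun i => i.+1%:R ^- 1)).
rewrite [leRHS](@big_cat_nat _ _ _ h) //=; last by rewrite ph; lia.
by rewrite lerDl; apply: sumr_ge0 => i _; rewrite invr_ge0 exprn_ge0.
Qed.

(** Write [n = t p + r]. Only the residues of [m] and [-m] are possible for [r], and [2 n >= p]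
    gives [n >= p (t + 1) / 2] also for [t = 0]; the sum over [t] is harmonic. *)
Lemma sum_off_diagonal_residue m : \sum_(n < p * p)
  (off_diagonal n m && (p <= n.*2)%N)%:R / n%:R <= 4 * L / p%:R.
Proof.
rewrite (sum_blocks (fun n => (off_diagonal n m && (p <= n.*2)%N)%:R / n%:R)).
apply: (@le_trans _ _ (\sum_(t < p) 4 / p%:R * inv t)); last first.
  rewrite -big_distrr /= mulrAC; apply: ler_wpM2r; first by rewrite invr_ge0 ltW.
  by rewrite ler_pM2l //; apply: le_trans HL; apply: ler_sum => i _; rewrite expr1.
apply: ler_sum => t _.
have q0 : 0 <= 2 / p%:R * inv t by rewrite !mulr_ge0 ?invr_ge0 // ltW.
apply: (@le_trans _ _ (\sum_(r < p) ((r == m %% p :> nat)%N%:R + (r == (p - m %% p) %% p :> nat)%N%:R) * (2 / p%:R * inv t))).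
  apply: ler_sum => r _; case: (boolP (off_diagonal _ _ && _)) => [/andP[od big]|_]; last first.
    by rewrite mul0r mulr_ge0 // addr_ge0.
  apply: ler_pM => //; first by rewrite invr_ge0.
    have mp := ltn_pmod m (prime_gt0 p_pr).
    suff : (r == (m %% p)%N :> nat) || (r == ((p - m %% p) %% p)%N :> nat).
      by case/orP => ->; rewrite ?lerDl ?lerDr.
    case/orP: od => [/andP[_]|]; first by rewrite modnMDl modn_small // => ->.
    rewrite -addnA dvdn_addr ?dvdn_mull // /dvdn -modnDmr => /eqP E.
    apply/orP; right; have [m0|m0] := posnP (m %% p)%N.
      by move: E; rewrite m0 subn0 modnn addn0 modn_small // => ->.
    rewrite modn_small; last by lia.
    have : (p %| r + m %% p)%N by rewrite /dvdn E.
    have rp := ltn_ord r; case/dvdnP => c Ec.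
    have : c = 1%N by nia.
    by move=> c1; apply/eqP; nia.
  have -> : 2 / p%:R * inv t = (p%:R * t.+1%:R / 2)^-1.
    by rewrite !invfM invrK; ring.
  have n0 : (0 < t * p + r)%N by rewrite -double_gt0; exact: leq_trans (prime_gt0 p_pr) big.
  rewrite lef_pV2 ?posrE ?ltr0n // ?divr_gt0 ?mulr_gt0 //.
  rewrite ler_pdivrMr // -!natrM ler_nat.
  by move: big; case: (nat_of_ord t) => [|k]; lia || nia.
rewrite -big_distrl /= big_split /=.
have one c : (\sum_(r < p) (r == c :> nat)%N%:R : R) <= 1.
  have [cp|cp] := ltnP c p; last first.
    by rewrite big1 // => r _; rewrite (negPf (_ : _ != _)) // neq_ltn (leq_trans (ltn_ord r)).
  rewrite (bigD1 (Ordinal cp)) //= eqxx big1 ?addr0 // => r rc.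
  by case: eqP => // E; case/eqP: rc; apply: val_inj.
have -> : 4 / p%:R * inv t = 2 * (2 / p%:R * inv t) by ring.
by apply: ler_wpM2r => //; apply: le_trans (lerD (one _) (one _)) _; rewrite -mulr2n.
Qed.

Lemma sum_product_le (g : nat -> R) : (forall n, 0 <= g n) ->
  \sum_(j < h) \sum_(k < h) g (j.+1 * k.+1)%N <= D * \sum_(n < p * p) g n.
Proof.
move=> g0; rewrite big_distrr /=.
apply: (@le_trans _ _ (\sum_(n < p * p) (\sum_(i < h) \sum_(j < h) (i.+1 * j.+1 == n)%N%:R) * g n)); last first.
  by apply: ler_sum => n _; apply: ler_wpM2r.
under [leRHS]eq_bigr => n _ do rewrite big_distrl /=.
rewrite [leRHS]exchange_big; apply: ler_sum => j _.
under [leRHS]eq_bigr => n _ do rewrite big_distrl /=.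
rewrite [leRHS]exchange_big; apply: ler_sum => k _.
have lt : (j.+1 * k.+1 < p * p)%N by have := ltn_ord j; have := ltn_ord k; have := ph; nia.
by rewrite (bigD1 (Ordinal lt)) //= eqxx mul1r lerDl; apply: sumr_ge0 => n _; rewrite mulr_ge0.
Qed.

(** One of the two products is at least [p/2], and exchanging their roles reduces to [j k] being the
    large one. For fixed [i], [m] the pairs [(j, k)] are grouped by their product [n], each [n]
    arising at most [D] times. *)
Lemma off_diagonal_sum :
  \sum_(i < h) \sum_(j < h) \sum_(k < h) \sum_(m < h) inv i * inv j * (inv k * inv m) *
    (off_diagonal (j.+1 * k.+1) (m.+1 * i.+1))%:R <= 8 * L ^+ 3 * D / p%:R.
Proof.
pose f (i j k m : 'I_h) : R := inv i * inv j * (inv k * inv m) *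
  (off_diagonal (j.+1 * k.+1) (m.+1 * i.+1) && (p <= (j.+1 * k.+1).*2)%N)%:R.
have f0 i j k m : 0 <= inv i * inv j * (inv k * inv m) by rewrite !mulr_ge0 ?invr_ge0.
apply: (@le_trans _ _ (\sum_(i < h) \sum_(j < h) \sum_(k < h) \sum_(m < h) (f i j k m + f j i m k))).
  apply: ler_sum => i _; apply: ler_sum => j _; apply: ler_sum => k _; apply: ler_sum => m _.
  rewrite /f; have -> : inv j * inv i * (inv m * inv k) = inv i * inv j * (inv k * inv m) by ring.
  rewrite -mulrDr; apply: ler_wpM2l => //.
  rewrite [(i.+1 * m.+1)%N]mulnC [(k.+1 * j.+1)%N]mulnC [off_diagonal (m.+1 * i.+1) _]off_diagonal_sym.
  case: (boolP (off_diagonal _ _)) => [od|_] /=; last by rewrite addr0.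
  by have := off_diagonal_large _ od; rewrite muln_gt0 => /(_ isT) /orP [] ->; rewrite ?lerDl ?lerDr.
have fB : \sum_(i < h) \sum_(j < h) \sum_(k < h) \sum_(m < h) f i j k m <= L ^+ 2 * (D * (4 * L / p%:R)).
  have -> : \sum_(i < h) \sum_(j < h) \sum_(k < h) \sum_(m < h) f i j k m =
    \sum_(i < h) \sum_(m < h) inv i * inv m * (\sum_(j < h) \sum_(k < h)
      (off_diagonal (j.+1 * k.+1) (m.+1 * i.+1) && (p <= (j.+1 * k.+1).*2)%N)%:R / (j.+1 * k.+1)%:R).
    apply: eq_bigr => i _; rewrite [RHS](eq_bigr (fun m : 'I_h => \sum_(j < h) \sum_(k < h) f i j k m)).
      rewrite [RHS]exchange_big; apply: eq_bigr => j _ /=; exact: exchange_big.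
    move=> m _; rewrite big_distrr; apply: eq_bigr => j _ /=; rewrite big_distrr; apply: eq_bigr => k _ /=.
    by rewrite /f natrM invfM; ring.
  apply: (@le_trans _ _ (\sum_(i < h) \sum_(m < h) inv i * inv m * (D * (4 * L / p%:R)))).
    apply: ler_sum => i _; apply: ler_sum => m _; apply: ler_wpM2l; first by rewrite mulr_ge0 ?invr_ge0.
    have := @sum_product_le (fun n => (off_diagonal n (m.+1 * i.+1) && (p <= n.*2)%N)%:R / n%:R).
    move=> /(_ (fun n => divr_ge0 (ler0n _ _) (ler0n _ _))) /le_trans; apply.
    by apply: ler_wpM2l => //; exact: sum_off_diagonal_residue.
  have -> : \sum_(i < h) \sum_(m < h) inv i * inv m * (D * (4 * L / p%:R)) =
     harmonic R 1 h ^+ 2 * (D * (4 * L / p%:R)).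
    rewrite expr2 /harmonic !big_distrl; apply: eq_bigr => i _ /=; rewrite big_distrr big_distrl.
    by apply: eq_bigr => m _ /=; rewrite !expr1.
  apply: ler_wpM2r; first by rewrite !mulr_ge0 ?invr_ge0 // ltW.
  by rewrite lerXn2r ?nnegrE // harmonic_half_le.
have sw : \sum_(i < h) \sum_(j < h) \sum_(k < h) \sum_(m < h) f j i m k =
          \sum_(i < h) \sum_(j < h) \sum_(k < h) \sum_(m < h) f i j k m.
  rewrite exchange_big; apply: eq_bigr => i _; apply: eq_bigr => j _; exact: exchange_big.
under eq_bigr => i _ do under eq_bigr => j _ do under eq_bigr => k _ do rewrite big_split /=.
under eq_bigr => i _ do under eq_bigr => j _ do rewrite big_split /=.
under eq_bigr => i _ do rewrite big_split /=.
rewrite big_split /= sw.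
have -> : 8 * L ^+ 3 * D / p%:R = L ^+ 2 * (D * (4 * L / p%:R)) + L ^+ 2 * (D * (4 * L / p%:R)) by ring.
exact: lerD.
Qed.

Lemma sum_correlation_sqr_energy :
  `|\sum_l V l ^+ 2 - 8 * mult_energy h| <= 64 * L ^+ 3 * D / p%:R.
Proof.
rewrite sum_correlation_sqr -mulrBr normrM ger0_norm //.
have -> : 64 * L ^+ 3 * D / p%:R = 8 * (8 * L ^+ 3 * D / p%:R) by ring.
rewrite ler_pM2l //; apply: le_trans off_diagonal_sum.
rewrite /mult_energy -sumrB; apply: le_trans (ler_norm_sum _ _ _) _; apply: ler_sum => i _.
rewrite -sumrB; apply: le_trans (ler_norm_sum _ _ _) _; apply: ler_sum => j _.
rewrite -sumrB; apply: le_trans (ler_norm_sum _ _ _) _; apply: ler_sum => k _.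
rewrite -sumrB; apply: le_trans (ler_norm_sum _ _ _) _; apply: ler_sum => m _.
rewrite -mulrBr normrM ger0_norm ?mulr_ge0 ?invr_ge0 //.
by apply: ler_wpM2l; rewrite ?mulr_ge0 ?invr_ge0 // diagonal_error.
Qed.
End Correlations.

(** * The energy compared with products of partial zeta sums *)

Section MultiplicativeEnergy.
Variable R : realFieldType.
Local Notation H := (harmonic R).

Lemma ler_sum_inj (I J : finType) (P : pred I) (Q : pred J) (f : I -> R) (g : J -> R) (φ : I -> J) :
  (forall j, 0 <= g j) -> {in P &, injective φ} -> (forall i, P i -> Q (φ i) /\ f i <= g (φ i)) ->
  \sum_(i | P i) f i <= \sum_(j | Q j) g j.
Proof.
move=> g0 inj fgQ; have fg i Pi := (fgQ i Pi).2; apply: (@le_trans _ _ (\sum_(i | P i) g (φ i))); first exact: ler_sum.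
rewrite -(big_imset g (h := φ) (A := P)) /=; last by move=> i j; exact: inj.
rewrite [leRHS](bigID (fun j => j \in φ @: P)) /= [X in _ <= X + _](eq_bigl (fun j => j \in φ @: P)) => [|j].
  by rewrite lerDl; apply: sumr_ge0.
by rewrite andbC; case: imsetP => //= -[i Pi ->]; exact: (fgQ i Pi).1.
Qed.

Lemma sum_prod4 (I J K L : finType) (u : I -> R) (v : J -> R) (w : K -> R) (s : L -> R) :
  \sum_(z : I * J * (K * L)) u z.1.1 * v z.1.2 * (w z.2.1 * s z.2.2) =
  (\sum_i u i) * (\sum_i v i) * ((\sum_i w i) * (\sum_i s i)).
Proof.
rewrite -(pair_bigA _ (fun a b => u a.1 * v a.2 * (w b.1 * s b.2))) /=.
rewrite -(pair_bigA _ (fun i j => \sum_b u i * v j * (w b.1 * s b.2))) /=.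
rewrite -mulrA big_distrl; apply: eq_bigr => i _ /=.
rewrite [X in _ = _ * X]big_distrl big_distrr; apply: eq_bigr => j _ /=.
rewrite -(pair_bigA _ (fun k l => u i * v j * (w k * s l))) /= mulrA big_distrl big_distrr.
apply: eq_bigr => k _ /=; rewrite !big_distrr; apply: eq_bigr => l _ /=; ring.
Qed.

Lemma sum_shift n (f : nat -> R) : f 0%N = 0 -> \sum_(i < n) f i.+1 = \sum_(i < n.+1) f i.
Proof. by move=> f0; rewrite big_ord_recl f0 add0r. Qed.

Lemma harmonic_shift k n : H k.+1 n = \sum_(i < n.+1) (i : nat)%:R ^- k.+1.
Proof. by rewrite -(sum_shift n (f := fun i => i%:R ^- k.+1)) // expr0n invr0. Qed.

Lemma harmonic_ge0 k n : 0 <= H k n.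
Proof. by apply: sumr_ge0 => i _; rewrite invr_ge0 exprn_ge0. Qed.

(** Indices now start at 0, so that an index is the integer itself; the added terms vanish because
    the inverse of 0 is 0. *)
Lemma mult_energy_shift n : mult_energy R n =
  \sum_(a < n.+1) \sum_(b < n.+1) \sum_(c < n.+1) \sum_(d < n.+1)
    (a%:R^-1 * b%:R^-1 * (c%:R^-1 * d%:R^-1)) * (b * c == d * a :> nat)%N%:R.
Proof.
rewrite /mult_energy.
rewrite -(sum_shift n (f := fun a => \sum_(b < n.+1) \sum_(c < n.+1) \sum_(d < n.+1)
    (a%:R^-1 * b%:R^-1 * (c%:R^-1 * d%:R^-1)) * (b * c == d * a :> nat)%N%:R)); last first.
  by do 3 (apply: big1 => ? _); rewrite invr0 !mul0r.
apply: eq_bigr => a _.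
rewrite -(sum_shift n (f := fun b => \sum_(c < n.+1) \sum_(d < n.+1)
    (a.+1%:R^-1 * b%:R^-1 * (c%:R^-1 * d%:R^-1)) * (b * c == d * a.+1 :> nat)%N%:R)); last first.
  by do 2 (apply: big1 => ? _); rewrite invr0 mulr0 !mul0r.
apply: eq_bigr => b _.
rewrite -(sum_shift n (f := fun c => \sum_(d < n.+1)
    (a.+1%:R^-1 * b.+1%:R^-1 * (c%:R^-1 * d%:R^-1)) * (b.+1 * c == d * a.+1 :> nat)%N%:R)); last first.
  by apply: big1 => ? _; rewrite invr0 mul0r mulr0 !mul0r.
apply: eq_bigr => c _.
rewrite -(sum_shift n (f := fun d =>
    (a.+1%:R^-1 * b.+1%:R^-1 * (c.+1%:R^-1 * d%:R^-1)) * (b.+1 * c.+1 == d * a.+1 :> nat)%N%:R)) //.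
by rewrite /= invr0 ?mulr0 ?mul0r // !mulr0 ?mul0r. 
Qed.

(* Parametrization of [b c = d a]: [a = g x], [b = g y], [c = t x], [d = t y] with [x], [y] coprime. *)
Lemma proportion_param a b c d : (0 < a)%N -> (0 < b)%N -> (b * c = d * a)%N ->
  let g := gcdn a b in let t := (c %/ (a %/ g))%N in
  [/\ (0 < g)%N, (a = g * (a %/ g))%N, (b = g * (b %/ g))%N, (c = t * (a %/ g))%N &
      (d = t * (b %/ g))%N /\ coprime (a %/ g) (b %/ g)].
Proof.
move=> a0 b0 E g t; have g0 : (0 < g)%N by rewrite gcdn_gt0 a0.
have aE : (a = g * (a %/ g))%N by rewrite mulnC divnK // dvdn_gcdl.
have bE : (b = g * (b %/ g))%N by rewrite mulnC divnK // dvdn_gcdr.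
have cop : coprime (a %/ g) (b %/ g).
  rewrite /coprime -(eqn_pmul2l g0) muln_gcdr -aE -bE muln1 //.
have E' : ((b %/ g) * c = d * (a %/ g))%N.
  by apply/eqP; rewrite -(eqn_pmul2l g0) mulnA -bE E [X in (_ == X)%N]mulnCA -aE.
have xc : (a %/ g %| c)%N by rewrite -(Gauss_dvdr _ cop) E' dvdn_mull.
have cE : (c = t * (a %/ g))%N by rewrite /t divnK.
have x0 : (0 < a %/ g)%N by move: a0; rewrite {1}aE muln_gt0 => /andP[].
split=> //; split=> //; apply/eqP; rewrite -(eqn_pmul2r x0) -E' {1}cE mulnCA mulnA //; apply/eqP; ring.
Qed.

Lemma coprime_scale_gcd m x y : coprime x y -> gcdn (m * x) (m * y) = m.
Proof. by move=> /eqP c; rewrite -muln_gcdr c muln1. Qed.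

(** Tuples [(m, ((a, b), (c, d)))]. Multiplying the energy by the partial sum of [1/m^4] adds the
    parameter [m], which turns a coprime pair [(x, y)] into an arbitrary pair [(m x, m y)]. *)
Definition scaled_proportion n := ('I_n.+1 * (('I_n.+1 * 'I_n.+1) * ('I_n.+1 * 'I_n.+1)))%type.
Definition scaled_weight n (z : scaled_proportion n) : R := (z.1 : nat)%:R ^- 4 *
   ((z.2.1.1 : nat)%:R^-1 * (z.2.1.2 : nat)%:R^-1 * ((z.2.2.1 : nat)%:R^-1 * (z.2.2.2 : nat)%:R^-1)).
Definition is_scaled_proportion n (z : scaled_proportion n) :=
  [&& (0 < z.1)%N, (0 < z.2.1.1)%N, (0 < z.2.1.2)%N, (0 < z.2.2.1)%N, (0 < z.2.2.2)%N
   & (z.2.1.2 * z.2.2.1 == z.2.2.2 * z.2.1.1)%N].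

Lemma harmonic4_energyE n : H 4 n * mult_energy R n = \sum_(z : scaled_proportion n | is_scaled_proportion z) scaled_weight z.
Proof.
pose P := @is_scaled_proportion n; pose f := @scaled_weight n.
rewrite big_mkcond -(pair_bigA _ (fun m u => if P (m, u) then f (m, u) else 0)) /=.
rewrite harmonic_shift big_distrl; apply: eq_bigr => m _ /=.
rewrite mult_energy_shift -(pair_bigA _ (fun u v => if P (m, (u, v)) then f (m, (u, v)) else 0)) /=.
rewrite -(pair_bigA _ (fun a b => \sum_v if P (m, ((a, b), v)) then f (m, ((a, b), v)) else 0)) /=.
rewrite big_distrr; apply: eq_bigr => a _ /=; rewrite big_distrr; apply: eq_bigr => b _ /=.
rewrite -(pair_bigA _ (fun c d => if P (m, ((a, b), (c, d))) then f (m, ((a, b), (c, d))) else 0)) /=.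
rewrite big_distrr; apply: eq_bigr => c _ /=; rewrite big_distrr; apply: eq_bigr => d _ /=.
rewrite /P /f /is_scaled_proportion /scaled_weight /=.
have [->|m0] := posnP m; first by rewrite expr0n invr0 mul0r.
have [->|a0] := posnP a; first by rewrite invr0 !mul0r mulr0.
have [->|b0] := posnP b; first by rewrite invr0 mulr0 !mul0r mulr0.
have [->|c0] := posnP c; first by rewrite invr0 mul0r mulr0 !mul0r mulr0.
have [->|d0] := posnP d; first by rewrite invr0 !mulr0 !mul0r mulr0.
by case: (_ == _) => /=; rewrite ?mulr1 ?mulr0.
Qed.

(** With [a = g x], [b = g y], [c = t x], [d = t y], send the tuple to [(g, t, m x, m y)]. The
    weight becomes the product of the four inverse squares, and the map is injective since [m] is
    the gcd of the last two entries. These can reach [n * n], so [B] has to bound the partial sums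
    of every length. *)
Lemma mult_energy_upper B n : (forall k, H 2 k <= B) -> H 4 n * mult_energy R n <= B ^+ 4.
Proof.
move=> HB.
pose w4 (z : 'I_n.+1 * 'I_n.+1 * ('I_(n * n).+1 * 'I_(n * n).+1)) : R :=
  z.1.1%:R ^- 2 * z.1.2%:R ^- 2 * (z.2.1%:R ^- 2 * z.2.2%:R ^- 2).
have w4E : \sum_z w4 z = H 2 n ^+ 2 * H 2 (n * n) ^+ 2.
  pose u (k : nat) (i : 'I_k.+1) : R := (i : nat)%:R ^- 2.
  rewrite (sum_prod4 (u n) (u n) (u (n * n)%N) (u (n * n)%N)) /u -!harmonic_shift; ring.
have H0 := harmonic_ge0.
have B0 : 0 <= B := le_trans (H0 2 n) (HB n).
apply: (@le_trans _ _ (\sum_z w4 z)); last first.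
  have -> : B ^+ 4 = B ^+ 2 * B ^+ 2 by ring.
  by rewrite w4E; apply: ler_pM; rewrite ?exprn_ge0 // lerXn2r ?nnegrE.
rewrite harmonic4_energyE; pose T := scaled_proportion n; pose P := @is_scaled_proportion n; pose f := @scaled_weight n.
pose gg (z : T) := gcdn z.2.1.1 z.2.1.2.
pose φ (z : T) : 'I_n.+1 * 'I_n.+1 * ('I_(n * n).+1 * 'I_(n * n).+1) :=
  ((inord (gg z), inord (z.2.2.1 %/ (z.2.1.1 %/ gg z))),
   (inord (z.1 * (z.2.1.1 %/ gg z)), inord (z.1 * (z.2.1.2 %/ gg z)))).
have φE z : P z -> exists g t x y : nat,
   [/\ [/\ (φ z).1.1 = g :> nat, (φ z).1.2 = t :> nat, (φ z).2.1 = (z.1 * x)%N :> nat & (φ z).2.2 = (z.1 * y)%N :> nat],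
    [/\ z.2.1.1 = (g * x)%N :> nat, z.2.1.2 = (g * y)%N :> nat, z.2.2.1 = (t * x)%N :> nat & z.2.2.2 = (t * y)%N :> nat] &
    [/\ (0 < z.1)%N, (0 < x)%N, (0 < y)%N, coprime x y & (0 < g)%N /\ (0 < t)%N]].
  case: z => m [[a b] [c d]] /and5P [/= m0 a0 b0 c0 /andP[d0 /eqP E]].
  have [g0 aE bE cE [dE cop]] := proportion_param a0 b0 E.
  rewrite /φ /gg /=; set g := gcdn a b in g0 aE bE cE dE cop *; set x := (a %/ g)%N in aE cE cop *.
  set y := (b %/ g)%N in bE dE cop *; set t := (c %/ x)%N in cE dE *.
  have [x0 y0] : (0 < x)%N /\ (0 < y)%N.
    by move: a0 b0; rewrite {1}aE {1}bE !muln_gt0 => /andP[_ ->] /andP[_ ->].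
  have t0 : (0 < t)%N by move: c0; rewrite {1}cE muln_gt0 => /andP[].
  have := ltn_ord m; have := ltn_ord a; have := ltn_ord b; have := ltn_ord c; rewrite !ltnS => cn bn an mn.
  have xn : (x <= n)%N by apply: leq_trans an; rewrite {1}aE leq_pmull.
  have yn : (y <= n)%N by apply: leq_trans bn; rewrite {1}bE leq_pmull.
  have gn : (g <= n)%N by apply: leq_trans an; rewrite {1}aE leq_pmulr.
  have tn : (t <= n)%N by apply: leq_trans cn; rewrite {1}cE leq_pmulr.
  by exists g, t, x, y; rewrite !inordK ?ltnS ?leq_mul.
apply: (ler_sum_inj (Q := xpredT) (φ := φ)) => [z|z z' Pz Pz' E|z Pz].
- by rewrite /w4 !mulr_ge0 ?invr_ge0 ?exprn_ge0.
- have [g [t [x [y [[e1 e2 e3 e4] [f1 f2 f3 f4] [m0 x0 y0 cop _]]]]]] := φE z Pz.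
  have [g' [t' [x' [y' [[e1' e2' e3' e4'] [f1' f2' f3' f4'] [m0' x0' y0' cop' _]]]]]] := φE z' Pz'.
  rewrite E in e1 e2 e3 e4.
  have mm : z.1 = z'.1 :> nat by rewrite -(coprime_scale_gcd z.1 cop) -(coprime_scale_gcd z'.1 cop') -e3 -e4 e3' e4'.
  have gE := etrans (esym e1) e1'; have tE := etrans (esym e2) e2'.
  have xE : x = x' by apply/eqP; rewrite -(eqn_pmul2l m0) {2}mm -e3 -e3'.
  have yE : y = y' by apply/eqP; rewrite -(eqn_pmul2l m0) {2}mm -e4 -e4'.
  move: f1 f2 f3 f4; rewrite tE xE yE gE -f1' -f2' -f3' -f4' => f1 f2 f3 f4.
  move: z z' mm f1 f2 f3 f4 {E Pz Pz' e1 e2 e3 e4 e1' e2' e3' e4' f1' f2' f3' f4' m0 m0'}.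
  by case=> [m [[a b] [c d]]] [m' [[a' b'] [c' d']]] /= /val_inj-> /val_inj-> /val_inj-> /val_inj-> /val_inj->.
have [g [t [x [y [[e1 e2 e3 e4] [f1 f2 f3 f4] [m0 x0 y0 cop [g0 t0]]]]]]] := φE z Pz.
rewrite /f /scaled_weight /w4 e1 e2 e3 e4 f1 f2 f3 f4.
split=> //; rewrite !natrM le_eqVlt; apply/orP; left; apply/eqP; field.
by rewrite !pnatr_eq0 -!lt0n m0 x0 y0 g0 t0.
Qed.

(** The map of the upper bound is inverted on [(g, t, X, Y)] whenever [g X], [g Y], [t X], [t Y] are
    all at most [n]. If one of them exceeds [n], say [g X], then [1/(g X)^2 <= 1/(n g X)]; the four
    cases give the error term. *)
Lemma mult_energy_lower n : (0 < n)%N ->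
  H 2 n ^+ 4 - 4 * (H 2 n ^+ 2 * H 1 n ^+ 2 / n%:R) <= H 4 n * mult_energy R n.
Proof.
move=> n0; have N0 : 0 < n%:R :> R by rewrite ltr0n.
pose D := ('I_n.+1 * 'I_n.+1 * ('I_n.+1 * 'I_n.+1))%type.
pose w (z : D) : R := z.1.1%:R ^- 2 * z.1.2%:R ^- 2 * (z.2.1%:R ^- 2 * z.2.2%:R ^- 2).
pose Q (z : D) := [&& [&& (0 < z.1.1)%N, (0 < z.1.2)%N, (0 < z.2.1)%N & (0 < z.2.2)%N],
  (z.1.1 * z.2.1 <= n)%N, (z.1.1 * z.2.2 <= n)%N, (z.1.2 * z.2.1 <= n)%N & (z.1.2 * z.2.2 <= n)%N].
pose u (k : nat) (i : 'I_n.+1) : R := (i : nat)%:R ^- k.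
have wE : \sum_z w z = H 2 n ^+ 4.
  rewrite (sum_prod4 (u 2) (u 2) (u 2) (u 2)) /u -!harmonic_shift; ring.
have inv2 (a b : nat) : (n < a * b)%N -> a%:R ^- 2 * b%:R ^- 2 <= a%:R ^- 1 * b%:R ^- 1 / n%:R :> R.
  move=> nab; have ab0 : (0 < a * b)%N by exact: leq_ltn_trans nab.
  have [a0 b0] : (0 : R) < a%:R /\ (0 : R) < b%:R by move: ab0; rewrite muln_gt0 !ltr0n => /andP.
  rewrite -!invfM lef_pV2 ?posrE ?mulr_gt0 ?exprn_gt0 //.
  have -> : a%:R ^+ 2 * b%:R ^+ 2 = a%:R ^+ 1 * b%:R ^+ 1 * (a * b)%:R :> R by rewrite natrM; ring.
  by rewrite ler_pM2l ?mulr_gt0 ?exprn_gt0 // ler_nat ltnW.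
pose r1 (z : D) : R := z.1.1%:R ^- 1 * z.1.2%:R ^- 2 * (z.2.1%:R ^- 1 * z.2.2%:R ^- 2).
pose r2 (z : D) : R := z.1.1%:R ^- 1 * z.1.2%:R ^- 2 * (z.2.1%:R ^- 2 * z.2.2%:R ^- 1).
pose r3 (z : D) : R := z.1.1%:R ^- 2 * z.1.2%:R ^- 1 * (z.2.1%:R ^- 1 * z.2.2%:R ^- 2).
pose r4 (z : D) : R := z.1.1%:R ^- 2 * z.1.2%:R ^- 1 * (z.2.1%:R ^- 2 * z.2.2%:R ^- 1).
have v0 (a : nat) k : (0 : R) <= a%:R ^- k by rewrite invr_ge0 exprn_ge0.
have bad : \sum_(z | ~~ Q z) w z <= \sum_z (r1 z + r2 z + r3 z + r4 z) / n%:R.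
  rewrite big_mkcond /=; apply: ler_sum => z _.
  have r10 : 0 <= r1 z by rewrite /r1 !mulr_ge0.
  have r20 : 0 <= r2 z by rewrite /r2 !mulr_ge0.
  have r30 : 0 <= r3 z by rewrite /r3 !mulr_ge0.
  have r40 : 0 <= r4 z by rewrite /r4 !mulr_ge0.
  have nv : 0 <= n%:R^-1 :> R by rewrite invr_ge0.
  have q1 := mulr_ge0 r10 nv; have q2 := mulr_ge0 r20 nv; have q3 := mulr_ge0 r30 nv; have q4 := mulr_ge0 r40 nv.
  case: ifP => [|_]; last by rewrite mulr_ge0 // !addr_ge0.
  rewrite !mulrDl /Q => nq.
  have [z0|] := boolP [&& (0 < z.1.1)%N, (0 < z.1.2)%N, (0 < z.2.1)%N & (0 < z.2.2)%N]; last first.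
    move=> z0; suff -> : w z = 0 by rewrite !addr_ge0.
    rewrite /w; move: z0; rewrite !negb_and -!eqn0Ngt.
    by case/or4P => /eqP ->; rewrite expr0n invr0 ?mul0r ?mulr0 ?mul0r.
  rewrite z0 !negb_and -!ltnNge /= in nq.
  case/or4P: nq => lt.
  - apply: (@le_trans _ _ (r1 z / n%:R)); last by lra.
    rewrite /w /r1; have := ler_wpM2r (mulr_ge0 (v0 z.1.2 2) (v0 z.2.2 2)) (inv2 _ _ lt).
    by congr (_ <= _); ring.
  - apply: (@le_trans _ _ (r2 z / n%:R)); last by lra.
    rewrite /w /r2; have := ler_wpM2r (mulr_ge0 (v0 z.1.2 2) (v0 z.2.1 2)) (inv2 _ _ lt).
    by congr (_ <= _); ring.
  - apply: (@le_trans _ _ (r3 z / n%:R)); last by lra.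
    rewrite /w /r3; have := ler_wpM2r (mulr_ge0 (v0 z.1.1 2) (v0 z.2.2 2)) (inv2 _ _ lt).
    by congr (_ <= _); ring.
  - apply: (@le_trans _ _ (r4 z / n%:R)); last by lra.
    rewrite /w /r4; have := ler_wpM2r (mulr_ge0 (v0 z.1.1 2) (v0 z.2.1 2)) (inv2 _ _ lt).
    by congr (_ <= _); ring.
have badE : \sum_z (r1 z + r2 z + r3 z + r4 z) / n%:R = 4 * (H 2 n ^+ 2 * H 1 n ^+ 2 / n%:R).
  rewrite -big_distrl /= !big_split /= (sum_prod4 (u 1) (u 2) (u 1) (u 2)) (sum_prod4 (u 1) (u 2) (u 2) (u 1)).
  rewrite (sum_prod4 (u 2) (u 1) (u 1) (u 2)) (sum_prod4 (u 2) (u 1) (u 2) (u 1)) /u -!harmonic_shift; ring.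
suff good : \sum_(z | Q z) w z <= H 4 n * mult_energy R n.
  by have := wE; rewrite (bigID Q) /= => <-; move: bad good; rewrite badE; lra.
rewrite harmonic4_energyE.
pose ψ (z : D) : scaled_proportion n :=
  let m := gcdn z.2.1 z.2.2 in let x := (z.2.1 %/ m)%N in let y := (z.2.2 %/ m)%N in
  (inord m, ((inord (z.1.1 * x), inord (z.1.1 * y)), (inord (z.1.2 * x), inord (z.1.2 * y)))).
have ψE z : Q z -> exists m x y : nat,
   [/\ [/\ (ψ z).1 = m :> nat, (ψ z).2.1.1 = (z.1.1 * x)%N :> nat, (ψ z).2.1.2 = (z.1.1 * y)%N :> nat,
       (ψ z).2.2.1 = (z.1.2 * x)%N :> nat & (ψ z).2.2.2 = (z.1.2 * y)%N :> nat],
      z.2.1 = (m * x)%N :> nat, z.2.2 = (m * y)%N :> nat &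
      [/\ (0 < m)%N, (0 < x)%N, (0 < y)%N, coprime x y & (0 < z.1.1)%N /\ (0 < z.1.2)%N]].
  case: z => [[g t] [x y]] /and5P [/= /and4P [g0 t0 x0 y0] gx gy tx ty].
  rewrite /ψ /=; set m := gcdn x y; exists m, (x %/ m)%N, (y %/ m)%N.
  have m0 : (0 < m)%N by rewrite gcdn_gt0 x0.
  have xE : (x = m * (x %/ m) :> nat)%N by rewrite mulnC divnK // dvdn_gcdl.
  have yE : (y = m * (y %/ m) :> nat)%N by rewrite mulnC divnK // dvdn_gcdr.
  have cop : coprime (x %/ m) (y %/ m).
    by rewrite /coprime -(eqn_pmul2l m0) muln_gcdr -xE -yE muln1.
  have [x0' y0'] : (0 < x %/ m)%N /\ (0 < y %/ m)%N.
    by move: x0 y0; rewrite {1}xE {1}yE !muln_gt0 => /andP[_ ->] /andP[_ ->].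
  have le_m a b k : (a * b <= n)%N -> (a * (b %/ k) <= n)%N.
    by apply: leq_trans; rewrite leq_mul2l leq_div orbT.
  have mn : (m <= n)%N.
    have := ltn_ord x; rewrite ltnS; apply: leq_trans; exact: dvdn_leq x0 (dvdn_gcdl x y).
  by rewrite !inordK ?ltnS ?le_m.
apply: (ler_sum_inj (φ := ψ)) => [z|z z' Qz Qz' E|z Qz].
- by rewrite /scaled_weight !mulr_ge0 ?invr_ge0 ?exprn_ge0.
- have [m [x [y [[e1 e2 e3 e4 e5] f1 f2 [m0 x0 y0 cop [g0 t0]]]]]] := ψE z Qz.
  have [m' [x' [y' [[e1' e2' e3' e4' e5'] f1' f2' [m0' x0' y0' cop' [g0' t0']]]]]] := ψE z' Qz'.
  rewrite E in e1 e2 e3 e4 e5.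
  have mE := etrans (esym e1) e1'.
  have gE : z.1.1 = z'.1.1 :> nat by rewrite -(coprime_scale_gcd z.1.1 cop) -(coprime_scale_gcd z'.1.1 cop') -e2 -e3 e2' e3'.
  have tE : z.1.2 = z'.1.2 :> nat by rewrite -(coprime_scale_gcd z.1.2 cop) -(coprime_scale_gcd z'.1.2 cop') -e4 -e5 e4' e5'.
  have xE : x = x' by apply/eqP; rewrite -(eqn_pmul2l g0) {2}gE -e2 -e2'.
  have yE : y = y' by apply/eqP; rewrite -(eqn_pmul2l g0) {2}gE -e3 -e3'.
  move: f1 f2; rewrite mE xE yE -f1' -f2' => f1 f2.
  move: z z' gE tE f1 f2 {E Qz Qz' e1 e2 e3 e4 e5 e1' e2' e3' e4' e5' f1' f2' g0 t0 g0' t0' xE yE}.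
  by case=> [[g t] [a b]] [[g' t'] [a' b']] /= /val_inj-> /val_inj-> /val_inj-> /val_inj->.
have [m [x [y [[e1 e2 e3 e4 e5] f1 f2 [m0 x0 y0 cop [g0 t0]]]]]] := ψE z Qz.
rewrite /is_scaled_proportion /scaled_weight /w e1 e2 e3 e4 e5 f1 f2.
rewrite !muln_gt0 m0 x0 y0 g0 t0 /=; split; first by apply/eqP; ring.
rewrite !natrM le_eqVlt; apply/orP; left; apply/eqP; field.
by rewrite !pnatr_eq0 -!lt0n m0 x0 y0 g0 t0.
Qed.
End MultiplicativeEnergy.

Lemma odd_le_4half n m : n = m.*2.+1 -> (0 < m)%N -> (n <= 4 * m)%N.
Proof. by move=> ->; lia. Qed.

(** The linear arithmetic of [mult_energy_asymp], isolated with its products as variables: [q] and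
    [X] are the energy times [pi^4/90] and times [H 4], [b] and [x] are the fourth powers of
    [pi^2/6] and of [H 2], [u] is [1/p] and [l] is [L^2/p]. *)
Lemma energy_error_arith (R : realFieldType) (q X b u l x t : R) : t <= 32 * l ->
  `|q - X| <= 3300 * u -> b * (1 - 12 * u) <= x -> x - 4 * t <= X -> X <= b -> b * u <= 51 * u ->
  u <= l -> 0 <= u -> `|q - b| <= 4900 * l.
Proof.
move=> h1; rewrite ler_norml => /andP[h2 h2'] h3 h4 h5 h6 h7 h8.
rewrite mulrBr mulr1 mulrCA in h3.
by move: (b * u) h6 h3 => bu h6 h3; rewrite ler_norml; apply/andP; split; lra.
Qed.

(** * The second moment of Dedekind sums *)

Section DedekindSecondMoment.
Variables (R : realFieldType) (F : finFieldType) (p : nat) (co si : F -> R) (pi : R).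
Hypotheses (p_pr : prime p) (p_gt3 : (3 < p)%N) (cardF : #|F| = p)
  (ac : additive_character co si).
Local Notation ct := (cotangent co si).
Local Notation h := p./2.
Local Notation H := (harmonic R).
Hypotheses (pi_ge3 : 3 <= pi) (pi_le4 : pi <= 4).
Hypothesis ct_bound : forall i, (i < h)%N ->
  [/\ 0 <= ct i.+1%:R, ct i.+1%:R <= p%:R / (pi * i.+1%:R), p%:R / (pi * i.+1%:R) <= ct i.+1%:R + 1 &
     (p%:R / (pi * i.+1%:R)) ^+ 2 <= 1 + ct i.+1%:R ^+ 2].
Hypothesis HB : forall n, H 2 n <= pi ^+ 2 / 6.
Variables (L D : R).
Hypotheses (L1 : 1 <= L) (D1 : 1 <= D) (HL : H 1 p <= L)
  (HD : forall n, \sum_(i < h) \sum_(j < h) (i.+1 * j.+1 == n)%N%:R <= D).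
Let P0 : (0 : R) < p%:R. Proof. by rewrite ltr0n prime_gt0. Qed.
Let P4 : (4 : R) <= p%:R. Proof. by rewrite ler_nat. Qed.
Let Pn0 : (p%:R : R) != 0 := lt0r_neq0 P0.
Let pi0 : 0 < pi. Proof. by have := pi_ge3; lra. Qed.
Let pin0 : pi != 0 := lt0r_neq0 pi0.
Local Notation E := (mult_energy R h).
Let ph := p_half p_pr (ltnW p_gt3).
Let L0 : 0 <= L. Proof. by have := L1; lra. Qed.

Let pi_pow k : 3 ^+ k <= pi ^+ k <= 4 ^+ k.
Proof. by apply/andP; split; rewrite lerXn2r ?nnegrE // ltW. Qed.

Let E0 : 0 <= E.
Proof. by rewrite /mult_energy; do 4 (apply: sumr_ge0 => ? _); rewrite !mulr_ge0 ?invr_ge0. Qed.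

Lemma mult_energy_asymp : `|pi ^+ 4 / 90 * E - (pi ^+ 2 / 6) ^+ 4| <= 4900 * L ^+ 2 / p%:R.
Proof.
pose B := pi ^+ 2 / 6.
have [b1 b2] : 3 / 2 <= B /\ B <= 8 / 3.
  by have /andP[] := pi_pow 2; rewrite /B => *; split; lra.
have h0 : (0 < h)%N by rewrite half_gt0 (ltn_trans _ p_gt3).
have up := mult_energy_upper h HB; rewrite -/B in up.
have lo := mult_energy_lower R h0.
have /andP[x1 x2] := harmonic2_bounds p_pr p_gt3 cardF ac pi_ge3 ct_bound.
have y1 := harmonic4_bounds p_pr p_gt3 cardF ac pi_ge3 ct_bound.
have y2 : 1 <= H 4 h.
  rewrite /harmonic; case: h h0 => // n _; rewrite big_ord_recl expr1n invr1 lerDl.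
  by apply: sumr_ge0 => i _; rewrite invr_ge0 exprn_ge0.
have l1 : H 1 h <= L := harmonic_half_le p_pr p_gt3 cardF HL HD.
have l0 : 0 <= H 1 h by exact: harmonic_ge0.
have hP : h%:R^-1 <= 4 / p%:R :> R.
  rewrite ler_pdivlMr // mulrC ler_pdivrMr ?ltr0n // -natrM ler_nat.
  exact: odd_le_4half ph h0.
pose u : R := p%:R^-1.
have u0 : 0 <= u by rewrite invr_ge0 ltW.
have u4 : u <= 1 / 4 by rewrite /u -div1r ler_pdivrMr //; have := P4; lra.
have x1' : B * (1 - 3 * u) <= H 2 h by move: x1; rewrite /B /u; lra.
have X4 : B ^+ 4 * (1 - 12 * u) <= H 2 h ^+ 4.
  apply: (@le_trans _ _ ((B * (1 - 3 * u)) ^+ 4)); last first.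
    have B0 : 0 <= B by lra.
    have q0 : 0 <= 1 - 3 * u by lra.
    by rewrite lerXn2r ?nnegrE ?harmonic_ge0 ?(mulr_ge0 B0 q0).
  rewrite (exprMn 4 B); apply: ler_wpM2l; first by rewrite exprn_ge0 //; lra.
  have : 0 <= (u * (1 - u)) ^+ 2 by exact: sqr_ge0.
  have : 0 <= u ^+ 2 * (1 / 4 - u) by rewrite mulr_ge0 ?exprn_ge0 // subr_ge0.
  have := sqr_ge0 (u ^+ 2); have := sqr_ge0 u; nra.
have B4 : B ^+ 4 <= 51.
  apply: (@le_trans _ _ ((8 / 3) ^+ 4)); last by lra.
  by rewrite lerXn2r ?nnegrE //; lra.
have x2B : H 2 h ^+ 2 <= 8.
  apply: (@le_trans _ _ ((8 / 3) ^+ 2)); last by lra.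
  by rewrite lerXn2r ?nnegrE ?harmonic_ge0 //; move: x2; rewrite -/B; lra.
have t1 : H 2 h ^+ 2 * H 1 h ^+ 2 / h%:R <= 8 * L ^+ 2 * (4 * u).
  apply: ler_pM => //; [by rewrite mulr_ge0 ?exprn_ge0 ?harmonic_ge0 | by rewrite invr_ge0 |].
  apply: ler_pM; rewrite ?exprn_ge0 ?harmonic_ge0 //.
  by rewrite lerXn2r ?nnegrE.
have Lu : u <= L ^+ 2 * u by rewrite ler_peMl //; have := L1; nra.
have EB : E <= 51.
  apply: le_trans B4; apply: le_trans up; by rewrite ler_peMl.
have pi4 : pi ^+ 4 <= 256 by have /andP[_] := pi_pow 4; lra.
have t2 : `|pi ^+ 4 / 90 * E - H 4 h * E| <= 3300 * u.
  rewrite -mulrBl normrM [`|E|]ger0_norm //.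
  apply: (@le_trans _ _ (256 * (u * (1 / 4)) * 51)); last by lra.
  have w1 : 0 <= pi ^+ 4 by rewrite exprn_ge0 // ltW.
  have w2 : 0 <= u * u by rewrite mulr_ge0.
  have w3 : u * u <= u * (1 / 4) by apply: ler_wpM2l.
  have w4 := ler_pM w1 w2 pi4 w3.
  apply: ler_pM => //; rewrite distrC; apply: le_trans y1 _; rewrite expr2 invfM; exact: w4.
have B4u : B ^+ 4 * u <= 51 * u by apply: ler_wpM2r.
have -> : 4900 * L ^+ 2 / p%:R = 4900 * (L ^+ 2 * u) by rewrite /u; ring.
have t1' : H 2 h ^+ 2 * H 1 h ^+ 2 / h%:R <= 32 * (L ^+ 2 * u) by apply: le_trans t1 _; lra.
exact: energy_error_arith t1' t2 X4 lo up B4u Lu u0.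
Qed.

Lemma dedekind_second_moment :
  `|\sum_l dedekind_sum R p (l : F) ^+ 2 - 5 / 144 * p%:R ^+ 2| <= 50 * p%:R * L ^+ 3 * D.
Proof.
set S := \sum_l _.
have h1 : H 1 h <= L := harmonic_half_le p_pr p_gt3 cardF HL HD.
have a1 := dedekind_second_moment_correlation p_pr p_gt3 cardF ac pi_ge3 ct_bound L1 h1.
have a2 := sum_correlation_sqr_energy p_pr p_gt3 cardF HL HD.
have a3 := mult_energy_asymp.
rewrite -/S in a1; set V := \sum_l _ in a1 a2.
pose k := (p%:R / pi) ^+ 4.
have k0 : 0 <= k by rewrite exprn_ge0 // divr_ge0 // ltW.
have kp : k <= p%:R ^+ 4 / 81.
  rewrite /k expr_div_n; apply: ler_wpM2l; first by rewrite exprn_ge0.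
  rewrite lef_pV2 ?posrE ?exprn_gt0 //; by have /andP[] := pi_pow 4; lra.
have LD : L ^+ 3 <= L ^+ 3 * D by rewrite ler_peMr // exprn_ge0.
have L23 : L ^+ 2 <= L ^+ 3 by rewrite [leRHS]exprS ler_peMl // exprn_ge0.
have Pge : 0 <= p%:R :> R := ltW P0.
have Z0 : 0 <= p%:R ^+ 3 * (L ^+ 3 * D).
  apply: mulr_ge0; first exact: exprn_ge0.
  apply: mulr_ge0; first exact: exprn_ge0.
  by have := D1; lra.
have b1 : `|k * V - k * (8 * E)| <= p%:R ^+ 3 * (L ^+ 3 * D).
  rewrite -mulrBr normrM [`|k|]ger0_norm //.
  apply: (@le_trans _ _ (p%:R ^+ 4 / 81 * (64 * L ^+ 3 * D / p%:R))); first exact: ler_pM.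
  have -> : p%:R ^+ 4 / 81 * (64 * L ^+ 3 * D / p%:R) = 64 / 81 * (p%:R ^+ 3 * (L ^+ 3 * D)) by field.
  by rewrite -[leRHS]mul1r; apply: ler_wpM2r => //; lra.
(* The constant is [8 * 90 / 6^4 = 5/9], the powers of [pi] cancelling; division by [16 p^2] then
   gives [5/144 p^2]. *)
have b2 : `|k * (8 * E) - 5 / 9 * p%:R ^+ 4| <= 600 * (p%:R ^+ 3 * (L ^+ 3 * D)).
  have -> : k * (8 * E) - 5 / 9 * p%:R ^+ 4 =
    p%:R ^+ 4 * 720 / pi ^+ 8 * (pi ^+ 4 / 90 * E - (pi ^+ 2 / 6) ^+ 4) by rewrite /k; field.
  have pi8 : 0 <= p%:R ^+ 4 * 720 / pi ^+ 8 by apply: divr_ge0; [apply: mulr_ge0 => //; exact: exprn_ge0 | apply: exprn_ge0; exact: ltW].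
  rewrite normrM (ger0_norm pi8).
  apply: (@le_trans _ _ (p%:R ^+ 4 * 720 / 3 ^+ 8 * (4900 * L ^+ 2 / p%:R))).
    apply: ler_pM => //; apply: ler_wpM2l; first by apply: mulr_ge0 => //; exact: exprn_ge0.
    by rewrite lef_pV2 ?posrE ?exprn_gt0 //; have /andP[] := pi_pow 8.
  have -> : p%:R ^+ 4 * 720 / 3 ^+ 8 * (4900 * L ^+ 2 / p%:R) = 720 * 4900 / 3 ^+ 8 * (p%:R ^+ 3 * L ^+ 2) by field.
  have PL : p%:R ^+ 3 * L ^+ 2 <= p%:R ^+ 3 * (L ^+ 3 * D).
    by apply: ler_wpM2l; [exact: exprn_ge0 | exact: le_trans L23 LD].
  have PL0 : 0 <= p%:R ^+ 3 * L ^+ 2 by apply: mulr_ge0; exact: exprn_ge0.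
  by apply: ler_pM => //; lra.
have b3 : `|16 * p%:R ^+ 2 * S - k * V| <= 100 * (p%:R ^+ 3 * (L ^+ 3 * D)).
  apply: le_trans a1 _; rewrite -[leLHS]mulrA; apply: ler_wpM2l => //.
  by apply: ler_wpM2l; first exact: exprn_ge0.
have c1 : `|16 * p%:R ^+ 2 * (S - 5 / 144 * p%:R ^+ 2)| <= 16 * p%:R ^+ 2 * (50 * p%:R * L ^+ 3 * D).
  have -> : 16 * p%:R ^+ 2 * (50 * p%:R * L ^+ 3 * D) = 800 * (p%:R ^+ 3 * (L ^+ 3 * D)) by ring.
  have := Z0.
  move: b1 b2 b3; set Z := p%:R ^+ 3 * _; rewrite !ler_norml.
  move=> /andP[? ?] /andP[? ?] /andP[? ?] ?; apply/andP; split; lra.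
have q0 : 0 < 16 * p%:R ^+ 2 :> R by rewrite mulr_gt0 // exprn_gt0.
by move: c1; rewrite normrM (ger0_norm (ltW q0)) ler_pM2l.
Qed.
End DedekindSecondMoment.

(** * The weighted fourth moment *)

Lemma sum_moment_error (R : realFieldType) (I : finType) (P : pred I) (s q : I -> R) (b e : R) :
  (forall i, P i -> `|q i - b| <= e) -> (forall i, 0 <= s i) ->
  `|\sum_(i | P i) s i * q i - b * \sum_(i | P i) s i| <= e * \sum_(i | P i) s i.
Proof.
move=> qe s0; rewrite !big_distrr -sumrB; apply: le_trans (ler_norm_sum _ _ _) _.
apply: ler_sum => i Pi /=; rewrite [b * _]mulrC -mulrBr normrM (ger0_norm (s0 i)) mulrC.
by apply: ler_wpM2r => //; exact: qe.
Qed.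

Section WeightedFourthMoment.
Variables (R : realFieldType) (F : finFieldType) (p : nat) (co si : F -> R) (pi : R).
Hypotheses (p_pr : prime p) (p_gt3 : (3 < p)%N) (cardF : #|F| = p)
  (ac : additive_character co si).
Local Notation χ := (@chi R F p).
Local Notation S := (@dedekind_sum R F p).
Let p_gt2 : (2 < p)%N := ltnW p_gt3.
Let P1 : (1 : R) <= p%:R. Proof. by rewrite ler1n prime_gt0. Qed.
Let P0 : (0 : R) <= p%:R. Proof. by []. Qed.

(** Oddness is read off Eisenstein's formula, where it is that of the sine; no computation with
    residues is required. *)
Lemma sawtoothN a : sawtooth R p (- a : F) = - sawtooth R p a.
Proof.
have Pn0 : 2 * p%:R != 0 :> R by rewrite mulf_neq0 // pnatr_eq0 -lt0n prime_gt0.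
have e1 := eisenstein p_pr cardF ac (- a); have e2 := eisenstein p_pr cardF ac a.
have N : sine_sum co si (- a) = - sine_sum co si a.
  by rewrite /sine_sum -sumrN; apply: eq_bigr => l _; rewrite mulrN (siN ac) mulrN.
apply: (mulfI Pn0); apply: oppr_inj; rewrite -e1 N e2; ring.
Qed.

Lemma dedekind_sumN c : S (- c) = - S c.
Proof.
by rewrite /dedekind_sum -sumrN; apply: eq_bigr => a _; rewrite mulrN sawtoothN mulrN.
Qed.

Lemma chi_N1 : odd p./2 -> χ (-1) = -1.
Proof.
move=> o; rewrite /chi oppr_eq0 oner_eq0 -signr_odd o expr1 eq_sym.
by rewrite (negPf (F1_neqN1 p_pr p_gt2 cardF)).
Qed.

Definition weighted_fourth_moment := \sum_(m : F | m != 0) \sum_(n : F | n != 0)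
  norm_sq co si (fun a : F => m * a ^+ 4 + n * a ^+ 2) ^+ 2 * S (m / n) ^+ 2.

Definition twisted_second_moment := \sum_(c : F | c != 0) χ (2 * c) * S c ^+ 2.

Lemma twisted_second_moment_eq0 : odd p./2 -> twisted_second_moment = 0.
Proof.
move=> /chi_N1 o; have : twisted_second_moment = - twisted_second_moment; last by move=> H; lra.
rewrite {1}/twisted_second_moment (reindex_inj oppr_inj) /= /twisted_second_moment -sumrN.
apply: eq_big => [c|c _]; first by rewrite oppr_eq0.
have -> : 2 * - c = -1 * (2 * c) by ring.
by rewrite (chiM R p_pr p_gt2 cardF (-1)) o dedekind_sumN sqrrN mulN1r mulNr.
Qed.

Local Notation W := (\sum_c S c ^+ 2).

Lemma dedekind_sum0 : S 0 = 0.
Proof.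
rewrite /dedekind_sum big1 // => a _; by rewrite mulr0 {2}/sawtooth eqxx mulr0.
Qed.

Lemma second_moment_nonzero : \sum_(c : F | c != 0) S c ^+ 2 = W.
Proof. by rewrite [RHS](bigD1 0) //= dedekind_sum0 expr0n add0r. Qed.

Lemma norm_twisted_second_moment : `|twisted_second_moment| <= W.
Proof.
rewrite -second_moment_nonzero; apply: le_trans (ler_norm_sum _ _ _) _; apply: ler_sum => c _.
by rewrite normrM [`|S c ^+ 2|]ger0_norm ?sqr_ge0 // -[leRHS]mul1r; apply: ler_wpM2r; rewrite ?sqr_ge0 // chi_norm.
Qed.

Lemma weighted_fourth_moment_error :
  `|weighted_fourth_moment - 7 * p%:R ^+ 3 * W - p%:R ^+ 2 * theta R F p * twisted_second_moment|
    <= 10 ^+ 6 * p%:R ^+ 2 * W.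
Proof.
rewrite /weighted_fourth_moment (weighted_moment p_pr p_gt3 cardF ac (fun c => S c ^+ 2)).
pose q c : R := p%:R * quadric_count R p (2 * c : F)^-1 - p%:R ^+ 4 - p%:R ^+ 2 * theta R F p * χ (2 * c).
have qB c : c != 0 -> `|q c - 7 * p%:R ^+ 3| <= 10 ^+ 6 * p%:R ^+ 2.
  move=> c0; have k0 : (2 * c)^-1 != 0 by rewrite invr_eq0 mulf_neq0 // (F2_neq0 p_pr p_gt2 cardF).
  have := quadric_count_asymp R p_pr p_gt3 cardF k0; rewrite (chiV R p_pr p_gt2 cardF) => B.
  have -> : q c - 7 * p%:R ^+ 3 = p%:R * (quadric_count R p (2 * c)^-1 -
    (p%:R ^+ 3 + 7 * p%:R ^+ 2 + p%:R * χ (2 * c) * theta R F p)) by rewrite /q; ring.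
  have -> : 10 ^+ 6 * p%:R ^+ 2 = p%:R * (10 ^+ 6 * p%:R) :> R by rewrite [RHS]mulrCA -expr2.
  by rewrite normrM (ger0_norm P0); apply: ler_wpM2l.
have := sum_moment_error qB (fun c => sqr_ge0 (S c)).
rewrite second_moment_nonzero; congr (`|_| <= _); rewrite addrAC; congr (_ - _).
rewrite /twisted_second_moment big_distrr -sumrB; apply: eq_bigr => c _ /=.
rewrite /q; ring.
Qed.

Variable X : R.
Hypotheses (X1 : 1 <= X) (HW : `|W - 5 / 144 * p%:R ^+ 2| <= 50 * p%:R * X).

Lemma second_moment_bound : W <= 51 * (p%:R ^+ 2 * X).
Proof.
have p2 : p%:R <= p%:R ^+ 2 :> R by rewrite expr2 ler_peMl.
have a1 : p%:R * X <= p%:R ^+ 2 * X by apply: ler_wpM2r => //; have := X1; lra.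
have a2 : p%:R ^+ 2 * 1 <= p%:R ^+ 2 * X by apply: ler_wpM2l => //; exact: exprn_ge0.
have P20 : 0 <= p%:R ^+ 2 :> R by exact: exprn_ge0.
by move: HW; rewrite ler_norml => /andP[_ ?]; lra.
Qed.

Let Y : R := p%:R ^+ 4 * X.

Lemma weighted_fourth_moment_main :
  `|weighted_fourth_moment - 35 / 144 * p%:R ^+ 5 - p%:R ^+ 2 * theta R F p * twisted_second_moment|
    <= 10 ^+ 8 * Y.
Proof.
have e1 := weighted_fourth_moment_error.
have e2 : `|7 * p%:R ^+ 3 * W - 35 / 144 * p%:R ^+ 5| <= 350 * Y.
  have -> : 7 * p%:R ^+ 3 * W - 35 / 144 * p%:R ^+ 5 = 7 * p%:R ^+ 3 * (W - 5 / 144 * p%:R ^+ 2) by field.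
  have q0 : 0 <= 7 * p%:R ^+ 3 :> R by rewrite mulr_ge0 // exprn_ge0.
  rewrite normrM (ger0_norm q0); have -> : 350 * Y = 7 * p%:R ^+ 3 * (50 * p%:R * X) by rewrite /Y; ring.
  exact: ler_wpM2l.
have e3 : p%:R ^+ 2 * W <= 51 * Y.
  have -> : 51 * Y = p%:R ^+ 2 * (51 * (p%:R ^+ 2 * X)) by rewrite /Y; ring.
  by apply: ler_wpM2l; [exact: exprn_ge0 | exact: second_moment_bound].
have Y0 : 0 <= Y by apply: mulr_ge0; [exact: exprn_ge0 | have := X1; lra].
move: (weighted_fourth_moment) (p%:R ^+ 2 * theta R F p * twisted_second_moment) e1 e2 e3 Y0.
rewrite -[10 ^+ 6 * _ * W]mulrA.
move: (7 * p%:R ^+ 3 * W) (p%:R ^+ 2 * W) (35 / 144 * p%:R ^+ 5) Y => u v w y t z.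
rewrite !ler_norml => /andP[a1 a2] /andP[b1 b2] c y0; apply/andP; split; lra.
Qed.

Lemma weighted_fourth_moment_3mod4 : odd p./2 ->
  `|weighted_fourth_moment - 35 / 144 * p%:R ^+ 5| <= 10 ^+ 8 * (p%:R ^+ 4 * X).
Proof.
by move=> o; have := weighted_fourth_moment_main; rewrite twisted_second_moment_eq0 // mulr0 subr0.
Qed.

(** [s] stands for the square root of [p], taken as a hypothesis because [R] is only an ordered
    field. The twisted moment is bounded trivially by the untwisted one, and the factor [s] comes
    from [theta]. *)
Lemma weighted_fourth_moment_any (s : R) : 0 <= s -> s ^+ 2 = p%:R ->
  `|weighted_fourth_moment - 35 / 144 * p%:R ^+ 5| <= 10 ^+ 9 * (p%:R ^+ 4 * s * X).
Proof.
move=> s0 s2.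
have s1 : 1 <= s by rewrite -(@ler_pXn2r _ 2) ?nnegrE // expr1n s2.
have th : `|theta R F p| <= 10 ^+ 3 * s.
  rewrite -(@ler_pXn2r _ 2) ?nnegrE ?mulr_ge0 ?exprn_ge0 // real_normK ?num_real //.
  apply: le_trans (theta_sqr R p_pr p_gt3 cardF) _.
  by rewrite exprMn s2 -exprM.
have Y0 : 0 <= Y by apply: mulr_ge0; [exact: exprn_ge0 | have := X1; lra].
have t1 : `|p%:R ^+ 2 * theta R F p * twisted_second_moment| <= 10 ^+ 3 * 51 * (Y * s).
  rewrite normrM normrM (ger0_norm (exprn_ge0 2 P0)).
  have -> : 10 ^+ 3 * 51 * (Y * s) = p%:R ^+ 2 * (10 ^+ 3 * s) * (51 * (p%:R ^+ 2 * X)) by rewrite /Y; ring.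
  apply: ler_pM => //; first by rewrite mulr_ge0 ?exprn_ge0.
    by apply: ler_wpM2l => //; exact: exprn_ge0.
  exact: le_trans norm_twisted_second_moment second_moment_bound.
have Ys : Y <= Y * s by rewrite ler_peMr.
have -> : p%:R ^+ 4 * s * X = Y * s by rewrite /Y; ring.
have e1 := weighted_fourth_moment_main.
move: (weighted_fourth_moment) (p%:R ^+ 2 * theta R F p * twisted_second_moment) (35 / 144 * p%:R ^+ 5) e1 t1.
move: Y (Y * s) Y0 Ys => y ys y0 yys t z w.
rewrite !ler_norml => /andP[a1 a2] /andP[b1 b2]; apply/andP; split; lra.
Qed.
End WeightedFourthMoment.

End FiniteField.

(** * The prime field *)

Module PrimeField.
Import all_boot all_order all_algebra all_field Rstruct ring lra zify.
Import FiniteField.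
Set Implicit Arguments. Unset Strict Implicit. Unset Printing Implicit Defensive.
Import Order.TTheory GRing.Theory Num.Theory.
Local Open Scope ring_scope.

Local Notation R := Rdefinitions.R.

Lemma prime_nat_of_Z p : Znumtheory.prime (Z.of_nat p) -> prime p.
Proof.
move=> pp; apply/primeP; split.
  by case: (pp) => p1 _; lia.
move=> d /dvdnP [k E].
have D : Z.divide (Z.of_nat d) (Z.of_nat p) by exists (Z.of_nat k); rewrite -Nat2Z.inj_mul E.
have := prime_divisors _ pp _ D.
case=> [|[|[|]]] H; apply/orP.
- by exfalso; lia.
- by left; apply/eqP; lia.
- by right; apply/eqP; lia.
- by case: (pp) => p1 _; exfalso; lia.
Qed.

Lemma rsumE n (f : nat -> R) : rsum n f = \sum_(i < n) f i.
Proof. by elim: n => [|n IH]; rewrite ?big_ord0 // big_ord_recr /= -IH. Qed.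

Lemma harmonic_le_ln n : (0 < n)%N -> (harmonic R 1 n <= 1 + ln (INR n))%R.
Proof.
case: n => // n _; elim: n => [|n IH].
  by rewrite /harmonic big_ord1 expr1n invr1 /= ln_1 addr0.
rewrite /harmonic big_ord_recr /= -/(harmonic R 1 n.+1).
apply/RleP; rewrite expr1 -INRE; apply: add_inv_le_ln; exact/RleP.
Qed.

Lemma sum_ord_head (g : nat -> R) n : (0 < n)%N ->
  \sum_(i < n) g i = g 0%N + \sum_(i < n - 1) g i.+1.
Proof. by case: n => // n _; rewrite subn1 big_ord_recl. Qed.

Section PrimeField.
Variable p : nat.
Hypotheses (p_pr : prime p) (p_gt3 : (3 < p)%N).
Local Notation F := 'F_p.
Let cardF : #|{: F}| = p := card_Fp p_pr.
Let p0 : (0 < p)%coq_nat. Proof. by apply/ssrnat.ltP; exact: prime_gt0. Qed.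

Definition Fcos (x : F) : R := cos (angle p x).
Definition Fsin (x : F) : R := sin (angle p x).

Lemma modn_coq m : (m %% p)%N = Nat.modulo m p.
Proof.
have lt : (Nat.modulo m p < p)%N by apply/ssrnat.ltP; apply: Nat.mod_upper_bound; lia.
by rewrite {1}(Nat.div_mod_eq m p) plusE multE mulnC modnMDl modn_small.
Qed.

Lemma Fcos_nat n : Fcos n%:R = cos (angle p n).
Proof. by rewrite /Fcos val_Fp_nat // modn_coq cos_angle_mod. Qed.

Lemma Fsin_nat n : Fsin n%:R = sin (angle p n).
Proof. by rewrite /Fsin val_Fp_nat // modn_coq sin_angle_mod. Qed.

Lemma Fp_natE (x : F) : x = (x : nat)%:R.
Proof. by rewrite natr_Zp. Qed.

Lemma Fp_lt (x : F) : (x < p)%N.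
Proof. by have := ltn_ord x; rewrite {2}Fp_cast. Qed.

Lemma Fp_additive_character : additive_character Fcos Fsin.
Proof.
have opp (x : F) : - x = (p - x)%:R.
  rewrite natrB ?(ltnW (Fp_lt x)) // natr_Zp.
  by have -> : p%:R = 0 :> F by [apply: (natF_p p_pr cardF)]; rewrite sub0r.
have ang (x : F) : angle p (p - x)%N = Rminus (2 * PI) (angle p x).
  have := @angle_plus p (p - x)%N x p0; rewrite plusE subnK ?(ltnW (Fp_lt x)) //.
  by have := @angle_mult p 1 p0; rewrite multE mul1n => -> /=; Lra.lra.
split.
- move=> x y; rewrite [x]Fp_natE [y]Fp_natE -natrD !Fcos_nat !Fsin_nat -plusE angle_plus //.
  by rewrite cos_plus.
- move=> x y; rewrite [x]Fp_natE [y]Fp_natE -natrD !Fcos_nat !Fsin_nat -plusE angle_plus //.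
  by rewrite sin_plus.
- move=> x; rewrite opp Fcos_nat ang cos_minus cos_2PI sin_2PI /Fcos; Lra.lra.
- move=> x; rewrite opp Fsin_nat ang sin_minus cos_2PI sin_2PI /Fsin.
  by rewrite -RoppE; Lra.lra.
- rewrite -[0]/(0%:R) Fcos_nat /angle /= Rmult_0_r /Rdiv Rmult_0_l cos_0; exact: R1E.
move=> x x0; apply/eqP; apply: sin_angle_neq0.
  have := Fp_lt x; have : (0 < x)%N by rewrite lt0n; apply: contra x0 => /eqP E; apply/eqP; apply: val_inj.
  by move=> /ssrnat.ltP ? /ssrnat.ltP ?.
have := p_half p_pr (ltnW p_gt3); lia.
Qed.

Lemma Fcotangent_bound i : (i < p./2)%N ->
  [/\ 0 <= cotangent Fcos Fsin i.+1%:R, cotangent Fcos Fsin i.+1%:R <= p%:R / (PI * i.+1%:R),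
     p%:R / (PI * i.+1%:R) <= cotangent Fcos Fsin i.+1%:R + 1 &
     (p%:R / (PI * i.+1%:R)) ^+ 2 <= 1 + cotangent Fcos Fsin i.+1%:R ^+ 2].
Proof.
move=> ih; have i2 : (2 * i.+1 < p)%N by rewrite [leqRHS](p_half p_pr (ltnW p_gt3)); lia.
have [|h0 [h1 [h2 h3]]] := @cotangent_angle_bounds p i.+1 _ (elimT ssrnat.ltP i2); first by lia.
have cE : cotangent Fcos Fsin i.+1%:R = Rdiv (Rplus 1 (cos (angle p i.+1))) (sin (angle p i.+1)).
  by rewrite /cotangent Fcos_nat Fsin_nat.
have zE : p%:R / (PI * i.+1%:R) = Rdiv (INR p) (Rmult PI (INR i.+1)) by rewrite !INRE.
by rewrite cE zE; split; apply/RleP; rewrite // -!RpowE.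
Qed.

Lemma PI_3_4 : 3 <= PI /\ PI <= 4.
Proof.
have [h1 h2] := PI_bounds_3_4.
have E3 : 3%:R = IZR 3 :> R by rewrite -INRE /=; Lra.lra.
have E4 : 4%:R = IZR 4 :> R by rewrite -INRE /=; Lra.lra.
by rewrite E3 E4; split; apply/RleP.
Qed.

Lemma harmonic2_half_le : harmonic R 2 p./2 <= PI ^+ 2 / 6.
Proof.
have [pi3 _] := PI_3_4.
by have /andP[] := harmonic2_bounds p_pr p_gt3 cardF Fp_additive_character pi3 Fcotangent_bound.
Qed.

Lemma Nat_powE b k : Nat.pow b k = (b ^ k)%N.
Proof. by elim: k => //= k ->; rewrite expnS. Qed.

Lemma Fnorm_sq m n :
  Rpow_def.pow (Cmod (twoTermSum (Z.of_nat m) (Z.of_nat n) 4 2 p)) 4 =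
  norm_sq Fcos Fsin (fun a : F => m%:R * a ^+ 4 + n%:R * a ^+ 2) ^+ 2.
Proof.
rewrite twoTermSum_pow4 !rsumE /norm_sq !(sumF p_pr cardF) !RpowE.
congr ((_ ^+ 2 + _ ^+ 2) ^+ 2); apply: eq_bigr => a _.
  by rewrite -!natrX -!natrM -natrD Fcos_nat !Nat_powE plusE !multE.
by rewrite -!natrX -!natrM -natrD Fsin_nat !Nat_powE plusE !multE.
Qed.

Lemma saw_sawtooth k : saw (Rdiv (INR k) (INR p)) = sawtooth R p (k%:R : F).
Proof.
rewrite saw_ratio // -modn_coq.
have kE : k%:R = (k %% p)%:R :> F by apply/eqP; rewrite (natF_eq p_pr cardF) modn_mod.
have kp : (k %% p < p)%N by rewrite ltn_pmod ?prime_gt0.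
rewrite kE /sawtooth (residue_nat p_pr cardF kp).
have -> : ((k %% p)%:R == 0 :> F) = (k %% p == 0)%N.
  by rewrite -[0]/(0%:R) (natF_eq p_pr cardF) mod0n modn_mod.
have -> : Nat.eqb (k %% p)%N 0 = (k %% p == 0)%N by case: (k %% p)%N.
case: eqP => // _; rewrite !INRE RminusE !RdivE; congr (_ - _ / _).
Qed.

Lemma invmod_inv n : (0 < n < p)%N -> ((invmod p n)%:R : F) = n%:R^-1.
Proof.
move=> np; have n0 : n%:R != 0 :> F by exact: (Fp_nat_neq0 p_pr cardF np).
pose j : nat := (n%:R^-1 : F).
have jp : (j < p)%N := Fp_lt _.
have jE : j%:R = n%:R^-1 :> F by rewrite /j natr_Zp.
have j0 : (0 < j)%N by rewrite lt0n; apply/eqP => E; move: n0; rewrite -invr_eq0 -jE E eqxx.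
have one k : n%:R * k%:R = 1 :> F <-> Nat.modulo (n * k) p = 1%N.
  rewrite -natrM -[1]/(1%:R) -modn_coq; split.
    by move/eqP; rewrite (natF_eq p_pr cardF) [(1 %% p)%N]modn_small ?prime_gt1 // => /eqP.
  by move=> E; apply/eqP; rewrite (natF_eq p_pr cardF) E modn_small ?prime_gt1.
have inv1 : n%:R * (invmod p n)%:R = 1 :> F.
  apply/one; apply: (@find_inv_spec p n (p - 1) j); last by apply/one; rewrite jE divff.
  by split; apply/ssrnat.leP; lia.
by apply: (mulfI n0); rewrite inv1 divff.
Qed.

Lemma dedekind_dedekind_sum m n : (0 < n < p)%N ->
  dedekind (Z.mul (Z.of_nat m) (Z.of_nat (invmod p n))) p = dedekind_sum R p (m%:R / n%:R : F).
Proof.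
move=> np; rewrite -Nat2Z.inj_mul dedekind_nat rsumE /dedekind_sum (sumF p_pr cardF).
apply: eq_bigr => a _; rewrite !saw_sawtooth -(invmod_inv np); congr (_ * sawtooth R p _).
by rewrite !multE !natrM.
Qed.

Lemma sum_nonzero (g : F -> R) : \sum_(x | x != 0) g x = \sum_(i < p - 1) g (i.+1%:R).
Proof.
have := sumF p_pr cardF g; rewrite (bigD1 0) //=.
have -> : \sum_(i < p) g (i : nat)%:R = g 0 + \sum_(i < p - 1) g (i.+1%:R).
  exact: (sum_ord_head (fun i => g i%:R) (prime_gt0 p_pr)).
by move/addrI.
Qed.

Lemma moment_weighted_fourth_moment :
  rsum (p - 1) (fun i => rsum (p - 1) (fun j =>
    Rmult (Rpow_def.pow (Cmod (twoTermSum (Z.of_nat i.+1) (Z.of_nat j.+1) 4 2 p)) 4)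
     (Rpow_def.pow (dedekind (Z.mul (Z.of_nat i.+1) (Z.of_nat (invmod p j.+1))) p) 2))) =
  weighted_fourth_moment p (F := F) Fcos Fsin.
Proof.
rewrite /weighted_fourth_moment sum_nonzero rsumE; apply: eq_bigr => i _.
rewrite sum_nonzero rsumE; apply: eq_bigr => j _.
rewrite dedekind_dedekind_sum; last by have := ltn_ord j; lia.
by rewrite Fnorm_sq RpowE.
Qed.

Hypothesis harmonic2_le : forall n, harmonic R 2 n <= PI ^+ 2 / 6.

Lemma dedekind_second_moment_le y t K : (1 < y)%N -> trunc_log 2 (p * p) = t -> trunc_log y (p * p) = K ->
  `|\sum_c dedekind_sum R p (c : F) ^+ 2 - 5 / 144 * p%:R ^+ 2| <=
  50 * p%:R * (Rpow_def.pow (Rplus 1 (ln (INR p))) 3 * (t.+1 ^ y * 2 ^ K)%N%:R).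
Proof.
move=> y1 <- <-; have [pi3 pi4] := PI_3_4.
have H1 : harmonic R 1 p <= Rplus 1 (ln (INR p)) by exact: harmonic_le_ln (prime_gt0 p_pr).
have L1 : 1 <= harmonic R 1 p.
  rewrite /harmonic; case: (p) (prime_gt0 p_pr) => // n _; rewrite big_ord_recl expr1n invr1 lerDl.
  by apply: sumr_ge0 => i _; rewrite invr_ge0 exprn_ge0.
have D1 : (1 : R) <= ((trunc_log 2 (p * p)).+1 ^ y * 2 ^ trunc_log y (p * p))%N%:R.
  by rewrite ler1n muln_gt0 !expn_gt0.
have hp : (p./2 * p./2 <= p * p)%N by apply: leq_mul; rewrite leq_half_double -addnn; lia.
rewrite RpowE mulrA.
apply: (dedekind_second_moment p_pr p_gt3 cardF Fp_additive_character pi3 pi4 Fcotangent_bound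
  harmonic2_le (le_trans L1 H1) D1 H1 (fun n => factorization_count_le R n y1 hp)).
Qed.
End PrimeField.
(** The cotangent argument modulo a prime [q] bounds the partial sum up to [q/2]. Choosing [q]
    beyond [2 n + 3], unrelated to [p], covers every length. *)
Lemma harmonic2_le n : harmonic R 2 n <= PI ^+ 2 / 6.
Proof.
have [q qn q_pr] := prime_above (2 * n + 3).
have q3 : (3 < q)%N by lia.
apply: le_trans (harmonic2_half_le q_pr q3).
have nq : (n <= q./2)%N by rewrite geq_half_double -addnn; lia.
rewrite /harmonic -!(big_mkord xpredT (fun i => i.+1%:R ^- 2)) [leRHS](@big_cat_nat _ _ _ n) //= lerDl.
by apply: sumr_ge0 => i _; rewrite invr_ge0 exprn_ge0.
Qed.

Lemma IZR_nat n : n%:R = IZR (Z.of_nat n) :> R.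
Proof. by rewrite -INR_IZR_INZ INRE. Qed.

Definition moment (p : nat) : R := rsum (p - 1) (fun i => rsum (p - 1) (fun j =>
    Rmult (Rpow_def.pow (Cmod (twoTermSum (Z.of_nat i.+1) (Z.of_nat j.+1) 4 2 p)) 4)
     (Rpow_def.pow (dedekind (Z.mul (Z.of_nat i.+1) (Z.of_nat (invmod p j.+1))) p) 2))).

Definition moment_error (p : nat) : R :=
  Rabs (Rminus (moment p) (Rmult (Rdiv (IZR 35) (IZR 144)) (Rpow_def.pow (INR p) 5))).

Lemma moment_error_bound p y (C E : R) : prime p -> (3 < p)%N -> (1 < y)%N -> 0 <= C ->
  (forall t K : nat, Rle (Rpow_def.pow (IZR 2) t) (Rpow_def.pow (INR p) 2) ->
     Rle (Rpow_def.pow (INR y) K) (Rpow_def.pow (INR p) 2) ->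
     Rle (Rmult (Rpow_def.pow (Rplus (IZR 1) (ln (INR p))) 3) (Rmult (Rpow_def.pow (INR t.+1) y) (Rpow_def.pow (IZR 2) K)))
       (Rmult C E)) ->
  (odd p./2 -> moment_error p <= 10 ^+ 9 * C * (INR p ^+ 4 * E)) /\
  moment_error p <= 10 ^+ 9 * C * (INR p ^+ 4 * sqrt (INR p) * E).
Proof.
move=> p_pr p_gt3 y1 C0 CE; pose t := trunc_log 2 (p * p); pose K := trunc_log y (p * p).
pose X : R := Rpow_def.pow (Rplus (IZR 1) (ln (INR p))) 3 * (t.+1 ^ y * 2 ^ K)%N%:R.
have two : IZR 2 = 2%:R :> R by rewrite IZR_nat.
have pp : (0 < p * p)%N by rewrite muln_gt0 prime_gt0.
have XE : X <= C * E.
  have -> : X = Rmult (Rpow_def.pow (Rplus (IZR 1) (ln (INR p))) 3)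
      (Rmult (Rpow_def.pow (INR t.+1) y) (Rpow_def.pow (IZR 2) K)).
    by rewrite /X two !RpowE natrM !natrX !INRE.
  apply/RleP; apply: CE; apply/RleP; rewrite !RpowE ?two INRE.
    by rewrite -!natrX ler_nat -mulnn; exact: trunc_logP.
  by rewrite INRE -!natrX ler_nat -mulnn; exact: trunc_logP.
have p1 : (1 : R) <= p%:R by rewrite ler1n prime_gt0.
have X1 : 1 <= X.
  rewrite /X -[leLHS]mulr1; apply: ler_pM => //.
    have L1 : 1 <= Rplus (IZR 1) (ln (INR p)) by apply/RleP; apply: one_le_add_ln; apply/ssrnat.ltP; exact: prime_gt0.
    rewrite RpowE -[leLHS](expr1n _ 3) lerXn2r ?nnegrE //.
      by rewrite (le_trans ler01 L1).
  by rewrite ler1n muln_gt0 !expn_gt0.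
have HW := dedekind_second_moment_le p_pr p_gt3 harmonic2_le y1 (erefl t) (erefl K).
have meE : moment_error p = `|weighted_fourth_moment p (F := 'F_p) (@Fcos p) (@Fsin p) - 35 / 144 * p%:R ^+ 5|.
  rewrite /moment_error RabsE /moment moment_weighted_fourth_moment // RminusE RmultE RdivE RpowE INRE.
  have [-> ->] : IZR 35 = 35 /\ IZR 144 = 144 :> R by rewrite !IZR_nat.
  by [].
have ac := Fp_additive_character p_pr p_gt3.
have cF := card_Fp p_pr.
split.
  move=> o; rewrite meE; apply: le_trans (weighted_fourth_moment_3mod4 p_pr p_gt3 cF ac X1 HW o) _.
  rewrite INRE -[leRHS]mulrA [C * _]mulrCA; apply: ler_pM.
  - exact: exprn_ge0.
  - by rewrite mulr_ge0 ?exprn_ge0 // (le_trans ler01 X1).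
  - by rewrite ler_weXn2l // ler1n.
  by apply: ler_wpM2l => //; exact: exprn_ge0.
have sq : sqrt (INR p) ^+ 2 = p%:R by rewrite -RpowE pow2_sqrt -?INRE //; exact: pos_INR.
have s0 : 0 <= sqrt (INR p) by apply/RleP; exact: sqrt_pos.
rewrite meE; apply: le_trans (weighted_fourth_moment_any p_pr p_gt3 cF ac X1 HW s0 sq) _.
rewrite INRE -[leRHS]mulrA [C * _]mulrCA; apply: ler_wpM2l; first exact: exprn_ge0.
by apply: ler_wpM2l => //; rewrite mulr_ge0 ?exprn_ge0 // -INRE.
Qed.

Lemma odd_half_of_mod4 p : Nat.modulo p 4 = 3 -> odd p./2.
Proof.
move=> E; have pE := Nat.div_mod_eq p 4; rewrite E in pE.
have -> : p = ((2 * (Nat.div p 4) + 1).*2.+1)%N by rewrite {1}pE plusE multE; lia.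
by rewrite /= uphalf_double addn1 mul2n /= odd_double.
Qed.

Lemma moment_error_stdlib p y (C E : R) : Znumtheory.prime (Z.of_nat p) -> lt 3 p -> lt 1 y -> Rle (IZR 0) C ->
  (forall t K : nat, Rle (Rpow_def.pow (IZR 2) t) (Rpow_def.pow (INR p) 2) ->
     Rle (Rpow_def.pow (INR y) K) (Rpow_def.pow (INR p) 2) ->
     Rle (Rmult (Rpow_def.pow (Rplus (IZR 1) (ln (INR p))) 3) (Rmult (Rpow_def.pow (INR t.+1) y) (Rpow_def.pow (IZR 2) K)))
       (Rmult C E)) ->
  (Nat.modulo p 4 = 3%N -> Rle (moment_error p)
     (Rmult (Rmult (Rpow_def.pow (IZR 10) 9) C) (Rmult (Rpow_def.pow (INR p) 4) E))) /\
  Rle (moment_error p)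
     (Rmult (Rmult (Rpow_def.pow (IZR 10) 9) C) (Rmult (Rmult (Rpow_def.pow (INR p) 4) (sqrt (INR p))) E)).
Proof.
move=> /prime_nat_of_Z p_pr /ssrnat.ltP p3 /ssrnat.ltP y1 /RleP C0 CE.
have [A B] := moment_error_bound p_pr p3 y1 C0 CE.
have ten : IZR 10 = 10%:R :> R by rewrite IZR_nat.
split=> [/odd_half_of_mod4 /A h|]; apply/RleP; rewrite !RpowE ten //.
Qed.
End PrimeField.

Theorem theorem1p1 :
  exists K : R, 0 < K /\
  forall p : nat, prime (Z.of_nat p) -> (3 < p)%nat ->
    let T := rsum (p - 1) (fun i => rsum (p - 1) (fun j =>
               let m := S i in let n := S j in
               Cmod (twoTermSum (Z.of_nat m) (Z.of_nat n) 4 2 p) ^ 4 *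
               dedekind (Z.of_nat m * Z.of_nat (invmod p n)) p ^ 2)) in
    let E := exp (3 * ln (INR p) / ln (ln (INR p))) in
    ((p mod 4 = 3)%nat ->
       Rabs (T - 35 / 144 * INR p ^ 5) <= K * (INR p ^ 4 * E)) /\
    ((p mod 4 = 1)%nat ->
       Rabs (T - 35 / 144 * INR p ^ 5) <= K * (Rpower (INR p) (9 / 2) * E)).
Proof.
destruct divisor_bound_growth as [C [C0 HC]].
exists (10 ^ 9 * C). split; [apply Rmult_lt_0_compat; [apply pow_lt; lra|exact C0]|].
intros p pp p3 T E.
destruct (HC p) as [y [y1 Hy]].
(* The growth estimate asks for [p > 4]; 4 is excluded by its divisor 2. *)
{ enough (p <> 4%nat) by lia. intros ->. destruct pp as [_ pp].
  specialize (pp 2%Z ltac:(lia)). assert (H : (2 | 2)%Z) by (exists 1%Z; reflexivity).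
  assert (H' : (2 | Z.of_nat 4)%Z) by (exists 2%Z; reflexivity).
  destruct pp as [_ _ pp]. specialize (pp 2%Z H H'). destruct pp as [k Hk]. lia. }
destruct (PrimeField.moment_error_stdlib pp p3 y1 (Rlt_le _ _ C0) Hy) as [A B].
split; intros hp; [exact (A hp)|].
(* [B] holds in every residue class modulo 4, so the condition [p mod 4 = 1] does not enter its
   proof. *)
rewrite Rpower_nine_halves; [exact B|].
apply lt_0_INR; lia.
Qed.
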